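(* (a) The closure graph $G_2^{\rm B}$ for congruence bundles of $2\times 2$ complex matrices is as follows. Its vertices (the congruence bundles of $2\times 2$ matrices) are represented by $$0_2,\quad D=\begin{bmatrix}1&0\\0&0\end{bmatrix},\quad I_2,\quad H_2(-1)=\begin{bmatrix}0&1\\-1&0\end{bmatrix},\quad \Gamma_2=\begin{bmatrix}0&-1\\1&1\end{bmatrix},\quad \mathcal B=\left\{\begin{bmatrix}0&1\\\lambda&0\end{bmatrix}\right\}_{\lambda\ne\pm1}.$$ The vertex $\mathcal B$ represents the bundle that consists of all matrices whose congruence canonical forms are $\begin{bmatrix}0&1\\\lambda&0\end{bmatrix}$ with $\lambda\in\mathbb C\setminus\{-1,1\}$ (each nonzero $\lambda$ is determined up to replacement by $\lambda^{-1}$). The other vertices are congruence canonical matrices; the corresponding bundles coincide with their congruence classes. The arrows are exactly $$0_2\to H_2(-1),\quad 0_2\to D,\quad H_2(-1)\to \Gamma_2,\quad D\to\Gamma_2,\quad D\to I_2,\quad \Gamma_2\to\mathcal B,\quad I_2\to\mathcal B.$$ The dimensions of the bundles are: $0$ for $0_2$; $1$ for $H_2(-1)$; $2$ for $D$; $3$ for $\Gamma_2$ and $I_2$; $4$ for $\mathcal B$. (b) The closure graph $G_3^{\rm B}$ for congruence bundles of $3\times 3$ complex matrices is as follows. Its vertices (the congruence bundles of $3\times 3$ matrices) are represented by $$000=0_3,\quad [-1]^20=\begin{bmatrix}0&1&0\\-1&0&0\\0&0&0\end{bmatrix},\quad 100=\operatorname{diag}(1,0,0),\quad 1^20=\begin{bmatrix}0&-1&0\\1&1&0\\0&0&0\end{bmatrix},\quad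 110=\operatorname{diag}(1,1,0),$$ $$[-1]^21=\begin{bmatrix}0&1&0\\-1&0&0\\0&0&1\end{bmatrix},\quad 111=I_3,\quad 0^3=\begin{bmatrix}0&1&0\\0&0&1\\0&0&0\end{bmatrix},\quad 1^21=\begin{bmatrix}0&-1&0\\1&1&0\\0&0&1\end{bmatrix},\quad 1^3=\begin{bmatrix}0&0&1\\0&-1&-1\\1&1&0\end{bmatrix},$$ $$\mathcal B_0=\left\{\begin{bmatrix}0&1&0\\\lambda&0&0\\0&0&0\end{bmatrix}\right\}_{\lambda\ne\pm1},\qquad \mathcal B_1=\left\{\begin{bmatrix}0&1&0\\\mu&0&0\\0&0&1\end{bmatrix}\right\}_{\mu\ne\pm1}.$$ The bundle corresponding to $\mathcal B_0$ consists of all matrices whose congruence canonical forms are $\begin{bmatrix}0&1&0\\\lambda&0&0\\0&0&0\end{bmatrix}$ with $\lambda\in\mathbb C\setminus\{-1,1\}$. The bundle corresponding to $\mathcal B_1$ consists of all matrices whose congruence canonical forms are $\begin{bmatrix}0&1&0\\\mu&0&0\\0&0&1\end{bmatrix}$ with $\mu\in\mathbb C\setminus\{-1,1\}$. (Nonzero $\lambda$ and $\mu$ are determined up to replacement by $\lambda^{-1}$ and $\mu^{-1}$.) The other bundles coincide with the congruence classes of the corresponding canonical matrices. The arrows are exactly $$000\to[-1]^20,\quad 000\to 100,\quad [-1]^20\to 1^20,\quad 100\to 1^20,\quad 100\to 110,$$ $$1^20\to [-1]^21,\quad 1^20\to\mathcal B_0,\quad 110\to\mathcal B_0,\quad 110\to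 111,\quad \mathcal B_0\to 0^3,$$ $$[-1]^21\to 1^21,\quad 111\to 1^3,\quad 0^3\to 1^21,\quad 0^3\to 1^3,\quad 1^21\to\mathcal B_1,\quad 1^3\to\mathcal B_1.$$ The dimensions of the bundles are: $0$ for $000$; $3$ for $[-1]^20$ and $100$; $5$ for $1^20$ and $110$; $6$ for $[-1]^21$, $\mathcal B_0$ and $111$; $7$ for $0^3$; $8$ for $1^21$ and $1^3$; $9$ for $\mathcal B_1$.
   Context: All matrices are over $\mathbb C$. Two $n\times n$ matrices $A,B$ are congruent if $S^TAS=B$ for some nonsingular $S$; the equivalence classes are called congruence classes. Every congruence class of $2\times2$ or $3\times3$ matrices contains exactly one of the matrices displayed in the claim, called its congruence canonical matrix (up to replacement of a nonzero parameter $\lambda$ or $\mu$ by its inverse). Congruence bundles: two square matrices $A$ and $B$ belong to the same congruence bundle if and only if the pencils $A+\lambda A^T$ and $B+\lambda B^T$ belong to the same strict equivalence bundle. Here a pencil $A+\lambda B$ is identified with the matrix pair $(A,B)$, and pairs $(A,B)$, $(A',B')$ are (strictly) equivalent if $RAS=A'$ and $RBS=B'$ for some nonsingular $R,S$. By Kronecker's theorem each pair is equivalent to a direct sum, unique up to permutation of summands, of pairs $(L_r,R_r)$, $(L_r^T,R_r^T)$, and $P_r(\lambda)$ with $r\ge1$ and $\lambda\in\mathbb C\cup\{\infty\}$, where $L_r=[I_{r-1}\ 0]$ and $R_r=[0\ I_{r-1}]$ are $(r-1)\times r$, $P_r(\lambda)=(I_r,J_r(\lambda))$ for $\lambda\in\mathbb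 C$, $P_r(\infty)=(J_r(0),I_r)$, and $J_r(\lambda)$ is the $r\times r$ upper triangular Jordan block. Write the Kronecker canonical form of $(A,B)$ as $\mathcal K\oplus\mathcal P_1(\lambda_1)\oplus\dots\oplus\mathcal P_t(\lambda_t)$ with distinct $\lambda_1,\dots,\lambda_t\in\mathbb C\cup\{\infty\}$, where $\mathcal K$ is a direct sum of pairs $(L_k,R_k)$ and $(L_k^T,R_k^T)$ and each $\mathcal P_i(\lambda_i)$ is a direct sum of pairs $P_k(\lambda_i)$. The strict equivalence bundle of $(A,B)$ consists of all pairs whose Kronecker canonical form is $\mathcal K\oplus\mathcal P_1(\mu_1)\oplus\dots\oplus\mathcal P_t(\mu_t)$ with the same $\mathcal K,\mathcal P_1,\dots,\mathcal P_t$ and distinct $\mu_1,\dots,\mu_t\in\mathbb C\cup\{\infty\}$. The closure graph $G_n^{\rm B}$ for congruence bundles is the directed graph whose vertices represent, in a one-to-one manner, the congruence bundles of $n\times n$ matrices and in which there is a directed path (possibly of length $0$) from the vertex of $\mathcal A$ to the vertex of $\mathcal A'$ if and only if the matrices in $\mathcal A$ can be transformed to matrices in $\mathcal A'$ by arbitrarily small perturbations, i.e. $\mathcal A\subseteq\overline{\mathcal A'}$; it is the Hasse diagram of this order. The dimension of a bundle is its complex dimension as a subset of $\mathbb C^{n\times n}$. The symbols $000$, $[-1]^20$, $1^20$, etc. are merely names of the displayed matrices.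
   Formalization: Congruence bundles are defined with the pencil eigenvalues 1 and -1 kept fixed; under the literal definition I_2 and H_2(-1) (likewise 110 and [-1]^2 0) would lie in one bundle, contradicting the claim that their bundles are distinct congruence classes. *)

(* Defs.v *)
From HB Require Import structures.
From mathcomp Require Import all_boot all_order all_algebra complex.
From mathcomp Require Import all_classical all_reals all_analysis.
From Stdlib Require Import Relation_Operators.

Set Implicit Arguments.
Unset Strict Implicit.
Unset Printing Implicit Defensive.

Import Order.TTheory GRing.Theory Num.Theory.
Import numFieldNormedType.Exports.

Local Open Scope classical_set_scope.
Local Open Scope ring_scope.

(* [R[i]] is the field of complex numbers over the reals [R]. Packing it as a
   [numClosedFieldType] gives access to the topology and the norm that
   MathComp-Analysis attaches to numeric fields (the norm is the modulus). *)
Definition Cplx (R : realType) : numClosedFieldType := R[i].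

Section Congruence.
Variables (K : fieldType) (n : nat).

Definition congruent (A B : 'M[K]_n) : Prop :=
  exists2 S : 'M[K]_n, S \in unitmx & S^T *m A *m S = B.

(* The matrices whose canonical form for congruence belongs to [F], when [F]
   is a set of congruence canonical matrices. *)
Definition congruent_to (F : set 'M[K]_n) : set 'M[K]_n :=
  [set A | exists2 M, F M & congruent A M].

End Congruence.

Section Kronecker.
Variable K : fieldType.

(* In [KP r l], the eigenvalue [l] is an element of K extended with infinity;
   [None] stands for infinity. *)
Inductive kblock := KL of nat | KLT of nat | KP of nat & option K.

Definition kblock_rows (b : kblock) : nat :=
  match b with KL r => r.-1 | KLT r => r | KP r _ => r end.

Definition kblock_cols (b : kblock) : nat :=
  match b with KL r => r | KLT r => r.-1 | KP r _ => r end.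

Definition Lmx r : 'M[K]_(r.-1, r) :=
  \matrix_(i < r.-1, j < r) ((i : nat) == j)%:R.

Definition Rmx r : 'M[K]_(r.-1, r) :=
  \matrix_(i < r.-1, j < r) (i.+1 == j)%:R.

Definition Jmx r (l : K) : 'M[K]_r :=
  \matrix_(i < r, j < r) (l *+ ((i : nat) == j) + (i.+1 == j)%:R).

Definition kblock_pair (b : kblock) :
    'M[K]_(kblock_rows b, kblock_cols b) * 'M[K]_(kblock_rows b, kblock_cols b) :=
  match b return
    'M[K]_(kblock_rows b, kblock_cols b) * 'M[K]_(kblock_rows b, kblock_cols b)
  with
  | KL r => (Lmx r, Rmx r)
  | KLT r => ((Lmx r)^T, (Rmx r)^T)
  | KP r (Some l) => (1%:M, Jmx r l)
  | KP r None => (Jmx r 0, 1%:M)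
  end.

Fixpoint krows (s : seq kblock) : nat :=
  if s is b :: s' then (kblock_rows b + krows s')%N else 0%N.

Fixpoint kcols (s : seq kblock) : nat :=
  if s is b :: s' then (kblock_cols b + kcols s')%N else 0%N.

Fixpoint ksum (s : seq kblock) :
    'M[K]_(krows s, kcols s) * 'M[K]_(krows s, kcols s) :=
  match s return 'M[K]_(krows s, kcols s) * 'M[K]_(krows s, kcols s) with
  | [::] => (0, 0)
  | b :: s' => (block_mx (kblock_pair b).1 0 0 (ksum s').1,
                block_mx (kblock_pair b).2 0 0 (ksum s').2)
  end.

Definition strictly_equivalent m n (p q : 'M[K]_(m, n) * 'M[K]_(m, n)) : Prop :=
  exists R : 'M[K]_m, exists S : 'M[K]_n,
    [/\ R \in unitmx, S \in unitmx, R *m p.1 *m S = q.1 & R *m p.2 *m S = q.2].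

Definition has_kronecker_form m n (p : 'M[K]_(m, n) * 'M[K]_(m, n))
    (s : seq kblock) : Prop :=
  exists e : (krows s = m) * (kcols s = n),
    strictly_equivalent p (castmx e (ksum s).1, castmx e (ksum s).2).

(* A Kronecker form with its eigenvalues forgotten: the sizes of the singular
   blocks, and for each of the distinct eigenvalues the sizes of the blocks
   with this eigenvalue. *)
Record kron_type := KronType {
  kt_L : seq nat;
  kt_LT : seq nat;
  kt_P : seq (seq nat) }.

Definition kron_type_ok (t : kron_type) : bool :=
  [&& all (leq 1) (kt_L t), all (leq 1) (kt_LT t)
    & all (fun p => (p != [::]) && all (leq 1) p) (kt_P t)].

Definition kron_blocks (t : kron_type) (lam : seq (option K)) : seq kblock :=
  [seq KL r | r <- kt_L t] ++ [seq KLT r | r <- kt_LT t] ++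
  flatten [seq [seq KP r pl.2 | r <- pl.1] | pl <- zip (kt_P t) lam].

(* For [E] empty, this says that [p] and [q] belong to the same strict
   equivalence bundle. In general, the eigenvalues in [E] are distinguished:
   they cannot be replaced by other eigenvalues, nor replace them. *)
Definition same_strict_bundle (E : seq (option K)) m n
    (p q : 'M[K]_(m, n) * 'M[K]_(m, n)) : Prop :=
  exists t : kron_type, exists lam mu : seq (option K),
    [/\ kron_type_ok t,
        [/\ size lam = size (kt_P t), uniq lam
          & has_kronecker_form p (kron_blocks t lam)],
        [/\ size mu = size (kt_P t), uniq mu
          & has_kronecker_form q (kron_blocks t mu)]
      & forall i, (i < size lam)%N ->
          (nth None lam i \in E) || (nth None mu i \in E) ->
          nth None lam i = nth None mu i].

(* The eigenvalues 1 and -1 of the pencil (A, A^T), which are the fixed points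
   of the involution l |-> 1 / l on its spectrum, are distinguished. This is
   needed: by [strict_bundle_I2_H2] below, I_2 and H_2(-1) would otherwise be
   in one bundle, which would then not be a congruence class. *)
Definition congr_bundle n (A : 'M[K]_n) : set 'M[K]_n :=
  [set B | same_strict_bundle [:: Some 1; Some (-1)] (A, A^T) (B, B^T)].

End Kronecker.

Section Dimension.
Variables (R : realType) (n : nat).
Local Notation C := (Cplx R).

(* [phi] parametrizes a nonempty d-dimensional embedded complex submanifold of
   C^(n x n): it is holomorphic on the open set U, immersive, injective, and a
   homeomorphism from U onto its image. Differentiability is over C. *)
Definition holomorphic_embedding d (U : set 'rV[C]_d)
    (phi : 'rV[C]_d -> 'M[C]_n) : Prop :=
  [/\ open U /\ U !=set0,
      forall u, U u -> differentiable phi u /\ injective ('d phi u),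
      set_inj U phi
    & forall V, open V -> V `<=` U ->
        exists2 W, open W & phi @` V = W `&` phi @` U].

Definition contains_submanifold (X : set 'M[C]_n) (d : nat) : Prop :=
  exists U : set 'rV[C]_d, exists2 phi : 'rV[C]_d -> 'M[C]_n,
    holomorphic_embedding U phi & phi @` U `<=` X.

(* The dimension of a nonempty subset of a complex manifold is the maximum of
   the dimensions of the complex submanifolds contained in it (Lojasiewicz,
   Introduction to Complex Analytic Geometry). *)
Definition has_complex_dim (X : set 'M[C]_n) (d : nat) : Prop :=
  contains_submanifold X d /\
  forall d', contains_submanifold X d' -> (d' <= d)%N.

End Dimension.

(* The directed graph with vertices [V] and arrows [arrow], in which a vertex
   [v] represents the set [bun v], is the closure graph for congruence bundles:
   the vertices represent the congruence bundles one-to-one, directed paths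
   express inclusion in the closure, and the graph is the Hasse diagram. *)
Definition is_closure_graph (R : realType) (n : nat) (V : Type)
    (bun : V -> set 'M[Cplx R]_n) (arrow : rel V) : Prop :=
  [/\ injective bun,
      range bun = range (@congr_bundle (Cplx R) n),
      forall v w, clos_refl_trans V arrow v w <-> bun v `<=` closure (bun w)
    & forall v w, arrow v w <->
        [/\ v <> w, bun v `<=` closure (bun w)
          & forall u, bun v `<=` closure (bun u) ->
              bun u `<=` closure (bun w) -> u = v \/ u = w]].

Definition mxrows (K : pzRingType) (n : nat) (s : seq (seq K)) : 'M[K]_n :=
  \matrix_(i < n, j < n) (nth [::] s i)`_j.

Inductive vertex2 := v_0 | v_D | v_I | v_H | v_Gamma | v_B.

Definition H2 (K : fieldType) (l : K) : 'M[K]_2 :=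
  mxrows 2 [:: [:: 0; 1];
               [:: l; 0]].

Definition canon2 (K : fieldType) (v : vertex2) : set 'M[K]_2 :=
  match v with
  | v_0 => [set 0]
  | v_D => [set mxrows 2 [:: [:: 1; 0];
                             [:: 0; 0]]]
  | v_I => [set 1%:M]
  | v_H => [set H2 (-1)]
  | v_Gamma => [set mxrows 2 [:: [:: 0; -1];
                                 [:: 1; 1]]]
  | v_B => [set M | exists l : K, [/\ l != 1, l != -1 & M = H2 l]]
  end.

Arguments canon2 K v : clear implicits.

Definition arrow2 (v w : vertex2) : bool :=
  match v, w with
  | v_0, v_H | v_0, v_D
  | v_H, v_Gamma | v_D, v_Gamma | v_D, v_I
  | v_Gamma, v_B | v_I, v_B => true
  | _, _ => false
  end.

Definition dim2 (v : vertex2) : nat :=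
  match v with
  | v_0 => 0 | v_H => 1 | v_D => 2 | v_Gamma => 3 | v_I => 3 | v_B => 4
  end.

(* [m1] abbreviates [-1] and [sq] a square: v_m1sq_0 is the vertex [-1]^2 0,
   v_1sq_1 is 1^2 1, v_0cube is 0^3, and so on. *)
Inductive vertex3 :=
  v_000 | v_m1sq_0 | v_100 | v_1sq_0 | v_110 | v_m1sq_1 | v_111
| v_0cube | v_1sq_1 | v_1cube | v_B0 | v_B1.

Definition HB0 (K : fieldType) (l : K) : 'M[K]_3 :=
  mxrows 3 [:: [:: 0; 1; 0];
               [:: l; 0; 0];
               [:: 0; 0; 0]].

Definition HB1 (K : fieldType) (m : K) : 'M[K]_3 :=
  mxrows 3 [:: [:: 0; 1; 0];
               [:: m; 0; 0];
               [:: 0; 0; 1]].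

Definition canon3 (K : fieldType) (v : vertex3) : set 'M[K]_3 :=
  match v with
  | v_000 => [set 0]
  | v_m1sq_0 => [set mxrows 3 [:: [:: 0; 1; 0];
                                  [:: -1; 0; 0];
                                  [:: 0; 0; 0]]]
  | v_100 => [set mxrows 3 [:: [:: 1; 0; 0];
                               [:: 0; 0; 0];
                               [:: 0; 0; 0]]]
  | v_1sq_0 => [set mxrows 3 [:: [:: 0; -1; 0];
                                 [:: 1; 1; 0];
                                 [:: 0; 0; 0]]]
  | v_110 => [set mxrows 3 [:: [:: 1; 0; 0];
                               [:: 0; 1; 0];
                               [:: 0; 0; 0]]]
  | v_m1sq_1 => [set mxrows 3 [:: [:: 0; 1; 0];
                                  [:: -1; 0; 0];
                                  [:: 0; 0; 1]]]
  | v_111 => [set 1%:M]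
  | v_0cube => [set mxrows 3 [:: [:: 0; 1; 0];
                                 [:: 0; 0; 1];
                                 [:: 0; 0; 0]]]
  | v_1sq_1 => [set mxrows 3 [:: [:: 0; -1; 0];
                                 [:: 1; 1; 0];
                                 [:: 0; 0; 1]]]
  | v_1cube => [set mxrows 3 [:: [:: 0; 0; 1];
                                 [:: 0; -1; -1];
                                 [:: 1; 1; 0]]]
  | v_B0 => [set M | exists l : K, [/\ l != 1, l != -1 & M = HB0 l]]
  | v_B1 => [set M | exists m : K, [/\ m != 1, m != -1 & M = HB1 m]]
  end.

Arguments canon3 K v : clear implicits.

Definition arrow3 (v w : vertex3) : bool :=
  match v, w with
  | v_000, v_m1sq_0 | v_000, v_100
  | v_m1sq_0, v_1sq_0 | v_100, v_1sq_0 | v_100, v_110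
  | v_1sq_0, v_m1sq_1 | v_1sq_0, v_B0 | v_110, v_B0 | v_110, v_111
  | v_B0, v_0cube
  | v_m1sq_1, v_1sq_1 | v_111, v_1cube | v_0cube, v_1sq_1 | v_0cube, v_1cube
  | v_1sq_1, v_B1 | v_1cube, v_B1 => true
  | _, _ => false
  end.

Definition dim3 (v : vertex3) : nat :=
  match v with
  | v_000 => 0
  | v_m1sq_0 => 3 | v_100 => 3
  | v_1sq_0 => 5 | v_110 => 5
  | v_m1sq_1 => 6 | v_B0 => 6 | v_111 => 6
  | v_0cube => 7
  | v_1sq_1 => 8 | v_1cube => 8
  | v_B1 => 9
  end.

(* The two members of the family with parameters [l] and [l'] are congruent
   exactly when [l = l'] or both are nonzero and inverse to each other. *)
Definition determined_up_to_inverse (K : fieldType) n (F : K -> 'M[K]_n) : Prop :=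
  forall l l' : K, l != 1 -> l != -1 -> l' != 1 -> l' != -1 ->
    (congruent (F l) (F l') <-> l = l' \/ (l != 0 /\ l' = l^-1)).

Lemma strict_bundle_I2_H2 (K : fieldType) :
  same_strict_bundle [::] ((1%:M : 'M[K]_2), 1%:M^T) (H2 (-1), (H2 (-1))^T).
Proof.
have ksumE (l : K) : ksum [:: KP 1 (Some l); KP 1 (Some l)] = (1%:M, l%:M).
  have JE : Jmx 1 l = l%:M.
    by apply/matrixP=> i j; rewrite !ord1 !mxE /= addr0.
  have E0 (a : K) : (0 : 'M[K]_0) = a%:M by apply/matrixP=> -[].
  have blockE (a : K) : block_mx (a%:M : 'M[K]_1) 0 0
      (block_mx (a%:M : 'M[K]_1) 0 0 (0 : 'M[K]_0)) = a%:M.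
    by rewrite (E0 a) -!scalar_mx_block.
  by rewrite /= JE; congr pair; exact: blockE.
exists (KronType [::] [::] [:: [:: 1; 1]%N]), [:: Some 1], [:: Some (-1)].
have eN : (H2 (-1))^T *m H2 (-1) = 1%:M :> 'M[K]_2.
  apply/matrixP=> -[[|[|i]] // hi] [[|[|j]] // hj];
  by rewrite !(mxE, big_ord_recl, big_ord0) /=
             ?mulrNN ?(mulr0, mul0r, mulr1) ?(addr0, add0r).
have HT : (H2 (-1))^T = - H2 (-1) :> 'M[K]_2.
  apply/matrixP=> -[[|[|i]] // hi] [[|[|j]] // hj];
  by rewrite !mxE /= ?oppr0 ?opprK.
split=> //; split=> //; exists (erefl, erefl); rewrite ksumE !castmx_id.
  by exists 1%:M, 1%:M; rewrite /= ?unitmx1 ?trmx1 !mulmx1.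
exists (H2 (-1))^T, 1%:M; rewrite unitmx1 !mulmx1 /=; split=> //.
  by case/mulmx1_unit: eN.
by rewrite {2}HT mulmxN eN [RHS]raddfN.
Qed.

(* Main.v *)
Require Import Defs.
From HB Require Import structures.
From mathcomp Require Import all_boot all_order all_algebra complex.
From mathcomp Require Import all_classical all_reals all_analysis.
From mathcomp Require Import ring.

Set Implicit Arguments.
Unset Strict Implicit.
Unset Printing Implicit Defensive.

Import Order.TTheory GRing.Theory Num.Theory.
Import numFieldNormedType.Exports.

Local Open Scope classical_set_scope.
Local Open Scope ring_scope.

(* Let S = A + A^T and K = A - A^T. In size 3, K x is the cross product of x with a
   multiple of the axial vector k of A, and the congruence by P acts by
   S |-> P^T S P and k |-> adj(P) k. The bundle of A is determined by the rank of S
   together with a level: k = 0; k <> 0 and S k = 0; S k <> 0 and k^T S k = 0;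
   k^T S k <> 0. In size 2, the level only records whether K = 0. The sets
   {rank S <= r} and {level <= l} are closed, and the closure order is exactly the
   product order on the pairs (rank, level): along each arrow of the graph a linear
   perturbation of the canonical matrix lies in the larger bundle.
   That these sets are the congruence bundles follows, in one direction, from explicit
   Kronecker forms; in the other one, from the ranks of the pencil (A, A^T) at the
   points of the projective line, which a bundle preserves up to moving the free
   eigenvalues.
   A bundle of dimension d contains the graph of a rational map over d of the linear
   coordinates (for J_3(0), d rational coordinates). Conversely, linearizing at a
   canonical matrix the equations of {rank S <= r} and {level <= l} leaves only d free
   entries in a tangent matrix, which bounds the dimension of any submanifold. *)

(** Why ranks of the pencil detect the level in size 3: since K k = 0, one has [8 det (A^T - l A) =
    (1 - l)^3 det S + (1 - l) (1 + l)^2 k^T S k]. If det S = 0, the pencil is regular exactly at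
    level 3. If det S <> 0, it has an eigenvalue other than 1 exactly at level 3, and such an
    eigenvalue is never -1. There remain levels 1 and 2 with S of rank 2, where the pencil is
    singular: at level 1, k spans a common kernel of A and A^T and the pencil drops to rank 1 at
    some point; at level 2 it has rank 2 everywhere. The upper bounds for the dimension concern
    arbitrary submanifolds, at whose points the bundle is not known to be smooth. Each point is
    therefore moved to its canonical matrix by a congruence, and the limits of difference quotients
    of the submanifold are tested against the equations, divided by the step length. The only choice
    with a parameter is in the two families; everywhere else the checks are on explicit matrices
    with numerical entries, and the combinatorics of the graphs is a computation on the tables of
    ranks and levels. *)

Notation M2 a b c d := (mxrows 2 [:: [:: a; b]; [:: c; d]]).
Notation M3 a b c d e f g h i :=
  (mxrows 3 [:: [:: a; b; c]; [:: d; e; f]; [:: g; h; i]]).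

Definition f0 : 'I_2 := @Ordinal 2 0 isT.
Definition f1 : 'I_2 := @Ordinal 2 1 isT.
Definition e0 : 'I_3 := @Ordinal 3 0 isT.
Definition e1 : 'I_3 := @Ordinal 3 1 isT.
Definition e2 : 'I_3 := @Ordinal 3 2 isT.

Lemma ord2P (P : 'I_2 -> Prop) : P f0 -> P f1 -> forall i, P i.
Proof.
by move=> P0 P1 [[|[|//]] hi]; [move: P0|move: P1]; congr P; exact: val_inj.
Qed.

Lemma ord3P (P : 'I_3 -> Prop) : P e0 -> P e1 -> P e2 -> forall i, P i.
Proof.
by move=> P0 P1 P2 [[|[|[|//]]] hi]; [move: P0|move: P1|move: P2]; congr P;
  exact: val_inj.
Qed.

Lemma big_ord2 (V : nmodType) (F : 'I_2 -> V) : \sum_i F i = F f0 + F f1.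
Proof.
by rewrite !big_ord_recl big_ord0 addr0; congr (F _ + F _); exact: val_inj.
Qed.

Lemma big_ord3 (V : nmodType) (F : 'I_3 -> V) : \sum_i F i = F e0 + F e1 + F e2.
Proof.
rewrite !big_ord_recl big_ord0 addr0 addrA.
by congr (F _ + F _ + F _); exact: val_inj.
Qed.

Lemma matrix2P (K : Type) (A B : 'M[K]_2) :
  A f0 f0 = B f0 f0 -> A f0 f1 = B f0 f1 ->
  A f1 f0 = B f1 f0 -> A f1 f1 = B f1 f1 -> A = B.
Proof.
by move=> h1 h2 h3 h4; apply/matrixP; apply: ord2P; apply: ord2P.
Qed.

Lemma matrix3P (K : Type) (A B : 'M[K]_3) :
  A e0 e0 = B e0 e0 -> A e0 e1 = B e0 e1 -> A e0 e2 = B e0 e2 ->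
  A e1 e0 = B e1 e0 -> A e1 e1 = B e1 e1 -> A e1 e2 = B e1 e2 ->
  A e2 e0 = B e2 e0 -> A e2 e1 = B e2 e1 -> A e2 e2 = B e2 e2 -> A = B.
Proof.
by move=> *; apply/matrixP; apply: ord3P; apply: ord3P.
Qed.

Lemma M2_eta (K : pzRingType) (A : 'M[K]_2) :
  A = M2 (A f0 f0) (A f0 f1) (A f1 f0) (A f1 f1).
Proof. by apply: matrix2P; rewrite !mxE. Qed.

Lemma M3_eta (K : pzRingType) (A : 'M[K]_3) :
  A = M3 (A e0 e0) (A e0 e1) (A e0 e2) (A e1 e0) (A e1 e1) (A e1 e2)
         (A e2 e0) (A e2 e1) (A e2 e2).
Proof. by apply: matrix3P; rewrite !mxE. Qed.

Lemma det2E (K : comNzRingType) (A : 'M[K]_2) :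
  \det A = A f0 f0 * A f1 f1 - A f0 f1 * A f1 f0.
Proof.
rewrite (expand_det_row _ f0) big_ord2 /cofactor !det_mx11 !mxE /= expr0 expr1.
have -> : lift f0 0 = f1 by exact: val_inj.
have -> : lift f1 0 = f0 by exact: val_inj.
by rewrite mul1r mulN1r mulrN.
Qed.

Lemma det3E (K : comNzRingType) (A : 'M[K]_3) :
  \det A = A e0 e0 * (A e1 e1 * A e2 e2 - A e1 e2 * A e2 e1)
         - A e0 e1 * (A e1 e0 * A e2 e2 - A e1 e2 * A e2 e0)
         + A e0 e2 * (A e1 e0 * A e2 e1 - A e1 e1 * A e2 e0).
Proof.
rewrite (expand_det_row _ e0) big_ord3 /cofactor !det2E !mxE /=.
have L00 : lift e0 f0 = e1 by exact: val_inj.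
have L01 : lift e0 f1 = e2 by exact: val_inj.
have L10 : lift e1 f0 = e0 by exact: val_inj.
have L11 : lift e1 f1 = e2 by exact: val_inj.
have L20 : lift e2 f0 = e0 by exact: val_inj.
have L21 : lift e2 f1 = e1 by exact: val_inj.
by rewrite L00 L01 L10 L11 L20 L21; ring.
Qed.

Lemma congruentI (K : fieldType) n (P A B : 'M[K]_n) :
  \det P != 0 -> P^T *m A *m P = B -> congruent A B.
Proof. by move=> P0 PB; exists P; rewrite // unitmxE unitfE. Qed.

Lemma congruent_refl (K : fieldType) n (A : 'M[K]_n) : congruent A A.
Proof. by exists 1%:M; rewrite ?unitmx1 // trmx1 mul1mx mulmx1. Qed.

Lemma congruent_sym (K : fieldType) n (A B : 'M[K]_n) :
  congruent A B -> congruent B A.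
Proof.
move=> [P Pu <-]; exists (invmx P); first by rewrite unitmx_inv.
by rewrite -!mulmxA mulmxV // mulmx1 trmx_inv mulmxA mulVmx ?unitmx_tr // mul1mx.
Qed.

Lemma congruent_trans (K : fieldType) n (B A C : 'M[K]_n) :
  congruent A B -> congruent B C -> congruent A C.
Proof.
move=> [P Pu <-] [Q Qu <-]; exists (P *m Q); first by rewrite unitmx_mul Pu.
by rewrite trmx_mul !mulmxA.
Qed.

Ltac fieldx := field; repeat (apply/andP; split).
Ltac mxring2 := apply: matrix2P; rewrite !(mxE, big_ord2) /=; try by [ring|fieldx].
Ltac detnz := rewrite ?det2E ?det3E !mxE /=;
  rewrite ?(mulr0, mul0r, mulr1, mul1r, oppr0, subr0, sub0r,
            add0r, addr0)
    ?(oppr_eq0, invr_eq0, oner_eq0) //.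

(** * Canonical forms for congruence *)

(** Over an algebraically closed field the quadratic form of [A] has an isotropic vector, taken as
    first basis vector. If [a != 0], it is [(x, 1)] with [x] a root of [a x^2 + (b + c) x + d]. *)
Lemma isotropic2 (C : numClosedFieldType) (A : 'M[C]_2) :
  exists p q r, congruent A (M2 0 p q r).
Proof.
rewrite (M2_eta A); move: (A f0 f0) (A f0 f1) (A f1 f0) (A f1 f1) => a b c d.
have [->|a0] := eqVneq a 0; first by exists b, c, d; exact: congruent_refl.
set s := sqrtC ((b + c) ^+ 2 - 4 * a * d).
set x := (- (b + c) + s) / (2 * a).
exists (a * x + c), (a * x + b), a.
apply: (@congruentI _ _ (M2 x 1 1 0)); first by detnz.
have s2 : s ^+ 2 = (b + c) ^+ 2 - 4 * a * d by rewrite sqrtCK.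
mxring2.
(* The factor [4 * a] completes the square: the expression becomes [(2 a x + b + c)^2] minus the
   discriminant. *)
suff : 4 * a * ((x * a + 1 * c) * x + (x * b + 1 * d) * 1) = 0.
  move/eqP; rewrite !mulf_eq0 (negPf a0) pnatr_eq0 /= => /eqP; exact.
have -> : 4 * a * ((x * a + 1 * c) * x + (x * b + 1 * d) * 1) =
  (2 * a * x + (b + c)) ^+ 2 - ((b + c) ^+ 2 - 4 * a * d) by ring.
by rewrite -s2 /x; field.
Qed.

Lemma sqr_neq0_exists (C : numClosedFieldType) (r : C) :
  r != 0 -> exists2 s, s != 0 & r = s ^+ 2.
Proof. by exists (sqrtC r); rewrite ?sqrtC_eq0 ?sqrtCK. Qed.

Lemma canon2_exists (C : numClosedFieldType) (A : 'M[C]_2) :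
  exists v, congruent_to (canon2 C v) A.
Proof.
have [p [q [r]]] := isotropic2 A.
have H v (B M : 'M[C]_2) : congruent A B -> canon2 C v M -> congruent B M ->
    exists v, congruent_to (canon2 C v) A.
  by move=> AB vM BM; exists v, M => //; exact: congruent_trans AB BM.
have [pq|pq] := eqVneq (p + q) 0.
  have -> : q = - p by apply/eqP; rewrite -addr_eq0 addrC pq.
  have [->|p0] := eqVneq p 0.
    have [->|r0] := eqVneq r 0.
      move=> h; apply: (H v_0 _ _ h erefl).
      by have -> : M2 0 0 (- 0) 0 = 0 :> 'M[C]_2; [mxring2|exact: congruent_refl].
    have [s s0 ->] := sqr_neq0_exists r0.
    move=> h; apply: (H v_D _ _ h erefl).
    by apply: (@congruentI _ _ (M2 0 1 s^-1 0)); [detnz|mxring2].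
  have [->|r0] := eqVneq r 0.
    move=> h; apply: (H v_H _ _ h erefl).
    apply: (@congruentI _ _ (M2 p^-1 0 0 1)).
      by detnz.
    by mxring2.
  have [s s0 ->] := sqr_neq0_exists r0.
  move=> h; apply: (H v_Gamma _ _ h erefl).
  apply: (@congruentI _ _ (M2 (- s / p) 0 0 s^-1)); last by mxring2.
  by detnz; rewrite !mulf_neq0 ?oppr_eq0 ?invr_eq0.
(* The first basis vector pairs with the second with total weight [p + q], so adding a multiple of
   it to the second one removes [r]. *)
move=> h0; have h : congruent A (M2 0 p q 0).
  apply: (congruent_trans h0).
  apply: (@congruentI _ _ (M2 1 (- r / (p + q)) 0 1)); last by mxring2.
  by detnz.
(* Exchanging the basis vectors swaps [p] and [q]; one of them is nonzero and can be scaled to 1,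
   which leaves the parameter [q1 / p1]. *)
have [[p1 q1] {h0 h p q pq r}[h pq1 p10]] : exists pq : C * C,
    [/\ congruent A (M2 0 pq.1 pq.2 0), pq.1 + pq.2 != 0 & pq.1 != 0].
  have [p0|p0] := eqVneq p 0; last by exists (p, q).
  have q0 : q != 0 by rewrite p0 add0r in pq.
  exists (q, p); split => //=; last by rewrite addrC.
  apply: (congruent_trans h); apply: (@congruentI _ _ (M2 0 1 1 0)); last by mxring2.
  by detnz.
move: h pq1 p10 => /= h pq p0.
have h' : congruent A (H2 (q1 / p1)).
  apply: (congruent_trans h); apply: (@congruentI _ _ (M2 p1^-1 0 0 1)); last by mxring2.
  by detnz.
(* Ratio 1 is a symmetric hyperbolic plane, with orthonormal basis [(1, 1/2)], [('i, - 'i/2)]. Ratio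
   -1 is excluded by [p + q != 0]. *)
have [l1|l1] := eqVneq (q1 / p1) 1.
  apply: (H v_I _ _ h' erefl); rewrite l1.
  apply: (@congruentI _ _ (M2 1 'i 2^-1 (- 'i / 2))).
    detnz.
    have -> : - 'i / 2 - 'i * 2^-1 = - 'i :> C by field.
    by rewrite oppr_eq0 neq0Ci.
  mxring2.
  have -> : ('i * 0 + - 'i / 2 * 1) * 'i + ('i * 1 + - 'i / 2 * 0) * (- 'i / 2) = - 'i ^+
      2 :> C by field.
  by rewrite sqrCi opprK.
apply: (H v_B _ _ h'); last exact: congruent_refl.
exists (q1 / p1); split => //; apply: contra pq => /eqP qp.
by rewrite -[X in X + _]mulr1 -[q1](divfK p0) qp mulN1r mulr1 subrr.
Qed.

Lemma M3_congruence (K : comNzRingType) (a b c d e f g h i p q r s t u v w x : K) :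
  (M3 p q r s t u v w x)^T *m M3 a b c d e f g h i *m M3 p q r s t u v w x =
  M3 ((p * a + s * d + v * g) * p + (p * b + s * e + v * h) * s + (p * c + s * f + v * i)
      * v)
     ((p * a + s * d + v * g) * q + (p * b + s * e + v * h) * t + (p * c + s * f + v * i)
         * w)
     ((p * a + s * d + v * g) * r + (p * b + s * e + v * h) * u + (p * c + s * f + v * i)
         * x)
     ((q * a + t * d + w * g) * p + (q * b + t * e + w * h) * s + (q * c + t * f + w * i)
         * v)
     ((q * a + t * d + w * g) * q + (q * b + t * e + w * h) * t + (q * c + t * f + w * i)
         * w)
     ((q * a + t * d + w * g) * r + (q * b + t * e + w * h) * u + (q * c + t * f + w * i)
         * x)
     ((r * a + u * d + x * g) * p + (r * b + u * e + x * h) * s + (r * c + u * f + x * i)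
         * v)
     ((r * a + u * d + x * g) * q + (r * b + u * e + x * h) * t + (r * c + u * f + x * i)
         * w)
     ((r * a + u * d + x * g) * r + (r * b + u * e + x * h) * u + (r * c + u * f + x * i)
         * x).
Proof. by apply: matrix3P; rewrite !(mxE, big_ord3). Qed.

Ltac mxcongr3 := rewrite M3_congruence;
  congr (mxrows _ [:: [:: _; _; _]; [:: _; _; _]; [:: _; _; _]]);
  rewrite ?(mulr0, mul0r, mulr1, mul1r) ?(subr0, sub0r, add0r, addr0);
  try by [ring|fieldx].

Definition bordered (K : pzRingType) (A : 'M[K]_2) (z : K) : 'M[K]_3 :=
  M3 (A f0 f0) (A f0 f1) 0 (A f1 f0) (A f1 f1) 0 0 0 z.

Lemma bordered_congruent (K : fieldType) (A B : 'M[K]_2) (z s : K) :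
  s != 0 -> congruent A B -> congruent (bordered A z) (bordered B (s ^+ 2 * z)).
Proof.
move=> s0 [P]; rewrite unitmxE unitfE => P0 <-.
apply: (@congruentI _ _ (bordered P s)).
  rewrite det3E !mxE /= !(mulr0, mul0r, subr0, addr0).
  by move: P0; rewrite det2E => P0; rewrite mulrA (mulrA (P f0 f1)) -mulrBl mulf_neq0.
by rewrite /bordered M3_congruence !(mxE, big_ord2) /=;
  congr (mxrows _ [:: [:: _; _; _]; [:: _; _; _]; [:: _; _; _]]); ring.
Qed.

(** The type of the direct sum with [[0]] or [[1]]. Ten vertices are reached; the two others,
    [v_0cube] and [v_1cube], are the indecomposable ones and arise in [canon3_isotropic]. *)
Definition bordered_vertex (v : vertex2) (z : bool) : vertex3 :=
  match v, z with
  | v_0, false => v_000 | v_D, false => v_100 | v_I, false => v_110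
  | v_H, false => v_m1sq_0 | v_Gamma, false => v_1sq_0 | v_B, false => v_B0
  | v_0, true => v_100 | v_D, true => v_110 | v_I, true => v_111
  | v_H, true => v_m1sq_1 | v_Gamma, true => v_1sq_1 | v_B, true => v_B1
  end.

Lemma eq_congruent (K : fieldType) n (A B : 'M[K]_n) : A = B -> congruent A B.
Proof. by move=> ->; exact: congruent_refl. Qed.

Lemma canon3_bordered (C : numClosedFieldType) (v : vertex2) (z : bool) M :
  canon2 C v M -> congruent_to (canon3 C (bordered_vertex v z)) (bordered M z%:R).
Proof.
case: v z => [] [] /=; try by move=> ->; eexists; first (by []);
  apply: eq_congruent; rewrite /bordered; apply: matrix3P; rewrite !mxE.
all: try by move=> [l [l1 lm1 ->]]; eexists; [by exists l; split | apply: eq_congruent;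
    rewrite /bordered; apply: matrix3P; rewrite !mxE].
all: move=> ->; eexists; first (by []).
(* In the last two cases a zero diagonal entry precedes the new 1, and the coordinates have to be
   permuted. *)
- by rewrite /bordered !mxE; apply: (@congruentI _ _ (M3 0 1 0 0 0 1 1 0 0));
    [detnz|mxcongr3].
- by rewrite /bordered !mxE; apply: (@congruentI _ _ (M3 1 0 0 0 0 1 0 1 0));
    [detnz|mxcongr3].
Qed.

Lemma congruent_to_trans (K : fieldType) n (F : set 'M[K]_n) A B :
  congruent A B -> congruent_to F B -> congruent_to F A.
Proof. by move=> AB [M FM BM]; exists M => //; exact: congruent_trans AB BM. Qed.

Lemma canon3_bordered_exists (C : numClosedFieldType) (A : 'M[C]_2) z :
  exists v, congruent_to (canon3 C v) (bordered A z).
Proof.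
have [v [M vM AM]] := canon2_exists A.
have [->|z0] := eqVneq z 0.
  exists (bordered_vertex v false).
  apply: (congruent_to_trans _ (canon3_bordered false vM)).
  by have := bordered_congruent 0 (oner_neq0 C) AM; rewrite mulr0.
exists (bordered_vertex v true).
apply: (congruent_to_trans _ (canon3_bordered true vM)).
have [s s0 zs] := sqr_neq0_exists z0.
have := bordered_congruent z (invr_neq0 s0) AM.
by rewrite zs exprVn mulVf ?expf_neq0.
Qed.

(** The last row equals the last column, so the third basis vector has the same left and right
    orthogonal. As [z != 0], that plane is a complement; the form on it is the Schur complement of
    [z]. *)
Lemma canon3_split (C : numClosedFieldType) (a b c d x y z : C) : z != 0 ->
  exists v, congruent_to (canon3 C v) (M3 a b x c d y x y z).
Proof.
move=> z0.
have [v] := canon3_bordered_exists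
  (M2 (a - x ^+ 2 / z) (b - x * y / z) (c - x * y / z) (d - y ^+ 2 / z)) z.
rewrite /bordered !mxE /= => vA; exists v; apply: congruent_to_trans vA.
apply: (@congruentI _ _ (M3 1 0 0 0 1 0 (- x / z) (- y / z) 1)); first by detnz.
by mxcongr3.
Qed.

(** An anisotropic vector is moved to the third place, where it splits off. The basis vectors and
    the sums of the third one with the second or the first are tried in turn; if all are isotropic,
    only [b] is left. *)
Lemma canon3_sym_exists (C : numClosedFieldType) (a b x d y z : C) :
  exists v, congruent_to (canon3 C v) (M3 a b x b d y x y z).
Proof.
have [->|z0] := eqVneq z 0; last exact: canon3_split.
have [->|d0] := eqVneq d 0; last first.
  have [v vA] := canon3_split a x x 0 b y d0.
  exists v; apply: congruent_to_trans vA.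
  by apply: (@congruentI _ _ (M3 1 0 0 0 0 1 0 1 0)); [detnz|mxcongr3].
have [->|a0] := eqVneq a 0; last first.
  have [v vA] := canon3_split 0 y y 0 x b a0.
  exists v; apply: congruent_to_trans vA.
  by apply: (@congruentI _ _ (M3 0 0 1 0 1 0 1 0 0)); [detnz|mxcongr3].
have n2 (t : C) : t != 0 -> 2 * t != 0 by move=> t0; rewrite mulf_neq0 ?pnatr_eq0.
have [->|y0] := eqVneq y 0; last first.
  have [v vA] := canon3_split 0 b b 0 (b + x) y (n2 _ y0).
  exists v; apply: congruent_to_trans vA.
  by apply: (@congruentI _ _ (M3 1 0 0 0 1 1 0 0 1)); [detnz|mxcongr3].
have [->|x0] := eqVneq x 0; last first.
  have [v vA] := canon3_split 0 b b 0 x b (n2 _ x0).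
  exists v; apply: congruent_to_trans vA.
  by apply: (@congruentI _ _ (M3 1 0 1 0 1 0 0 0 1)); [detnz|mxcongr3].
have [v vA] := canon3_bordered_exists (M2 0 b b 0) 0.
exists v; apply: congruent_to_trans vA.
have -> : M3 0 b 0 b 0 0 0 0 0 = bordered (M2 0 b b 0) 0 :> 'M[C]_3.
  by apply: matrix3P; rewrite !mxE.
exact: congruent_refl.
Qed.

(** This is level 2: the third vector is proportional to k, with S k <> 0 because [x != 0] and k^T S
    k = 0. Here [det S = - 8 d x^2], so [d] decides between rank 2 and rank 3, that is, between
    [v_0cube] and [v_1cube]. *)
Lemma canon3_isotropic (C : numClosedFieldType) (a b c d x : C) :
  x != 0 -> b != c -> exists v, congruent_to (canon3 C v) (M3 a b x c d 0 x 0 0).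
Proof.
move=> x0; rewrite -subr_eq0 => bc.
have [->|d0] := eqVneq d 0.
  exists v_0cube; eexists; first by [].
  (* Adding multiples of the third vector to the first two changes [b] and [c] by the same amount,
     so [c] can be cleared while [b - c] stays. *)
  apply: (@congruent_trans _ _ (M3 0 (b - c) x 0 0 0 x 0 0)).
    apply: (@congruentI _ _ (M3 1 0 0 0 1 0 (- a / (2 * x)) (- c / x) 1)); first by detnz.
    by mxcongr3.
  apply: (@congruentI _ _ (M3 0 x^-1 0 (- x / (b - c)) 0 (x / (b - c)) 1 0 0)).
    detnz.
    by rewrite !mulf_neq0 ?oppr_eq0 ?mulf_neq0 ?invr_eq0.
  by mxcongr3.
have [s s0 ds] := sqr_neq0_exists (d0 : d != 0).
exists v_1cube; eexists; first by [].
set e := (b - c) / 2.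
have e_neq0 : e != 0 by rewrite mulf_neq0 ?invr_eq0 ?pnatr_eq0.
(* Here the shift is chosen to cancel the symmetric part of [b] and [c], leaving the skew entries
   [e] and [- e]. *)
apply: (@congruent_trans _ _ (M3 0 e x (- e) d 0 x 0 0)).
  apply: (@congruentI _ _ (M3 1 0 0 0 1 0 (- a / (2 * x)) (- (b + c) / (2 * x)) 1));
      first by detnz.
  by rewrite /e; mxcongr3.
(* The middle vector is scaled by ['i / s] because the central entry of the target is -1 while
   [d = s ^+ 2]. *)
apply: (@congruentI _ _ (M3 0 0 (s / ('i * e)) 0 ('i / s) 0 ('i * e / (s * x)) 0 0)).
  detnz.
  by rewrite !mulf_neq0 ?oppr_eq0 ?mulf_neq0 ?invr_eq0 ?mulf_neq0 ?neq0Ci.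
have i0 : 'i != 0 :> C by exact: neq0Ci.
rewrite ds; mxcongr3.
have -> : 'i / s * s ^+ 2 * ('i / s) = 'i ^+ 2 by fieldx.
exact: sqrCi.
Qed.

(** If the linear form [(x, y)] is nonzero, a change of the first two basis vectors makes its second
    coefficient vanish and level 2 applies; if it is zero, the matrix is a direct sum with [[0]]. *)
Lemma canon3_singular (C : numClosedFieldType) (a b c d x y : C) :
  b != c -> exists v, congruent_to (canon3 C v) (M3 a b x c d y x y 0).
Proof.
move=> bc; have [->|x0] := eqVneq x 0; last first.
  have bc' : b - a * y / x != c - a * y / x by rewrite (can_eq (subrK _)).
  have [v vA] :=
    canon3_isotropic a (d - (b + c) * y / x + a * (y / x) ^+ 2) x0 bc'.
  exists v; apply: congruent_to_trans vA.
  by apply: (@congruentI _ _ (M3 1 (- y / x) 0 0 1 0 0 0 1)); [detnz|mxcongr3].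
have [->|y0] := eqVneq y 0; last first.
  have cb : c != b by rewrite eq_sym.
  have [v vA] := canon3_isotropic d a y0 cb.
  exists v; apply: congruent_to_trans vA.
  by apply: (@congruentI _ _ (M3 0 1 0 1 0 0 0 0 1)); [detnz|mxcongr3].
have [v] := canon3_bordered_exists (M2 a b c d) 0.
by rewrite /bordered !mxE; exists v.
Qed.

Lemma canon3_exists (C : numClosedFieldType) (A : 'M[C]_3) :
  exists v, congruent_to (canon3 C v) A.
Proof.
rewrite (M3_eta A).
move: (A e0 e0) (A e0 e1) (A e0 e2) (A e1 e0) (A e1 e1) (A e1 e2)
      (A e2 e0) (A e2 e1) (A e2 e2) => {A} a b c d e f g h i.
(* The third column of the change of basis is the axial vector of the skew part. *)
have main (b' c' d' a' x y x' y' z : C) : x' = x -> y' = y -> b' != c' ->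
    exists v, congruent_to (canon3 C v) (M3 a' b' x c' d' y x' y' z).
  move=> -> -> bc; have [->|z0] := eqVneq z 0; first exact: canon3_singular.
  exact: canon3_split.
have step P B : \det P != 0 -> P^T *m M3 a b c d e f g h i *m P = B ->
    (exists v, congruent_to (canon3 C v) B) ->
    exists v, congruent_to (canon3 C v) (M3 a b c d e f g h i).
  by move=> P0 PB [v vB]; exists v; apply: congruent_to_trans vB; exact: congruentI PB.
(* A nonzero coordinate of the axial vector k lets k replace the corresponding standard basis
   vector. As K k = 0, the last row and column then agree, and the skew part survives only in the
   first two coordinates; these are the premises of [main]. *)
have [bd|bd] := eqVneq b d; last first.
  apply: (step (M3 1 0 (f - h) 0 1 (g - c) 0 0 (b - d)) _ _ (M3_congruence _ _ _ _ _ _ _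
      _ _ _ _ _ _ _ _ _ _ _)).
    by detnz; rewrite subr_eq0.
  by apply: main; [ring..|apply: contra bd => /eqP h1; apply/eqP; move: h1; rewrite
      ?(mulr0, mul0r, mulr1, mul1r, addr0, add0r)].
have [gc|gc] := eqVneq g c; last first.
  apply: (step (M3 0 1 (f - h) 0 0 (g - c) 1 0 (b - d)) _ _ (M3_congruence _ _ _ _ _ _ _
      _ _ _ _ _ _ _ _ _ _ _)).
    by detnz; rewrite subr_eq0.
  by apply: main; [ring..|apply: contra gc => /eqP h1; apply/eqP; move: h1; rewrite
      ?(mulr0, mul0r, mulr1, mul1r, addr0, add0r)].
have [fh|fh] := eqVneq f h; last first.
  apply: (step (M3 0 0 (f - h) 1 0 (g - c) 0 1 (b - d)) _ _ (M3_congruence _ _ _ _ _ _ _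
      _ _ _ _ _ _ _ _ _ _ _)).
    by detnz; rewrite subr_eq0.
  by apply: main; [ring..|apply: contra fh => /eqP h1; apply/eqP; move: h1; rewrite
      ?(mulr0, mul0r, mulr1, mul1r, addr0, add0r)].
rewrite bd gc fh; exact: canon3_sym_exists.
Qed.

(** * Rank and level *)

Definition symrank (K : fieldType) n (A : 'M[K]_n) : nat := \rank (A + A^T)%R.

Lemma sym_congruent (K : comNzRingType) n (P A : 'M[K]_n) :
  (P^T *m A *m P) + (P^T *m A *m P)^T = P^T *m (A + A^T) *m P.
Proof. by rewrite !trmx_mul trmxK mulmxA mulmxDr mulmxDl. Qed.

Lemma symrank_congruent (K : fieldType) n (A B : 'M[K]_n) :
  congruent A B -> symrank B = symrank A.
Proof.
move=> [P Pu <-]; rewrite /symrank sym_congruent mxrankMfree ?row_free_unit //.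
by rewrite -mxrank_tr trmx_mul trmxK mxrankMfree ?row_free_unit // mxrank_tr.
Qed.

Definition skew_level (K : fieldType) n (A : 'M[K]_n) : nat := (A != A^T).

Lemma skew_level_congruent (K : fieldType) n (A B : 'M[K]_n) :
  congruent A B -> skew_level B = skew_level A.
Proof.
move=> [P Pu <-]; rewrite /skew_level !trmx_mul trmxK mulmxA.
congr (~~ _ : nat); apply/eqP/eqP => [E|<-//].
apply: (can_inj (mulKmx (_ : P^T \in unitmx))); first by rewrite unitmx_tr.
exact: (can_inj (mulmxK Pu)).
Qed.

Lemma adj3E (K : comNzRingType) (A : 'M[K]_3) : \adj A =
  M3 (A e1 e1 * A e2 e2 - A e1 e2 * A e2 e1) (A e0 e2 * A e2 e1 - A e0 e1 * A e2 e2)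
     (A e0 e1 * A e1 e2 - A e0 e2 * A e1 e1)
     (A e1 e2 * A e2 e0 - A e1 e0 * A e2 e2) (A e0 e0 * A e2 e2 - A e0 e2 * A e2 e0)
     (A e0 e2 * A e1 e0 - A e0 e0 * A e1 e2)
     (A e1 e0 * A e2 e1 - A e1 e1 * A e2 e0) (A e0 e1 * A e2 e0 - A e0 e0 * A e2 e1)
     (A e0 e0 * A e1 e1 - A e0 e1 * A e1 e0).
Proof.
have L00 : lift e0 f0 = e1 by exact: val_inj.
have L01 : lift e0 f1 = e2 by exact: val_inj.
have L10 : lift e1 f0 = e0 by exact: val_inj.
have L11 : lift e1 f1 = e2 by exact: val_inj.
have L20 : lift e2 f0 = e0 by exact: val_inj.
have L21 : lift e2 f1 = e1 by exact: val_inj.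
by apply: matrix3P; rewrite !mxE /cofactor det2E !mxE /= ?(L00, L01, L10, L11, L20, L21);
    ring.
Qed.

Lemma adj3M (K : comNzRingType) (A B : 'M[K]_3) : \adj (A *m B) = \adj B *m \adj A.
Proof.
by rewrite !adj3E; apply: matrix3P; rewrite !(mxE, big_ord3) /= ?(mxE, big_ord3); ring.
Qed.

(** The adjugate reverses products and preserves invertibility, so the Gaussian factorization of [S]
    reduces the claim to [pid_mx], whose adjugate vanishes for rank 0 and 1 and has a corner entry 1
    for rank 2 and 3. *)
Lemma mxrank_le1 (K : fieldType) (S : 'M[K]_3) : (\rank S <= 1)%N = (\adj S == 0).
Proof.
have adj_unit (U : 'M[K]_3) : U \in unitmx -> \adj U \in unitmx.
  move=> Uu; have := mul_mx_adj U; move: Uu; rewrite unitmxE => Ud UE.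
  have : (\det U)%:M \in @unitmx K 3.
    by rewrite unitmxE det_scalar unitrX.
  by rewrite -UE unitmx_mul => /andP[].
have E0 (L U M : 'M[K]_3) : L \in unitmx -> U \in unitmx ->
    (L *m M *m U == 0) = (M == 0).
  move=> Lu Uu; apply/eqP/eqP => [E|->]; last by rewrite mulmx0 mul0mx.
  apply: (can_inj (mulKmx Lu)); apply: (can_inj (mulmxK Uu)).
  by rewrite E mulmx0 mul0mx.
rewrite -{2}(mulmx_ebase S) !adj3M mulmxA E0 ?adj_unit ?row_ebase_unit ?col_ebase_unit //.
have : (\rank S <= 3)%N by exact: rank_leq_row.
rewrite adj3E !mxE /=; case: (\rank S) => [|[|[|[|//]]]] _ /=.
- by apply/esym/eqP; apply: matrix3P; rewrite !mxE /= ?mulr0 ?mul0r ?subr0.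
- by apply/esym/eqP; apply: matrix3P; rewrite !mxE /= ?mulr0 ?mul0r ?subr0.
- apply/esym/negP => /eqP /matrixP /(_ e2 e2); rewrite !mxE /= mulr1 mulr0 subr0.
  by move/eqP; rewrite oner_eq0.
- apply/esym/negP => /eqP /matrixP /(_ e2 e2); rewrite !mxE /= mulr1 mulr0 subr0.
  by move/eqP; rewrite oner_eq0.
Qed.

Lemma mxrank_ltn (K : fieldType) n (S : 'M[K]_n.+1) : (\rank S <= n)%N = (\det S == 0).
Proof.
rewrite -[RHS]negbK -unitfE -unitmxE -row_full_unit /row_full.
by rewrite eqn_leq rank_leq_row leqNgt.
Qed.

Definition axial (K : pzRingType) (A : 'M[K]_3) : 'cV[K]_3 :=
  \col_i [tuple A e1 e2 - A e2 e1; A e2 e0 - A e0 e2; A e0 e1 - A e1 e0]`_i.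

Definition axial_level (K : fieldType) (A : 'M[K]_3) : nat :=
  if axial A == 0 then 0 else
  if (A + A^T) *m axial A == 0 then 1 else
  if (axial A)^T *m (A + A^T) *m axial A == 0 then 2 else 3.

(** Since [x^T K y] is the scalar product of k with the cross product of x and y, this dualizes the
    rule that the cross product of [P x] and [P y] is [adj(P)^T] applied to that of x and y. *)
Lemma axial_congruent (K : comNzRingType) (P A : 'M[K]_3) :
  axial (P^T *m A *m P) = \adj P *m axial A.
Proof.
rewrite adj3E; apply/matrixP => i j; rewrite (ord1 j) => {j}; move: i.
by apply: ord3P; rewrite !(mxE, big_ord3) /=; ring.
Qed.

(** As [P *m \adj P] is scalar, S k becomes [\det P *: P^T S k] and k^T S k is multiplied by
    [\det P ^+ 2]; none of the vanishing conditions changes. *)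
Lemma axial_level_congruent (K : fieldType) (A B : 'M[K]_3) :
  congruent A B -> axial_level B = axial_level A.
Proof.
move=> [P Pu <-]; rewrite /axial_level axial_congruent sym_congruent.
have Pd : \det P != 0 by rewrite -unitfE -unitmxE.
have SkE : P^T *m (A + A^T) *m P *m (\adj P *m axial A) =
    \det P *: (P^T *m ((A + A^T) *m axial A)).
  by rewrite -!mulmxA (mulmxA P) mul_mx_adj mul_scalar_mx !scalemxAr.
have qE : (\adj P *m axial A)^T *m (P^T *m (A + A^T) *m P) *m (\adj P *m axial A) =
    (\det P ^+ 2) *: ((axial A)^T *m (A + A^T) *m axial A).
  rewrite -mulmxA SkE -scalemxAr trmx_mul !mulmxA -(mulmxA _ _ P^T) -trmx_mul.
  by rewrite mul_mx_adj tr_scalar_mx mul_mx_scalar -!scalemxAl scalerA.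
have adjP0 : (\adj P *m axial A == 0) = (axial A == 0).
  apply/eqP/eqP => [/(congr1 (mulmx P))|->]; last by rewrite mulmx0.
  rewrite mulmxA mul_mx_adj mul_scalar_mx mulmx0 => /eqP.
  by rewrite scaler_eq0 (negPf Pd) => /eqP.
have Pt0 : (P^T *m ((A + A^T) *m axial A) == 0) = ((A + A^T) *m axial A == 0).
  apply/eqP/eqP => [E|->]; last by rewrite mulmx0.
  apply: (can_inj (mulKmx (_ : P^T \in unitmx))); first by rewrite unitmx_tr.
  by rewrite E mulmx0.
by rewrite adjP0 SkE qE !scaler_eq0 expf_eq0 (negPf Pd) /= Pt0.
Qed.

Lemma axial_level_le (K : fieldType) (A : 'M[K]_3) :
  [/\ (axial_level A <= 0)%N = (axial A == 0),
      (axial_level A <= 1)%N = ((A + A^T) *m axial A == 0),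
      (axial_level A <= 2)%N = ((axial A)^T *m (A + A^T) *m axial A == 0)
    & (axial_level A <= 3)%N].
Proof.
rewrite /axial_level -mulmxA.
have : axial A == 0 -> (A + A^T) *m axial A == 0 by move/eqP->; rewrite mulmx0.
have : (A + A^T) *m axial A == 0 -> (axial A)^T *m ((A + A^T) *m axial A) == 0.
  by move/eqP->; rewrite mulmx0.
case: (axial A == 0); case: (_ *m axial A == 0); case: (_ == 0) => //= h1 h2;
  by [have := h1 isT|have := h2 isT].
Qed.

(** * Polynomial equations for rank and level *)

Definition vanish (K : nmodType) (s : seq K) : bool := all (pred1 0) s.

Lemma vanishN (K : nmodType) (s : seq K) i : s`_i != 0 -> ~~ vanish s.
Proof.
move=> si; apply/allPn; exists s`_i => //.
by apply: mem_nth; case: ltnP si => // /(nth_default 0) ->; rewrite eqxx.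
Qed.

Lemma eq_mx0_2 (K : nmodType) (A : 'M[K]_2) :
  (A == 0) = [&& A f0 f0 == 0, A f0 f1 == 0, A f1 f0 == 0 & A f1 f1 == 0].
Proof.
apply/eqP/and4P => [->|[/eqP a /eqP b /eqP c /eqP d]]; first by rewrite !mxE.
by apply: matrix2P; rewrite mxE.
Qed.

Lemma eq_mx0_3 (K : nmodType) (A : 'M[K]_3) :
  (A == 0) = all (fun i => all (fun j => A i j == 0) [:: e0; e1; e2]) [:: e0; e1; e2].
Proof.
apply/eqP/idP => [->|]; first by rewrite /= !mxE !eqxx.
rewrite /= !andbT => /and3P[/and3P[/eqP? /eqP? /eqP?] /and3P[/eqP? /eqP? /eqP?]
  /and3P[/eqP? /eqP? /eqP?]].
by apply: matrix3P; rewrite mxE.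
Qed.

Lemma eq_col0_3 (K : nmodType) (u : 'cV[K]_3) :
  (u == 0) = [&& u e0 0 == 0, u e1 0 == 0 & u e2 0 == 0].
Proof.
apply/eqP/and3P => [->|[/eqP a /eqP b /eqP c]]; first by rewrite !mxE.
apply/matrixP => i j; rewrite (ord1 j) mxE; move: i; exact: ord3P.
Qed.

Notation syment A i j := (A i j + A j i).
Notation skewent A i j := (A i j - A j i).

(** The empty list for large [r] expresses a bound that every matrix satisfies; the other lists of
    polynomials below follow the same convention. *)
Definition rank_polys2 (K : pzRingType) (r : nat) (A : 'M[K]_2) : seq K :=
  let a := syment A f0 f0 in let b := syment A f0 f1 in let c := syment A f1 f1 in
  match r with 0 => [:: a; b; c] | 1 => [:: a * c - b * b] | _ => [::] end.

Definition level_polys2 (K : pzRingType) (l : nat) (A : 'M[K]_2) : seq K :=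
  match l with 0 => [:: skewent A f0 f1] | _ => [::] end.

Lemma symrank2_le (K : fieldType) (A : 'M[K]_2) (r : nat) :
  (symrank A <= r)%N = vanish (rank_polys2 r A).
Proof.
rewrite /symrank; case: r => [|[|r]] /=.
- rewrite leqn0 mxrank_eq0 eq_mx0_2 !mxE (addrC (A f1 f0)) andbT.
  by case: (_ + A f1 f0 == 0); rewrite //= andbF.
- by rewrite mxrank_ltn det2E !mxE andbT (addrC (A f1 f0)).
- by apply: leq_trans (rank_leq_row _) _.
Qed.

Lemma skew_level2_le (K : fieldType) (A : 'M[K]_2) (l : nat) :
  (skew_level A <= l)%N = vanish (level_polys2 l A).
Proof.
rewrite /skew_level; case: l => [|l] /=; last by apply: leq_trans (leq_b1 _) _.
rewrite leqn0 eqb0 negbK andbT subr_eq0; apply/eqP/eqP => [E|E]; first by rewrite [in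
    LHS]E mxE.
by apply: matrix2P; rewrite !mxE.
Qed.

(* For the symmetric matrix [[a, z, y], [z, b, x], [y, x, c]]: its entries, its
   2 x 2 minors, its determinant. *)
Definition minors3 (K : pzRingType) (r : nat) (a b c x y z : K) : seq K :=
  match r with
  | 0 => [:: a; b; c; x; y; z]
  | 1 => [:: b * c - x * x; a * c - y * y; a * b - z * z;
             y * z - a * x; z * x - b * y; x * y - c * z]
  | 2 => [:: a * (b * c - x * x) - z * (z * c - x * y) + y * (z * x - b * y)]
  | _ => [::]
  end.

Definition rank_polys3 (K : pzRingType) (r : nat) (A : 'M[K]_3) : seq K :=
  minors3 r (syment A e0 e0) (syment A e1 e1) (syment A e2 e2)
    (syment A e1 e2) (syment A e0 e2) (syment A e0 e1).

(* For the same matrix S and the vector k = (u, v, w): k, S k, k^T S k. *)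
Definition axial_polys (K : pzRingType) (l : nat) (a b c x y z u v w : K) : seq K :=
  match l with
  | 0 => [:: u; v; w]
  | 1 => [:: a * u + z * v + y * w; z * u + b * v + x * w; y * u + x * v + c * w]
  | 2 => [:: (a * u + z * v + y * w) * u + (z * u + b * v + x * w) * v
             + (y * u + x * v + c * w) * w]
  | _ => [::]
  end.

Definition level_polys3 (K : pzRingType) (l : nat) (A : 'M[K]_3) : seq K :=
  axial_polys l (syment A e0 e0) (syment A e1 e1) (syment A e2 e2)
    (syment A e1 e2) (syment A e0 e2) (syment A e0 e1)
    (skewent A e1 e2) (skewent A e2 e0) (skewent A e0 e1).

Lemma rank_polys3_M3 (K : pzRingType) r (a b c d e f g h i : K) :
  rank_polys3 r (M3 a b c d e f g h i) =
  minors3 r (a + a) (e + e) (i + i) (f + h) (c + g) (b + d).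
Proof. by rewrite /rank_polys3 !mxE. Qed.

Lemma level_polys3_M3 (K : pzRingType) l (a b c d e f g h i : K) :
  level_polys3 l (M3 a b c d e f g h i) =
  axial_polys l (a + a) (e + e) (i + i) (f + h) (c + g) (b + d) (f - h) (g - c) (b - d).
Proof. by rewrite /level_polys3 !mxE. Qed.

Lemma symrank3_le (K : fieldType) (A : 'M[K]_3) (r : nat) :
  (symrank A <= r)%N = vanish (rank_polys3 r A).
Proof.
rewrite /symrank; case: r => [|[|[|r]]].
- rewrite leqn0 mxrank_eq0 eq_mx0_3 /= !mxE !andbT.
  rewrite (addrC (A e1 e0)) (addrC (A e2 e0)) (addrC (A e2 e1)).
  do 6?[case: (_ == 0) => //=]; by rewrite ?(andbT, andbF).
- rewrite mxrank_le1 adj3E eq_mx0_3 /vanish /= !mxE /= !andbT.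
  rewrite (addrC (A e1 e0)) (addrC (A e2 e0)) (addrC (A e2 e1)).
  set a := A e0 e0 + _; set b := A e1 e1 + _; set c := A e2 e2 + _.
  set x := A e1 e2 + _; set y := A e0 e2 + _; set z := A e0 e1 + _.
  have -> : x * y - z * c = x * y - c * z by ring.
  have -> : y * x - z * c = x * y - c * z by ring.
  have -> : z * x - y * b = z * x - b * y by ring.
  have -> : z * y - a * x = y * z - a * x by ring.
  do 6?[case: (_ == 0) => //=]; by rewrite ?(andbT, andbF).
- rewrite mxrank_ltn det3E /vanish /= !mxE !andbT.
  rewrite (addrC (A e1 e0)) (addrC (A e2 e0)) (addrC (A e2 e1)).
  by congr (_ == 0); ring.
- by apply: leq_trans (rank_leq_row _) _.
Qed.

Lemma axial_level3_le (K : fieldType) (A : 'M[K]_3) (l : nat) :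
  (axial_level A <= l)%N = vanish (level_polys3 l A).
Proof.
have [h0 h1 h2 h3] := axial_level_le A; case: l => [|[|[|l]]].
- by rewrite h0 eq_col0_3 !mxE /vanish /= andbT.
- rewrite h1 eq_col0_3 !(mxE, big_ord3) /vanish /= andbT.
  by rewrite (addrC (A e1 e0)) (addrC (A e2 e0)) (addrC (A e2 e1)).
- rewrite h2 -mulmxA /vanish /= andbT.
  set M := (_ *m _); have -> : (M == 0) = (M 0 0 == 0).
    apply/eqP/eqP => [->|M0]; first by rewrite mxE.
    by apply/matrixP => i j; rewrite !ord1 M0 mxE.
  rewrite !(mxE, big_ord3) /= (addrC (A e1 e0)) (addrC (A e2 e0)) (addrC (A e2 e1)).
  by congr (_ == 0); ring.
- by apply: leq_trans h3 _.
Qed.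

Ltac vanish_ring :=
  rewrite ?rank_polys3_M3 ?level_polys3_M3 /vanish /= ?mxE /= ?andbT //; repeat
      (apply/andP; split);
  apply/eqP; by [ring|fieldx].

(** * Rank and level of the canonical matrices *)

Definition rk3 (v : vertex3) : nat :=
  match v with
  | v_000 | v_m1sq_0 => 0 | v_100 | v_1sq_0 | v_m1sq_1 => 1
  | v_110 | v_B0 | v_0cube | v_1sq_1 => 2 | v_111 | v_1cube | v_B1 => 3
  end.

(** Twelve of the sixteen pairs (rank, level) occur. S = 0 excludes levels 2 and 3; if S has rank 1,
    then S k <> 0 forces k^T S k <> 0, which excludes level 2; if S is invertible, k <> 0 forces S k
    <> 0, which excludes level 1. *)
Definition lv3 (v : vertex3) : nat :=
  match v with
  | v_000 | v_100 | v_110 | v_111 => 0 | v_m1sq_0 | v_1sq_0 | v_B0 => 1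
  | v_0cube | v_1cube => 2 | v_m1sq_1 | v_1sq_1 | v_B1 => 3
  end.

Definition rk2 (v : vertex2) : nat :=
  match v with v_0 | v_H => 0 | v_D | v_Gamma => 1 | v_I | v_B => 2 end.

Definition lv2 (v : vertex2) : nat :=
  match v with v_0 | v_D | v_I => 0 | v_H | v_Gamma | v_B => 1 end.

(** For explicit matrices the lower bound is certified by one polynomial: [i] is its index in the
    list and [x] its value in a factored form. The three lemmas that follow have the same use. *)
Lemma symrank2P (K : fieldType) (A : 'M[K]_2) r i x :
  vanish (rank_polys2 r.+1 A) -> (rank_polys2 r A)`_i = x -> x != 0 ->
  symrank A = r.+1.
Proof.
move=> h1 hx x0; apply/eqP; rewrite eqn_leq symrank2_le h1 /= ltnNge symrank2_le.
by apply: (@vanishN _ _ i); rewrite hx.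
Qed.

Lemma skew_level2P (K : fieldType) (A : 'M[K]_2) l i x :
  vanish (level_polys2 l.+1 A) -> (level_polys2 l A)`_i = x -> x != 0 ->
  skew_level A = l.+1.
Proof.
move=> h1 hx x0; apply/eqP; rewrite eqn_leq skew_level2_le h1 /= ltnNge skew_level2_le.
by apply: (@vanishN _ _ i); rewrite hx.
Qed.

Lemma symrank3P (K : fieldType) (A : 'M[K]_3) r i x :
  vanish (rank_polys3 r.+1 A) -> (rank_polys3 r A)`_i = x -> x != 0 ->
  symrank A = r.+1.
Proof.
move=> h1 hx x0; apply/eqP; rewrite eqn_leq symrank3_le h1 /= ltnNge symrank3_le.
by apply: (@vanishN _ _ i); rewrite hx.
Qed.

Lemma axial_level3P (K : fieldType) (A : 'M[K]_3) l i x :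
  vanish (level_polys3 l.+1 A) -> (level_polys3 l A)`_i = x -> x != 0 ->
  axial_level A = l.+1.
Proof.
move=> h1 hx x0; apply/eqP; rewrite eqn_leq axial_level3_le h1 /= ltnNge axial_level3_le.
by apply: (@vanishN _ _ i); rewrite hx.
Qed.

Ltac rank0 := abstract (apply/eqP; rewrite -leqn0 ?symrank2_le ?symrank3_le; vanish_ring).
Ltac level0 :=
  abstract (apply/eqP; rewrite -leqn0 ?skew_level2_le ?axial_level3_le; vanish_ring).
Ltac invS P i x :=
  apply: (@P _ _ _ i x); [abstract vanish_ring | 
    abstract (rewrite ?rank_polys3_M3 ?level_polys3_M3 /= ?mxE /=; by [ring|fieldx]) |
    repeat first [assumption | apply: mulf_neq0 | apply: expf_neq0
      | rewrite oppr_eq0 | rewrite invr_eq0 | by rewrite pnatr_eq0]].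

Lemma canon2_inv (C : numClosedFieldType) v M : canon2 C v M ->
  symrank M = rk2 v /\ skew_level M = lv2 v.
Proof.
have nz (l : C) : l != 1 -> l != -1 -> 1 - l != 0 /\ 1 + l != 0.
  by move=> l1 lm1; rewrite subr_eq0 eq_sym l1 addrC addr_eq0 lm1.
case: v => /=.
- by move=> ->; split; [rank0|level0].
- by move=> ->; split; [invS symrank2P 0%N (2%:R : C)|level0].
- by move=> ->; split; [invS symrank2P 0%N (4%:R : C)|level0].
- by move=> ->; split; [rank0|invS skew_level2P 0%N (2%:R : C)].
- by move=> ->; split; [invS symrank2P 2%N (2%:R : C)|invS skew_level2P 0%N (-2%:R : C)].
- move=> [l [l1 lm1 ->]]; have [h1 h2] := nz _ l1 lm1; split.
    by invS symrank2P 0%N (- (1 + l) ^+ 2).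
  by invS skew_level2P 0%N (1 - l).
Qed.

Lemma canon3_inv (C : numClosedFieldType) v M : canon3 C v M ->
  symrank M = rk3 v /\ axial_level M = lv3 v.
Proof.
have nz (l : C) : l != 1 -> l != -1 -> 1 - l != 0 /\ 1 + l != 0.
  by move=> l1 lm1; rewrite subr_eq0 eq_sym l1 addrC addr_eq0 lm1.
case: v => /=.
- by move=> ->; split; [rank0|level0].
- by move=> ->; split; [rank0|invS axial_level3P 2%N (2%:R : C)].
- by move=> ->; split; [invS symrank3P 0%N (2%:R : C)|level0].
- by move=> ->; split; [invS symrank3P 1%N (2%:R : C)|invS axial_level3P 2%N (-2%:R : C)].
- by move=> ->; split; [invS symrank3P 2%N (4%:R : C)|level0].
- by move=> ->; split; [invS symrank3P 2%N (2%:R : C)|invS axial_level3P 0%N (8%:R : C)].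
- by move=> ->; split; [invS symrank3P 0%N (8%:R : C)|level0].
- by move=> ->; split; [invS symrank3P 0%N (-1%:R : C)|invS axial_level3P 1%N (2%:R : C)].
- by move=> ->; split; [invS symrank3P 0%N (4%:R : C)|invS axial_level3P 0%N (8%:R : C)].
- by move=> ->; split; [invS symrank3P 0%N (8%:R : C)|invS axial_level3P 2%N (-4%:R : C)].
- move=> [l [l1 lm1 ->]]; have [h1 h2] := nz _ l1 lm1; split.
    by invS symrank3P 2%N (- (1 + l) ^+ 2).
  by invS axial_level3P 2%N (1 - l).
- move=> [l [l1 lm1 ->]]; have [h1 h2] := nz _ l1 lm1; split.
    by invS symrank3P 0%N (-2%:R * (1 + l) ^+ 2).
  by invS axial_level3P 0%N (2%:R * (1 - l) ^+ 2).
Qed.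

(** Every matrix has some canonical form and both invariants are constant under congruence, so the
    converse inclusion only needs that no two vertices share the pair (rank, level). The same holds
    in size 3. *)
Lemma congruent_to_canon2 (C : numClosedFieldType) v :
  congruent_to (canon2 C v) =
  [set A | symrank A = rk2 v /\ skew_level A = lv2 v].
Proof.
apply/seteqP; split => A /=.
  move=> [M vM AM]; have [<- <-] := canon2_inv vM.
  by rewrite (symrank_congruent AM) (skew_level_congruent AM).
move=> [Ar Al]; have [w [M wM AM]] := canon2_exists A.
suff -> : v = w by exists M.
have [] := canon2_inv wM.
rewrite (symrank_congruent AM) (skew_level_congruent AM) Ar Al.
by case: v w {Ar Al wM} => [] [].
Qed.

Lemma congruent_to_canon3 (C : numClosedFieldType) v :
  congruent_to (canon3 C v) =
  [set A | symrank A = rk3 v /\ axial_level A = lv3 v].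
Proof.
apply/seteqP; split => A /=.
  move=> [M vM AM]; have [<- <-] := canon3_inv vM.
  by rewrite (symrank_congruent AM) (axial_level_congruent AM).
move=> [Ar Al]; have [w [M wM AM]] := canon3_exists A.
suff -> : v = w by exists M.
have [] := canon3_inv wM.
rewrite (symrank_congruent AM) (axial_level_congruent AM) Ar Al.
by case: v w {Ar Al wM} => [] [].
Qed.

(** * Parameters of the families *)

Lemma inverse_parameter (K : fieldType) (l l' : K) :
  l' * (1 - l) ^+ 2 = l * (1 - l') ^+ 2 -> l = l' \/ l != 0 /\ l' = l^-1.
Proof.
(* The function [l / (1 - l)^2] is invariant under inversion of [l]; the difference of two of its
   values, with denominators cleared, has exactly these factors. *)
move=> E; have : (l - l') * (1 - l * l') = 0.
  by transitivity (l * (1 - l') ^+ 2 - l' * (1 - l) ^+ 2); [ring|rewrite E subrr].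
move/eqP; rewrite mulf_eq0 !subr_eq0 => /orP[/eqP|/eqP ll]; first by left.
have l0 : l != 0 by apply/eqP => l0; move/eqP: ll; rewrite l0 mul0r oner_eq0.
by right; split => //; apply: (mulfI l0); rewrite -ll divff.
Qed.

(** The determinant [- l] is multiplied by [\det P ^+ 2] and the skew entry [1 - l] by [\det P], so
    [l / (1 - l)^2] is preserved. *)
Lemma congruent_H2_parameter (K : fieldType) (P : 'M[K]_2) l l' :
  P^T *m H2 l *m P = H2 l' -> l = l' \/ l != 0 /\ l' = l^-1.
Proof.
move=> E; apply: inverse_parameter.
have E1 : l' = \det P ^+ 2 * l.
  have := congr1 determinant E; rewrite !det_mulmx det_tr !det2E !mxE /= !(mul0r, sub0r,
      mul1r) => h.
  by apply: oppr_inj; rewrite -h; ring.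
have E2 : 1 - l' = \det P * (1 - l).
  have /matrixP h := E.
  transitivity ((H2 l' : 'M[K]_2) f0 f1 - H2 l' f1 f0); first by rewrite !mxE.
  by rewrite -!h !(mxE, big_ord2) /= det2E; ring.
by rewrite E2 E1; ring.
Qed.

Lemma H2_parameter (K : fieldType) : determined_up_to_inverse (@H2 K).
Proof.
move=> l l' l1 lm1 l1' lm1'; split; first by case=> P _; exact: congruent_H2_parameter.
case=> [->|[l0 ->]]; first exact: congruent_refl.
by apply: (@congruentI _ _ (M2 0 1 l^-1 0)); [detnz|rewrite /H2; mxring2].
Qed.

(** The nonzero block is transformed by the upper left block of [P] alone, which reduces the claim
    to size 2. *)
Lemma HB0_parameter (K : fieldType) : determined_up_to_inverse (@HB0 K).
Proof.
move=> l l' l1 lm1 l1' lm1'; split.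
  case=> P _ /matrixP E; apply: (@congruent_H2_parameter _
    (M2 (P e0 e0) (P e0 e1) (P e1 e0) (P e1 e1))).
  apply: matrix2P.
  - by have := E e0 e0; rewrite !(mxE, big_ord3, big_ord2) /= => h; rewrite -[RHS]h; ring.
  - by have := E e0 e1; rewrite !(mxE, big_ord3, big_ord2) /= => h; rewrite -[RHS]h; ring.
  - by have := E e1 e0; rewrite !(mxE, big_ord3, big_ord2) /= => h; rewrite -[RHS]h; ring.
  - by have := E e1 e1; rewrite !(mxE, big_ord3, big_ord2) /= => h; rewrite -[RHS]h; ring.
case=> [->|[l0 ->]]; first exact: congruent_refl.
by apply: (@congruentI _ _ (M3 0 1 0 l^-1 0 0 0 0 1)); [detnz|rewrite /HB0; mxcongr3].
Qed.

(** Both [det A = - l] and [det (A + A^T) = - 2 (1 + l)^2] are multiplied by [\det P ^+ 2], so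
    [l / (1 + l)^2] is preserved. Replacing [1 + l] by [1 - l] changes both sides of the cleared
    equation by [4 l l']. *)
Lemma HB1_parameter (C : numClosedFieldType) : determined_up_to_inverse (@HB1 C).
Proof.
move=> l l' l1 lm1 l1' lm1'; split.
  case=> P _ E.
  have E1 : l' = \det P ^+ 2 * l.
    have := congr1 determinant E; rewrite !det_mulmx det_tr !det3E !mxE /=.
    rewrite !(mul0r, mulr0, subr0, sub0r, mul1r, mulr1, addr0) => h.
    by apply: oppr_inj; rewrite -h; ring.
  have E2 : (1 + l') ^+ 2 = \det P ^+ 2 * (1 + l) ^+ 2.
    have := congr1 (fun M : 'M[C]_3 => \det (M + M^T)) E.
    rewrite sym_congruent !det_mulmx det_tr (det3E (_ + _)) (det3E (HB1 l' + _)) !mxE /=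
        => h.
    have n2 : - 2%:R != 0 :> C by rewrite oppr_eq0 pnatr_eq0.
    apply: (mulfI n2); transitivity (\det P * (- 2%:R * (1 + l) ^+ 2) * \det P); last by
        ring.
    rewrite [LHS](_ : _ = (0 + 0) * ((0 + 0) * (1 + 1) - (0 + 0) * (0 + 0)) -
      (1 + l') * ((l' + 1) * (1 + 1) - (0 + 0) * (0 + 0)) +
      (0 + 0) * ((l' + 1) * (0 + 0) - (0 + 0) * (0 + 0))); last by ring.
    by rewrite -h; ring.
  apply: inverse_parameter; apply/eqP; rewrite -subr_eq0; apply/eqP.
  transitivity (l' * (1 + l) ^+ 2 - l * (1 + l') ^+ 2); first by ring.
  by rewrite E2 E1; ring.
case=> [->|[l0 ->]]; first exact: congruent_refl.
by apply: (@congruentI _ _ (M3 0 1 0 l^-1 0 0 0 0 1)); [detnz|rewrite /HB1; mxcongr3].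
Qed.

(** * Congruence bundles *)

(* [z] is a point of the projective line, [None] being the point at infinity. *)
Definition pencil_rank (K : fieldType) m n (z : option K)
    (p : 'M[K]_(m, n) * 'M[K]_(m, n)) : nat :=
  if z is Some l then \rank (p.2 - l *: p.1)%R else \rank p.1.

Lemma pencil_rank_equiv (K : fieldType) m n z (p q : 'M[K]_(m, n) * 'M[K]_(m, n)) :
  strictly_equivalent p q -> pencil_rank z p = pencil_rank z q.
Proof.
move=> [P [Q [Pu Qu]]]; rewrite /pencil_rank; case: p q => [a b] [a' b'] /= <- <-.
have E (X : 'M[K]_(m, n)) : \rank (P *m X *m Q) = \rank X.
  rewrite mxrankMfree ?row_free_unit // -mxrank_tr trmx_mul.
  by rewrite mxrankMfree ?row_free_unit ?unitmx_tr // mxrank_tr.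
case: z => [l|]; last by rewrite E.
by rewrite scalemxAl scalemxAr -mulmxBl -mulmxBr E.
Qed.

Lemma pencil_rank_ksum (K : fieldType) z (s : seq (kblock K)) :
  pencil_rank z (ksum s) = (\sum_(b <- s) pencil_rank z (kblock_pair b))%N.
Proof.
rewrite /pencil_rank; elim: s => [|b s IH] /=.
  by rewrite big_nil; case: z => [l|]; apply/eqP; rewrite -leqn0 rank_leq_row.
rewrite big_cons -IH; case: z {IH} => [l|]; last exact: rank_diag_block_mx.
by rewrite scale_block_mx opp_block_mx add_block_mx !scaler0 !subr0 rank_diag_block_mx.
Qed.

Lemma has_kronecker_form_rank (K : fieldType) m n z
    (p : 'M[K]_(m, n) * 'M[K]_(m, n)) s :
  has_kronecker_form p s ->
  pencil_rank z p = (\sum_(b <- s) pencil_rank z (kblock_pair b))%N.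
Proof.
move=> [[e1 e2] /(pencil_rank_equiv z) ->]; rewrite -pencil_rank_ksum.
by case: m / e1 p => p; case: n / e2 p => p; rewrite !castmx_id.
Qed.

Lemma unit_lower_mxrank (K : fieldType) n (A : 'M[K]_n) (d : K) : d != 0 ->
  (forall i j : 'I_n, (i < j)%N -> A i j = 0) -> (forall i, A i i = d) ->
  \rank A = n.
Proof.
move=> d0 tA dA; apply/eqP; rewrite -/(row_free A) row_free_unit unitmxE unitfE.
rewrite det_trig; last by apply/is_trig_mxP.
by apply/prodf_neq0 => i _; rewrite dA.
Qed.

Lemma mxrank_colsub_le (K : fieldType) m n p (f : 'I_p -> 'I_n) (A : 'M[K]_(m, n)) :
  (\rank (colsub f A) <= \rank A)%N.
Proof. by rewrite -{1}(mulmx1 A) -mulmx_colsub mxrankM_maxl. Qed.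

(** Without its first column, R - l L is lower triangular with ones on the diagonal; without its
    last column, L is the identity. A singular block thus contributes the same rank at all
    points. *)
Lemma pencil_rank_KL (K : fieldType) z r : pencil_rank z (kblock_pair (KL K r)) = r.-1.
Proof.
rewrite /pencil_rank /=; case: r => [|r] /=.
  by case: z => [l|]; apply/eqP; rewrite -leqn0 rank_leq_row.
apply/eqP; rewrite eqn_leq; apply/andP; split; first by case: z => *; exact: rank_leq_row.
case: z => [l|].
  have H : \rank (colsub (lift ord0) (Rmx K r.+1 - l *: Lmx K r.+1)%R) = r.
    apply: (@unit_lower_mxrank _ _ _ 1); first exact: oner_neq0.
    - move=> i j ij; rewrite !mxE /= /bump /= !add1n eqSS.
      by rewrite (ltn_eqF ij) (ltn_eqF (leqW ij)) mulr0 subr0.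
    - by move=> i; rewrite !mxE /= /bump /= !add1n eqxx (ltn_eqF (ltnSn i)) mulr0 subr0.
  by have := mxrank_colsub_le (lift ord0) (Rmx K r.+1 - l *: Lmx K r.+1)%R; rewrite H.
have H : \rank (colsub (widen_ord (leqnSn r)) (Lmx K r.+1)) = r.
  apply: (@unit_lower_mxrank _ _ _ 1); first exact: oner_neq0.
    by move=> i j ij; rewrite !mxE /= ltn_eqF.
  by move=> i; rewrite !mxE /= eqxx.
by have := mxrank_colsub_le (widen_ord (leqnSn r)) (Lmx K r.+1); rewrite H.
Qed.

Lemma pencil_rank_KLT (K : fieldType) z r :
  pencil_rank z (kblock_pair (KLT K r)) = r.-1.
Proof.
rewrite -(pencil_rank_KL z r) /pencil_rank /=; case: z => [l|]; rewrite -mxrank_tr ?trmxK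
    //.
by congr (\rank _); apply/matrixP => i j; rewrite !mxE.
Qed.

(** The rank at the eigenvalue is left as that of the nilpotent Jordan block: what matters for
    comparing members of a bundle is that it does not depend on [l]. *)
Lemma pencil_rank_KP (K : fieldType) z r (l : option K) :
  pencil_rank z (kblock_pair (KP r l)) = if z == l then \rank (Jmx r (0 : K)) else r.
Proof.
rewrite /pencil_rank; case: z l => [z|] [l|] //=.
- have E : Jmx r l - z *: 1%:M = Jmx r (l - z).
    by apply/matrixP => i j; rewrite !mxE mulrnBl mulr_natr addrAC.
  rewrite E; case: eqP => [[->]|zl]; first by rewrite subrr.
  rewrite -mxrank_tr; apply: (@unit_lower_mxrank _ _ _ (l - z)).
  + by rewrite subr_eq0; apply/eqP => lz; apply: zl; rewrite lz.
  + move=> i j ij; by rewrite !mxE (gtn_eqF ij) (gtn_eqF (leqW ij)) addr0.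
  + by move=> i; rewrite !mxE eqxx (gtn_eqF (ltnSn i)) addr0.
- rewrite -mxrank_tr; apply: (@unit_lower_mxrank _ _ _ 1); first exact: oner_neq0.
  + move=> i j ij; rewrite !mxE mul0rn add0r -val_eqE /=.
    by rewrite (gtn_eqF ij) (gtn_eqF (leqW ij)) mulr0 subr0.
  + by move=> i; rewrite !mxE mul0rn add0r eqxx (gtn_eqF (ltnSn i)) mulr0 subr0.
- by rewrite mxrank1.
Qed.

(** The rank at a point depends only on the type and on which positions of the eigenvalue list the
    point occupies. *)
Lemma pencil_rank_kron_blocks (K : fieldType) (z z' : option K) t lam mu :
  size lam = size (kt_P t) -> size mu = size (kt_P t) ->
  [seq z == l | l <- lam] = [seq z' == l | l <- mu] ->
  (\sum_(b <- kron_blocks t lam) pencil_rank z (kblock_pair b) =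
   \sum_(b <- kron_blocks t mu) pencil_rank z' (kblock_pair b))%N.
Proof.
case: t => L LT P /= sl sm E; rewrite /kron_blocks !big_cat !big_map /=; congr (_ + (_ +
    _))%N.
- by apply: eq_bigr => r _; rewrite !pencil_rank_KL.
- by apply: eq_bigr => r _; rewrite !pencil_rank_KLT.
elim: P lam mu sl sm E => [|p P IH] lam mu; first by case: lam; case: mu => //=; rewrite
    !big_nil.
case: lam => // l lam; case: mu => // m mu /= [sl] [sm] [E1 E2].
rewrite !big_cat !big_map (IH lam mu) //; congr (_ + _)%N.
by apply: eq_bigr => r _; rewrite !pencil_rank_KP E1.
Qed.

Lemma fresh_eigenvalue (K : numFieldType) (s : seq (option K)) : exists z, z \notin s.
Proof.
pose c := [seq Some (n%:R : K) | n <- iota 0 (size s).+1].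
have cu : uniq c.
  by rewrite map_inj_uniq ?iota_uniq // => m n [] /eqP; rewrite eqr_nat => /eqP.
have : ~~ all (mem s) c.
  apply/negP => /allP cs; have := uniq_leq_size cu cs.
  by rewrite size_map size_iota ltnn.
by case/allPn => z _ zs; exists z.
Qed.

(** An eigenvalue of [p] is matched with the eigenvalue of [q] at the same position, a distinguished
    point with itself, and any other point with a fresh one. *)
Lemma same_bundle_rank (K : numFieldType) E m n
    (p q : 'M[K]_(m, n) * 'M[K]_(m, n)) (z : option K) :
  same_strict_bundle E p q ->
  exists2 z', (if z \in E then z' = z else z' \notin E) &
    pencil_rank z p = pencil_rank z' q.
Proof.
move=> [t [lam [mu [_ [sl ul fp] [sm um fq] EE]]]].
have slm : size lam = size mu by rewrite sl sm.
suff [z' z'E lm] : exists2 z', (if z \in E then z' = z else z' \notin E) &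
    [seq z == l | l <- lam] = [seq z' == l | l <- mu].
  exists z' => //.
  rewrite (has_kronecker_form_rank z fp) (has_kronecker_form_rank z' fq).
  exact: pencil_rank_kron_blocks.
have [zlam|zlam] := boolP (z \in lam).
  have zi : (index z lam < size lam)%N by rewrite index_mem.
  exists (nth None mu (index z lam)).
    have := EE _ zi; rewrite nth_index //; case: ifP => [zE /(_ isT) <- //|zE h].
    by apply/negP => mE; move: h; rewrite mE => /(_ isT) h; rewrite -h zE in mE.
  apply: (@eq_from_nth _ false); rewrite !size_map // => i il.
  rewrite !(nth_map None) -?slm // -{1}(nth_index None zlam).
  by rewrite !nth_uniq // -slm.
have [zE|zE] := boolP (z \in E).
  exists z => //; apply: (@eq_from_nth _ false); rewrite !size_map // => i il.
  rewrite !(nth_map None) -?slm //.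
  have -> : z == nth None lam i = false.
    by apply: contraNF zlam => /eqP ->; rewrite mem_nth.
  (* If [z] were an eigenvalue of [q], then, being distinguished, it would be the eigenvalue of [p]
     at the same position. *)
  apply/esym; apply: contraNF zlam => /eqP zm.
  by rewrite zm -EE ?mem_nth // -zm zE orbT.
(* The partner of an ordinary point must avoid the eigenvalues of [q], to keep the generic rank, and
   also the distinguished points. *)
have [z'] := fresh_eigenvalue (E ++ mu); rewrite mem_cat negb_or => /andP[z'E z'mu].
exists z' => //; apply: (@eq_from_nth _ false); rewrite !size_map // => i il.
rewrite !(nth_map None) -?slm //.
have -> : z == nth None lam i = false.
  by apply: contraNF zlam => /eqP ->; rewrite mem_nth.
by apply/esym; apply: contraNF z'mu => /eqP ->; rewrite mem_nth -?slm.
Qed.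

(** * Explicit Kronecker forms *)

Definition kblock_entry (K : fieldType) (b : kblock K) (i j : nat) : K * K :=
  match b with
  | KL _ => ((i == j)%:R, (i.+1 == j)%:R)
  | KLT _ => ((j == i)%:R, (j.+1 == i)%:R)
  | KP _ (Some l) => ((i == j)%:R, l *+ (i == j) + (i.+1 == j)%:R)
  | KP _ None => (0 *+ (i == j) + (i.+1 == j)%:R, (i == j)%:R)
  end.

(** Indexing by natural numbers lets the entries of an explicit Kronecker form be computed, without
    the dependent sizes of [ksum]. *)
Fixpoint ksum_entry (K : fieldType) (s : seq (kblock K)) (i j : nat) : K * K :=
  if s is b :: s' then
    if (i < kblock_rows b)%N then
      if (j < kblock_cols b)%N then kblock_entry b i j else (0, 0)
    else if (j < kblock_cols b)%N then (0, 0)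
    else ksum_entry s' (i - kblock_rows b) (j - kblock_cols b)
  else (0, 0).

Lemma ksumE (K : fieldType) (s : seq (kblock K)) i j :
  (ksum s).1 i j = (ksum_entry s i j).1 /\ (ksum s).2 i j = (ksum_entry s i j).2.
Proof.
elim: s i j => [|b s IH] i j; first by case: i.
rewrite /= !mxE; case: (split_ordP i) => i' ->; case: (split_ordP j) => j' -> /=;
  rewrite ?mxE ?(unsplitK (inl _)) ?(unsplitK (inr _)) /= ?ltn_ord;
  rewrite ?[(_ + _ < _)%N]ltnNge ?leq_addr /= ?addKn; try exact: IH;
  rewrite ?mxE //.
by move: {i j IH}b i' j' => [r|r|r [l|]] i' j' /=; rewrite !mxE.
Qed.

Lemma has_kronecker_formI (K : fieldType) n (A B P Q : 'M[K]_n) (s : seq (kblock K)) :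
  krows s = n -> kcols s = n -> \det P != 0 -> \det Q != 0 ->
  (forall i j : 'I_n, (P *m A *m Q) i j = (ksum_entry s i j).1) ->
  (forall i j : 'I_n, (P *m B *m Q) i j = (ksum_entry s i j).2) ->
  has_kronecker_form (A, B) s.
Proof.
move=> er ec P0 Q0 hA hB; exists (er, ec); exists P, Q.
split; rewrite ?unitmxE ?unitfE //; apply/matrixP => i j; rewrite ?hA ?hB castmxE /=.
- by rewrite (ksumE _ _).1.
- by rewrite (ksumE _ _).2.
Qed.

(** Transposition exchanges the two members of (A, A^T), so the eigenvalues come in pairs l, 1/l,
    with 0 paired with infinity. *)
Definition inv_eigenvalue (K : fieldType) (l : K) : option K :=
  if l == 0 then None else Some l^-1.

(** The block L_1 has no row and L_1^T no column, so one of each stands for a zero row together with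
    a zero column. [v_I] and [v_H] share their type and differ by the distinguished eigenvalue; in
    size 3 so do [v_110] and [v_m1sq_0]. *)
Definition ktype2 (v : vertex2) : kron_type :=
  match v with
  | v_0 => KronType [:: 1; 1] [:: 1; 1] [::]
  | v_D => KronType [:: 1] [:: 1] [:: [:: 1]]
  | v_I | v_H => KronType [::] [::] [:: [:: 1; 1]]
  | v_Gamma => KronType [::] [::] [:: [:: 2]]
  | v_B => KronType [::] [::] [:: [:: 1]; [:: 1]]
  end%N.

Definition keigenvalues2 (K : fieldType) (v : vertex2) (l : K) : seq (option K) :=
  match v with
  | v_0 => [::]
  | v_D | v_I => [:: Some 1]
  | v_H | v_Gamma => [:: Some (-1)]
  | v_B => [:: Some l; inv_eigenvalue l]
  end.

Definition ktype3 (v : vertex3) : kron_type :=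
  match v with
  | v_000 => KronType [:: 1; 1; 1] [:: 1; 1; 1] [::]
  | v_m1sq_0 | v_110 => KronType [:: 1] [:: 1] [:: [:: 1; 1]]
  | v_100 => KronType [:: 1; 1] [:: 1; 1] [:: [:: 1]]
  | v_1sq_0 => KronType [:: 1] [:: 1] [:: [:: 2]]
  | v_m1sq_1 => KronType [::] [::] [:: [:: 1; 1]; [:: 1]]
  | v_111 => KronType [::] [::] [:: [:: 1; 1; 1]]
  | v_0cube => KronType [:: 2] [:: 2] [::]
  | v_1sq_1 => KronType [::] [::] [:: [:: 2]; [:: 1]]
  | v_1cube => KronType [::] [::] [:: [:: 3]]
  | v_B0 => KronType [:: 1] [:: 1] [:: [:: 1]; [:: 1]]
  | v_B1 => KronType [::] [::] [:: [:: 1]; [:: 1]; [:: 1]]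
  end%N.

Definition keigenvalues3 (K : fieldType) (v : vertex3) (l : K) : seq (option K) :=
  match v with
  | v_000 | v_0cube => [::]
  | v_100 | v_110 | v_111 | v_1cube => [:: Some 1]
  | v_m1sq_0 | v_1sq_0 => [:: Some (-1)]
  | v_m1sq_1 | v_1sq_1 => [:: Some (-1); Some 1]
  | v_B0 => [:: Some l; inv_eigenvalue l]
  | v_B1 => [:: Some l; inv_eigenvalue l; Some 1]
  end.

Ltac kform2 P Q :=
  apply: (@has_kronecker_formI _ _ _ _ P Q);
  [reflexivity | reflexivity | by detnz | by detnz
  | apply: ord2P; apply: ord2P; rewrite !(mxE, big_ord2) /= ..];
  rewrite ?(mulr0, mul0r, mulr1, mul1r) ?(subr0, sub0r, add0r, addr0); by [ring|fieldx].

Lemma M3_tr (K : pzRingType) (a b c d e f g h i : K) :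
  (M3 a b c d e f g h i)^T = M3 a d g b e h c f i.
Proof. by apply: matrix3P; rewrite !mxE. Qed.

Lemma M3_mul (K : comNzRingType) (p q r s t u v w x a b c d e f g h i
    p' q' r' s' t' u' v' w' x' : K) :
  M3 p q r s t u v w x *m M3 a b c d e f g h i *m M3 p' q' r' s' t' u' v' w' x' =
  M3 ((p * a + q * d + r * g) * p' + (p * b + q * e + r * h) * s' + (p * c + q * f + r *
      i) * v')
     ((p * a + q * d + r * g) * q' + (p * b + q * e + r * h) * t' + (p * c + q * f + r *
         i) * w')
     ((p * a + q * d + r * g) * r' + (p * b + q * e + r * h) * u' + (p * c + q * f + r *
         i) * x')
     ((s * a + t * d + u * g) * p' + (s * b + t * e + u * h) * s' + (s * c + t * f + u *
         i) * v')
     ((s * a + t * d + u * g) * q' + (s * b + t * e + u * h) * t' + (s * c + t * f + u *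
         i) * w')
     ((s * a + t * d + u * g) * r' + (s * b + t * e + u * h) * u' + (s * c + t * f + u *
         i) * x')
     ((v * a + w * d + x * g) * p' + (v * b + w * e + x * h) * s' + (v * c + w * f + x *
         i) * v')
     ((v * a + w * d + x * g) * q' + (v * b + w * e + x * h) * t' + (v * c + w * f + x *
         i) * w')
     ((v * a + w * d + x * g) * r' + (v * b + w * e + x * h) * u' + (v * c + w * f + x *
         i) * x').
Proof. by apply: matrix3P; rewrite !(mxE, big_ord3). Qed.

Lemma M3_entries (K : fieldType) (a b c d e f g h i : K) (pr : K * K -> K) s :
  let F i j := pr (ksum_entry s i j) in
  [/\ a = F 0 0, b = F 0 1 & c = F 0 2]%N ->
  [/\ d = F 1 0, e = F 1 1 & f = F 1 2]%N ->
  [/\ g = F 2 0, h = F 2 1 & i = F 2 2]%N ->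
  forall j k : 'I_3, (M3 a b c d e f g h i) j k = pr (ksum_entry s j k).
Proof.
by move=> F [? ? ?] [? ? ?] [? ? ?]; apply: ord3P; apply: ord3P; rewrite mxE.
Qed.

Ltac kform3 P Q :=
  apply: (@has_kronecker_formI _ _ _ _ P Q);
  [reflexivity | reflexivity | by detnz | by detnz | |];
  rewrite ?M3_tr M3_mul ?(mulr0, mul0r, mulr1, mul1r) ?(subr0, sub0r, add0r, addr0);
  first [apply: (M3_entries (pr := fst)) | apply: (M3_entries (pr := snd))];
  split; rewrite /=; by [ring|fieldx].

Lemma canon2_kronecker (C : numClosedFieldType) v M : canon2 C v M ->
  exists l : C, [/\ l != 1, l != -1 &
    has_kronecker_form (M, M^T) (kron_blocks (ktype2 v) (keigenvalues2 v l))].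
Proof.
have z1 : (0 : C) != 1 by rewrite eq_sym oner_neq0.
have zm1 : (0 : C) != -1 by rewrite eq_sym oppr_eq0 oner_neq0.
(* Outside the family the parameter is a dummy, and 0 is a value different from 1 and -1. *)
case: v => /=; try (move=> ->; exists 0; split => //).
- by abstract kform2 (M2 1 0 0 1 : 'M[C]_2) (M2 1 0 0 1 : 'M[C]_2).
- by abstract kform2 (M2 0 1 1 0 : 'M[C]_2) (M2 0 1 1 0 : 'M[C]_2).
- by abstract kform2 (M2 1 0 0 1 : 'M[C]_2) (M2 1 0 0 1 : 'M[C]_2).
- by abstract kform2 (M2 0 (-1) 1 0 : 'M[C]_2) (M2 1 0 0 1 : 'M[C]_2).
- by abstract kform2 (M2 (1 / 2) (1 / 2) (-1) 0 : 'M[C]_2) (M2 2 0 0 1 : 'M[C]_2).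
move=> [l [l1 lm1 ->]]; exists l; split => //; rewrite /inv_eigenvalue.
(* After exchanging the columns, the pair is diagonal with blocks (1, l) and (l, 1). The second one
   is scaled by [l^-1], or is the block at infinity if [l = 0]. *)
have [->|l0] := eqVneq l 0.
  by abstract kform2 (M2 1 0 0 1 : 'M[C]_2) (M2 0 1 1 0 : 'M[C]_2).
by abstract kform2 (M2 1 0 0 l^-1 : 'M[C]_2) (M2 0 1 1 0 : 'M[C]_2).
Qed.

Lemma canon3_kronecker (C : numClosedFieldType) v M : canon3 C v M ->
  exists l : C, [/\ l != 1, l != -1 &
    has_kronecker_form (M, M^T) (kron_blocks (ktype3 v) (keigenvalues3 v l))].
Proof.
have z1 : (0 : C) != 1 by rewrite eq_sym oner_neq0.
have zm1 : (0 : C) != -1 by rewrite eq_sym oppr_eq0 oner_neq0.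
case: v => /=; try (move=> ->; exists 0; split => //).
- rewrite (M3_eta 0) !mxE.
  by abstract kform3 (M3 1 0 0 0 1 0 0 0 1 : 'M[C]_3) (M3 1 0 0 0 1 0 0 0 1 : 'M[C]_3).
- by abstract kform3 (M3 0 0 1 0 (-1) 0 1 0 0 : 'M[C]_3) (M3 0 1 0 0 0 1 1 0 0 : 'M[C]_3).
- by abstract kform3 (M3 0 0 1 0 1 0 1 0 0 : 'M[C]_3) (M3 0 0 1 0 1 0 1 0 0 : 'M[C]_3).
- by abstract kform3 (M3 0 0 1 (1 / 2) (1 / 2) 0 (-1) 0 0 : 'M[C]_3) (M3 0 2 0 0 0 1 1 0
    0 : 'M[C]_3).
- by abstract kform3 (M3 0 0 1 1 0 0 0 1 0 : 'M[C]_3) (M3 0 1 0 0 0 1 1 0 0 : 'M[C]_3).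
- by abstract kform3 (M3 0 (-1) 0 1 0 0 0 0 1 : 'M[C]_3) (M3 1 0 0 0 1 0 0 0 1 : 'M[C]_3).
- rewrite (M3_eta 1%:M) !mxE /=.
  by abstract kform3 (M3 1 0 0 0 1 0 0 0 1 : 'M[C]_3) (M3 1 0 0 0 1 0 0 0 1 : 'M[C]_3).
- by abstract kform3 (M3 0 1 0 1 0 0 0 0 1 : 'M[C]_3) (M3 0 1 0 0 0 1 1 0 0 : 'M[C]_3).
- by abstract kform3 (M3 (1 / 2) (1 / 2) 0 (-1) 0 0 0 0 1 : 'M[C]_3) (M3 2 0 0 0 1 0 0 0
    1 : 'M[C]_3).
- by abstract kform3 (M3 0 0 (1 / 4) (1 / 2) (1 / 2) 0 1 0 0 : 'M[C]_3) (M3 4 2 0 0 (-2)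
    0 0 0 1 : 'M[C]_3).
- move=> [l [l1 lm1 ->]]; exists l; split => //; rewrite /inv_eigenvalue /HB0 /HB1.
  have [->|l0] := eqVneq l 0.
    by abstract kform3 (M3 0 0 1 1 0 0 0 1 0 : 'M[C]_3) (M3 0 0 1 0 1 0 1 0 0 : 'M[C]_3).
  by abstract kform3 (M3 0 0 1 1 0 0 0 l^-1 0 : 'M[C]_3) (M3 0 0 1 0 1 0 1 0 0 : 'M[C]_3).
- move=> [l [l1 lm1 ->]]; exists l; split => //; rewrite /inv_eigenvalue /HB0 /HB1.
  have [->|l0] := eqVneq l 0.
    by abstract kform3 (M3 1 0 0 0 1 0 0 0 1 : 'M[C]_3) (M3 0 1 0 1 0 0 0 0 1 : 'M[C]_3).
  by abstract kform3 (M3 1 0 0 0 l^-1 0 0 0 1 : 'M[C]_3) (M3 0 1 0 1 0 0 0 0 1 : 'M[C]_3).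
Qed.

(** * Pencil ranks that separate the bundles *)

Notation congr_eigenvalues C := [:: Some (1 : C); Some (-1)].

Lemma congruent_strictly_equivalent (K : fieldType) n (A B : 'M[K]_n) :
  congruent A B -> strictly_equivalent (A, A^T) (B, B^T).
Proof.
move=> [P Pu <-]; exists P^T, P; rewrite unitmx_tr /=; split => //.
by rewrite !trmx_mul trmxK mulmxA.
Qed.

Lemma same_strict_bundle_sym (K : fieldType) E m n (p q : 'M[K]_(m, n) * 'M[K]_(m, n)) :
  same_strict_bundle E p q -> same_strict_bundle E q p.
Proof.
move=> [t [lam [mu [tok [sl ul fp] [sm um fq] EE]]]].
exists t, mu, lam; split => // i il; rewrite orbC => h.
by rewrite EE // sl -sm.
Qed.

Lemma strictly_equivalent_trans (K : fieldType) m n (p q r : 'M[K]_(m, n) * 'M[K]_(m, n))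
    :
  strictly_equivalent p q -> strictly_equivalent q r -> strictly_equivalent p r.
Proof.
move=> [P [Q [Pu Qu pq1 pq2]]] [P' [Q' [Pu' Qu' qr1 qr2]]].
exists (P' *m P), (Q *m Q'); rewrite !unitmx_mul Pu Qu Pu' Qu'.
by split => //; rewrite -?qr1 -?qr2 -?pq1 -?pq2 !mulmxA.
Qed.

Lemma symrank_pencil (K : fieldType) n (A : 'M[K]_n) :
  symrank A = pencil_rank (Some (-1)) (A, A^T).
Proof. by rewrite /symrank /pencil_rank /= scaleN1r opprK addrC. Qed.

Lemma symmetric_pencil (K : fieldType) n (A : 'M[K]_n) :
  (A == A^T) = (pencil_rank (Some 1) (A, A^T) == 0).
Proof. by rewrite /pencil_rank mxrank_eq0 scale1r subr_eq0 eq_sym. Qed.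

(** A + A^T is the pencil at the point -1, which is distinguished and hence matched with itself.
    Likewise the rank at the point 1 detects symmetry. *)
Lemma same_bundle_symrank (K : numFieldType) n (A B : 'M[K]_n) :
  congr_bundle A B -> symrank A = symrank B.
Proof.
move=> /(same_bundle_rank (Some (-1)))[z'].
by rewrite !inE eqxx orbT => -> h; rewrite !symrank_pencil.
Qed.

Lemma same_bundle_symmetric (K : numFieldType) n (A B : 'M[K]_n) :
  congr_bundle A B -> (A == A^T) = (B == B^T).
Proof.
move=> /(same_bundle_rank (Some 1))[z'].
by rewrite !inE eqxx => -> h; rewrite !symmetric_pencil h.
Qed.

Lemma symmetric3E (K : fieldType) (A : 'M[K]_3) : (A == A^T) = (axial_level A == 0)%N.
Proof.
rewrite -leqn0 axial_level3_le /vanish /= andbT; apply/eqP/and3P => [E|].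
  have AE i j : A i j = A j i by rewrite {1}E mxE.
  by rewrite (AE e2 e1) (AE e2 e0) (AE e1 e0) !subrr.
rewrite !subr_eq0 => -[/eqP h1 /eqP h2 /eqP h3].
by apply: matrix3P; rewrite !mxE.
Qed.

Lemma pencil_rank3_le (K : fieldType) (z : option K) (M N : 'M[K]_3) :
  let X := if z is Some l then N - l *: M else M in
  ((pencil_rank z (M, N) <= 1)%N = (\adj X == 0)) *
  ((pencil_rank z (M, N) <= 2)%N = (\det X == 0)).
Proof. by case: z => [l|]; rewrite /pencil_rank /= mxrank_le1 mxrank_ltn. Qed.

Lemma pencil_rank3_eq3 (K : fieldType) (z : option K) (M N : 'M[K]_3) :
  (pencil_rank z (M, N) = 3) <-> ~~ (pencil_rank z (M, N) <= 2)%N.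
Proof.
have : (pencil_rank z (M, N) <= 3)%N by case: z => *; exact: rank_leq_row.
rewrite -ltnNge => h; split => [->//|h']; apply/eqP; by rewrite eqn_leq h h'.
Qed.

Definition regular_vertex (v : vertex3) : bool :=
  match v with v_m1sq_1 | v_1sq_1 => true | _ => false end.

(** The vertices listed are the non-symmetric ones with S of rank 1 or 2; among them regularity of
    the pencil singles out level 3. *)
Lemma canon3_regular (C : numClosedFieldType) v M : canon3 C v M ->
  match v with v_1sq_0 | v_m1sq_1 | v_B0 | v_0cube | v_1sq_1 => true | _ => false end ->
  (exists z, pencil_rank z (M, M^T) = 3) <-> regular_vertex v.
Proof.
have reg (A : 'M[C]_3) : \det A != 0 -> exists z, pencil_rank z (A, A^T) = 3.
  by move=> A0; exists None; apply/pencil_rank3_eq3; rewrite pencil_rank3_le.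
have sing (A : 'M[C]_3) : (forall l, \det (A^T - l *: A) = 0) -> \det A = 0 ->
    (exists z, pencil_rank z (A, A^T) = 3) <-> false.
  move=> h1 h2; split => // -[z] /pencil_rank3_eq3.
  by rewrite pencil_rank3_le; case: z => [l|]; rewrite ?h1 ?h2 eqxx.
case: v => //=.
- by move=> -> _; apply: sing => [l|]; rewrite det3E !mxE /=; ring.
- by move=> -> _; split => // _; apply: reg; detnz.
- by move=> -> _; apply: sing => [l|]; rewrite det3E !mxE /=; ring.
- by move=> -> _; split => // _; apply: reg; detnz.
- by move=> [l [_ _ ->]] _; apply: sing => [x|]; rewrite det3E !mxE /=; ring.
Qed.

(** For [HB0 l] the pencil at [l] keeps a single nonzero entry at most. For the nilpotent Jordan
    block, a fixed 2 x 2 minor equals 1 at all finite points and another one does so at infinity. *)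
Lemma canon3_low_rank (C : numClosedFieldType) v M : canon3 C v M ->
  match v with v_B0 | v_0cube => true | _ => false end ->
  (exists z, (pencil_rank z (M, M^T) <= 1)%N) <-> v = v_B0.
Proof.
have adj20 (X : 'M[C]_3) : X e1 e0 * X e2 e1 - X e1 e1 * X e2 e0 = 1 -> \adj X != 0.
  move=> X1; apply/eqP => /matrixP /(_ e2 e0).
  by rewrite adj3E [in RHS]mxE mxE /= X1 => /eqP; rewrite oner_eq0.
have adj02 (X : 'M[C]_3) : X e0 e1 * X e1 e2 - X e0 e2 * X e1 e1 = 1 -> \adj X != 0.
  move=> X1; apply/eqP => /matrixP /(_ e0 e2).
  by rewrite adj3E [in RHS]mxE mxE /= X1 => /eqP; rewrite oner_eq0.
have adj0 (x : C) : \adj (M3 0 0 0 x 0 0 0 0 0) = 0 :> 'M[C]_3.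
  by rewrite adj3E; apply: matrix3P; rewrite !mxE /=; ring.
case: v => //=.
- move=> -> _; split => // -[z]; rewrite pencil_rank3_le => /eqP h; exfalso.
  by move: h; apply/eqP; case: z => [l|]; [apply: adj20|apply: adj02]; rewrite !mxE /=;
      ring.
- move=> [l [_ _ ->]] _; split => // _; exists (Some l); rewrite pencil_rank3_le.
  rewrite (_ : _ - _ = M3 0 0 0 (1 - l * l) 0 0 0 0 0) ?adj0 //.
  by apply: matrix3P; rewrite !mxE /=; ring.
Qed.

(** The determinant of the pencil is [(1 - l)^3] for [v_1cube], so 1 is its only eigenvalue, whereas
    the parameter of [HB1] is itself an eigenvalue that is not distinguished. *)
Lemma canon3_free_eigenvalue (C : numClosedFieldType) v M : canon3 C v M ->
  match v with v_1cube | v_B1 => true | _ => false end ->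
  (exists2 z, z \notin congr_eigenvalues C & (pencil_rank z (M, M^T) <= 2)%N) <-> v =
      v_B1.
Proof.
case: v => //=.
- have nz (x y : C) : y != 0 -> x = y -> (x == 0) = false by move=> y0 ->; exact: negPf.
  move=> -> _; split => // -[[l|]]; rewrite pencil_rank3_le det3E !mxE /=.
    rewrite !inE negb_or => /andP[l1 _].
    rewrite (@nz _ ((1 - l) ^+ 3)) //; last by ring.
    by rewrite expf_neq0 // subr_eq0 eq_sym; apply: contra l1 => /eqP ->.
  by move=> _; rewrite (@nz _ 1) ?oner_neq0 //; ring.
- move=> [l [l1 lm1 ->]] _; split => // _; exists (Some l).
    by rewrite !inE negb_or; apply/andP; split; [apply: contra l1|apply: contra lm1];
      move=> /eqP[->].
  by rewrite pencil_rank3_le det3E !mxE /=; apply/eqP; ring.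
Qed.

(** A bundle fixes no individual ordinary point, so its invariants are existence statements whose
    condition [P] survives moving the point among the ordinary ones. *)
Lemma congr_bundle_inv (K : numFieldType) n (A B : 'M[K]_n) :
  congr_bundle A B -> forall P : option K -> nat -> Prop,
  (forall z z' r, P z r -> (if z \in congr_eigenvalues K then z' = z
     else z' \notin congr_eigenvalues K) -> P z' r) ->
  (exists z, P z (pencil_rank z (A, A^T))) <-> (exists z, P z (pencil_rank z (B, B^T))).
Proof.
move=> AB P PE; have [h1 h2] := (AB, same_strict_bundle_sym AB).
split => -[z Pz].
  by have [z' z'E E] := same_bundle_rank z h1; exists z'; rewrite -E; exact: PE z'E.
by have [z' z'E E] := same_bundle_rank z h2; exists z'; rewrite -E; exact: PE z'E.
Qed.

Lemma congr_bundle_congruent (K : numFieldType) n (A A' B B' : 'M[K]_n) :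
  congruent A A' -> congruent B B' -> congr_bundle A B -> congr_bundle A' B'.
Proof.
move=> AA BB [t [lam [mu [tok [sl ul [eA fA]] [sm um [eB fB]] EE]]]].
exists t, lam, mu; split => //; split => //; [exists eA|exists eB].
  apply: (strictly_equivalent_trans _ fA).
  exact/congruent_strictly_equivalent/congruent_sym.
apply: (strictly_equivalent_trans _ fB).
exact/congruent_strictly_equivalent/congruent_sym.
Qed.

Lemma canon3_bundle_inj (C : numClosedFieldType) v w M N :
  canon3 C v M -> canon3 C w N -> congr_bundle M N -> v = w.
Proof.
move=> vM wN MN.
have [Mr Ml] := canon3_inv vM; have [Nr Nl] := canon3_inv wN.
have := same_bundle_symrank MN; rewrite Mr Nr => rE.
have := same_bundle_symmetric MN; rewrite !symmetric3E Ml Nl => lE.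
have inv := congr_bundle_inv MN.
have regE := inv (fun _ r => r = 3) (fun _ _ _ e _ => e).
have lowE := inv (fun _ r => r <= 1)%N (fun _ _ _ e _ => e).
have freeE : (exists2 z, z \notin congr_eigenvalues C & (pencil_rank z (M, M^T) <= 2)%N)
    <-> (exists2 z, z \notin congr_eigenvalues C & (pencil_rank z (N, N^T) <= 2)%N).
  have [] := inv (fun z r => z \notin congr_eigenvalues C /\ (r <= 2)%N).
    by move=> z z' r [zE r2]; rewrite (negPf zE).
  move=> h1 h2; split => -[z zE r2]; [have [|z' []] := h1|have [|z' []] := h2];
    by [exists z | exists z'].
have reg1 := canon3_regular vM; have reg2 := canon3_regular wN.
have low1 := canon3_low_rank vM; have low2 := canon3_low_rank wN.
have free1 := canon3_free_eigenvalue vM; have free2 := canon3_free_eigenvalue wN.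
(* Rank of S and symmetry leave three groups: [v_1sq_0], [v_m1sq_1]; [v_B0], [v_0cube], [v_1sq_1];
   [v_1cube], [v_B1]. Regularity isolates level 3 in the first two, a point of rank at most 1
   isolates [v_B0], and a free eigenvalue isolates [v_B1]. *)
case: v w rE lE reg1 reg2 low1 low2 free1 free2 {vM wN Mr Ml Nr Nl} => [] [] //= _ _.
all: try by move=> /(_ isT)[a1 a2] /(_ isT)[b1 b2]; move: regE => [r1 r2];
  try (by have := b1 (r1 (a2 isT))); have := a1 (r2 (b2 isT)).
all: move=> reg1 reg2 low1 low2 free1 free2.
all: try by have := (low1 isT).1 (lowE.2 ((low2 isT).2 erefl)).
all: try by have := (low2 isT).1 (lowE.1 ((low1 isT).2 erefl)).
all: try by have := (free1 isT).1 (freeE.2 ((free2 isT).2 erefl)).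
all: try by have := (free2 isT).1 (freeE.1 ((free1 isT).2 erefl)).
Qed.

(** 1 and -1 are the only fixed points of inversion, so in the families the two free eigenvalues are
    distinct and never distinguished. *)
Lemma free_eigenvalues (C : numClosedFieldType) (x : C) : x != 1 -> x != -1 ->
  [/\ Some x \notin congr_eigenvalues C, inv_eigenvalue x \notin congr_eigenvalues C
    & Some x != inv_eigenvalue x].
Proof.
move=> x1 xm1; have S1 (y : C) : (Some y \in congr_eigenvalues C) = (y == 1) || (y == -1).
  by rewrite !inE.
split; first by rewrite S1 (negPf x1) (negPf xm1).
  rewrite /inv_eigenvalue; case: eqVneq => //= x0.
  by rewrite S1 !(inv_eq (@invrK C)) invr1 invrN1 negb_or x1.
rewrite /inv_eigenvalue; have [//|x0] := eqVneq x 0.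
apply/eqP => -[xE]; have : x ^+ 2 == 1 by rewrite expr2 {2}xE divff.
by rewrite sqrf_eq1 (negPf x1) (negPf xm1).
Qed.

(** Both Kronecker forms have the type of [v]. The positions that carry 1 or -1 depend on [v] alone,
    and the remaining ones carry free eigenvalues. *)
Lemma canon3_same_bundle (C : numClosedFieldType) v M N :
  canon3 C v M -> canon3 C v N -> congr_bundle M N.
Proof.
move=> /canon3_kronecker[l [l1 lm1 fM]] /canon3_kronecker[m [m1 mm1 fN]].
exists (ktype3 v), (keigenvalues3 v l), (keigenvalues3 v m).
have [[l2 l3 lu] [m2 m3 mu]] := (free_eigenvalues l1 lm1, free_eigenvalues m1 mm1).
have one : Some (1 : C) \in congr_eigenvalues C by rewrite !inE eqxx.
have mone : Some (-1 : C) \in congr_eigenvalues C by rewrite !inE eqxx orbT.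
have n1 : (Some (-1) != Some (1 : C)).
  by apply/eqP => -[] /eqP; rewrite eq_sym -addr_eq0 -mulr2n pnatr_eq0.
have ne (x y : option C) : x \notin congr_eigenvalues C -> y \in congr_eigenvalues C -> x
    != y.
  by move=> xE yE; apply: contra xE => /eqP ->.
split.
- by case: v fM fN.
- split => //; first by case: v fM fN.
  by case: v {fM fN} => //=; rewrite ?inE ?negb_or ?(ne _ _ l2 one) ?(ne _ _ l3 one) ?lu
      ?n1.
- split => //; first by case: v fM fN.
  by case: v {fM fN} => //=; rewrite ?inE ?negb_or ?(ne _ _ m2 one) ?(ne _ _ m3 one) ?mu
      ?n1.
- case: v {fM fN} => //= i; try (by case: i => [|[|[|]]]).
  + by case: i => [|[|//]] _ /=; rewrite ?(negPf l2) ?(negPf l3) ?(negPf m2) ?(negPf m3).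
  + by case: i => [|[|[|//]]] _ //=; rewrite ?(negPf l2) ?(negPf l3) ?(negPf m2) ?(negPf
      m3).
Qed.

Lemma congr_bundle3E (C : numClosedFieldType) v (A : 'M[C]_3) :
  congruent_to (canon3 C v) A -> congr_bundle A = congruent_to (canon3 C v).
Proof.
move=> [M vM AM]; apply/seteqP; split => B /= h.
  have [w [N wN BN]] := canon3_exists B; exists N => //.
  suff -> : v = w by [].
  exact: (canon3_bundle_inj vM wN (congr_bundle_congruent AM BN h)).
have [N vN BN] := h.
apply: (congr_bundle_congruent (congruent_sym AM) (congruent_sym BN)).
exact: canon3_same_bundle vM vN.
Qed.

Lemma canon2_bundle_inj (C : numClosedFieldType) v w M N :
  canon2 C v M -> canon2 C w N -> congr_bundle M N -> v = w.
Proof.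
move=> vM wN MN.
have [Mr Ml] := canon2_inv vM; have [Nr Nl] := canon2_inv wN.
have := same_bundle_symrank MN; rewrite Mr Nr => rE.
have : skew_level M = skew_level N by rewrite /skew_level (same_bundle_symmetric MN).
by rewrite Ml Nl => lE; case: v w rE lE {vM wN Mr Ml Nr Nl} => [] [].
Qed.

Lemma canon2_same_bundle (C : numClosedFieldType) v M N :
  canon2 C v M -> canon2 C v N -> congr_bundle M N.
Proof.
move=> /canon2_kronecker[l [l1 lm1 fM]] /canon2_kronecker[m [m1 mm1 fN]].
have [[l2 l3 lu] [m2 m3 mu]] := (free_eigenvalues l1 lm1, free_eigenvalues m1 mm1).
exists (ktype2 v), (keigenvalues2 v l), (keigenvalues2 v m); split.
- by case: v fM fN.
- split => //; first by case: v fM fN.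
  by case: v {fM fN} => //=; rewrite inE lu.
- split => //; first by case: v fM fN.
  by case: v {fM fN} => //=; rewrite inE mu.
- case: v {fM fN} => //= i; try (by case: i => [|[|[|]]]).
  by case: i => [|[|//]] _ /=; rewrite ?(negPf l2) ?(negPf l3) ?(negPf m2) ?(negPf m3).
Qed.

Lemma congr_bundle2E (C : numClosedFieldType) v (A : 'M[C]_2) :
  congruent_to (canon2 C v) A -> congr_bundle A = congruent_to (canon2 C v).
Proof.
move=> [M vM AM]; apply/seteqP; split => B /= h.
  have [w [N wN BN]] := canon2_exists B; exists N => //.
  suff -> : v = w by [].
  exact: (canon2_bundle_inj vM wN (congr_bundle_congruent AM BN h)).
have [N vN BN] := h.
apply: (congr_bundle_congruent (congruent_sym AM) (congruent_sym BN)).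
exact: canon2_same_bundle vM vN.
Qed.

(** * Closures *)

Lemma closure_perturbation (K : numFieldType) n (X : set 'M[K]_n) (A N : 'M[K]_n) :
  (forall e, e != 0 -> X (A + e *: N)) -> closure X A.
Proof.
move=> XN B AB.
have cN : continuous (fun e : K => A + e *: N).
  by move=> x; apply: (@cvgD _ _ _ (nbhs x) (nbhs_filter x)); [exact: (@cvg_cst _ _ _
      (nbhs x) (nbhs_filter x))|apply: (@cvgZr_tmp _ _ _ (nbhs x) (nbhs_filter x));
      exact: cvg_id].
have : nbhs (A + 0 *: N) B by rewrite scale0r addr0.
move=> /(cN 0) /nbhs_ballP[e /= e0 eB].
have e2 : e / 2 != 0 by rewrite mulf_neq0 ?invr_eq0 ?gt_eqF.
exists (A + (e / 2) *: N); split; first exact: XN.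
apply: eB; rewrite /ball /= sub0r normrN gtr0_norm ?divr_gt0 //.
by rewrite ltr_pdivrMr // ltr_pMr // ltr1n.
Qed.

Lemma differentiable_add (K : numFieldType) (V : normedModType K) (f g : V -> K) x :
  differentiable f x -> differentiable g x -> differentiable (fun y => f y + g y) x.
Proof. exact: differentiableD. Qed.

Lemma differentiable_opp (K : numFieldType) (V : normedModType K) (f : V -> K) x :
  differentiable f x -> differentiable (fun y => - f y) x.
Proof. exact: differentiableN. Qed.

Lemma differentiable_mul (K : numFieldType) (V : normedModType K) (f g : V -> K) x :
  differentiable f x -> differentiable g x -> differentiable (fun y => f y * g y) x.
Proof. exact: differentiableM. Qed.

Lemma differentiable_inv (K : numFieldType) (V : normedModType K) (f : V -> K) x :
  differentiable f x -> f x != 0 -> differentiable (fun y => (f y)^-1) x.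
Proof. exact: differentiableV. Qed.

Ltac diff_poly := repeat first
  [ exact: differentiable_cst | exact: differentiable_coord
  | apply: differentiable_add | apply: differentiable_opp | apply: differentiable_mul ].

Lemma vanish_closed (K : numFieldType) (V : normedModType K) (F : V -> seq K) :
  (forall i x, differentiable (fun x => (F x)`_i) x) -> closed [set x | vanish (F x)].
Proof.
move=> dF.
(* Beyond the end of the list the default value 0 makes the condition void, so all natural numbers
   may serve as indices. *)
have -> : [set x | vanish (F x)] = \bigcap_i [set x | (F x)`_i = 0].
  apply/seteqP; split => x /=.
    move=> /allP Fx i _ /=; have [iF|iF] := ltnP i (size (F x)).
      by apply/eqP; apply: Fx; exact: mem_nth.
    by rewrite nth_default.
  move=> h; apply/allP => y /(nthP 0)[i _ <-] /=; apply/eqP; exact: h.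
apply: closed_bigI => i _; apply: (@preimage_closed _ _ (fun x => (F x)`_i) [set 0]).
  by move=> x _; exact: differentiable_continuous.
exact: (accessible_closed_set1 (hausdorff_accessible (@norm_hausdorff K K))).
Qed.

Lemma symrank2_closed (K : numFieldType) r : closed [set A : 'M[K]_2 | (symrank A <=
    r)%N].
Proof.
rewrite (_ : [set _ | _] = [set A | vanish (rank_polys2 r A)]); last first.
  by apply/seteqP; split => A /=; rewrite symrank2_le.
apply: vanish_closed => i A.
by case: r i => [|[|r]] [|[|[|i]]] /=; diff_poly.
Qed.

Lemma symrank3_closed (K : numFieldType) r : closed [set A : 'M[K]_3 | (symrank A <=
    r)%N].
Proof.
rewrite (_ : [set _ | _] = [set A | vanish (rank_polys3 r A)]); last first.
  by apply/seteqP; split => A /=; rewrite symrank3_le.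
apply: vanish_closed => i A.
by case: r i => [|[|[|r]]] [|[|[|[|[|[|i]]]]]] /=; diff_poly.
Qed.

Lemma skew_level2_closed (K : numFieldType) l : closed [set A : 'M[K]_2 | (skew_level A
    <= l)%N].
Proof.
rewrite (_ : [set _ | _] = [set A | vanish (level_polys2 l A)]); last first.
  by apply/seteqP; split => A /=; rewrite skew_level2_le.
apply: vanish_closed => i A.
by case: l i => [|l] [|i] /=; rewrite ?nth_nil; diff_poly.
Qed.

Lemma axial_level3_closed (K : numFieldType) l : closed [set A : 'M[K]_3 | (axial_level A
    <= l)%N].
Proof.
rewrite (_ : [set _ | _] = [set A | vanish (level_polys3 l A)]); last first.
  by apply/seteqP; split => A /=; rewrite axial_level3_le.
apply: vanish_closed => i A.
by case: l i => [|[|[|l]]] [|[|[|i]]] /=; rewrite ?nth_nil; diff_poly.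
Qed.

Lemma clos_refl_trans_first (V : Type) (arrow : V -> V -> Prop) v w :
  Relation_Operators.clos_refl_trans V arrow v w ->
  v = w \/ exists2 u, arrow v u & Relation_Operators.clos_refl_trans V arrow u w.
Proof.
elim=> {v w} [v w vw|v|v u w _ IH uw IHuw].
- by right; exists w => //; exact: Relation_Operators.rt_refl.
- by left.
- case: IH => [->//|[x vx xu]]; right.
  by exists x => //; exact: Relation_Operators.rt_trans xu uw.
Qed.

(** An inclusion in a closure bounds both invariants, because sublevel sets are closed and bundles
    nonempty; conversely, paths of arrows give inclusions. The remaining hypotheses on the tables
    are finite checks. *)
Lemma closure_graph_of_invariants (R : realType) n (V : Type)
    (bun : V -> set 'M[Cplx R]_n) (arrow : rel V) (rk lv : V -> nat)
    (frk flv : 'M[Cplx R]_n -> nat) :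
  (forall v A, bun v A <-> frk A = rk v /\ flv A = lv v) ->
  (forall v, bun v !=set0) -> (forall A, exists v, bun v A) ->
  (forall v A, bun v A -> congr_bundle A = bun v) ->
  (forall v w, rk v = rk w -> lv v = lv w -> v = w) ->
  (forall r, closed [set A | (frk A <= r)%N]) ->
  (forall l, closed [set A | (flv A <= l)%N]) ->
  (forall v w, arrow v w -> bun v `<=` closure (bun w)) ->
  (forall v w, (rk v <= rk w)%N -> (lv v <= lv w)%N ->
     Relation_Operators.clos_refl_trans V arrow v w) ->
  (forall v w, arrow v w -> forall u, (rk v <= rk u <= rk w)%N ->
     (lv v <= lv u <= lv w)%N -> u = v \/ u = w) ->
  (forall v, ~~ arrow v v) ->
  is_closure_graph bun arrow.
Proof.
move=> bunE bun0 bunT bunC inj crk clv arr path hasse irr.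
have graph_closure v w : Relation_Operators.clos_refl_trans V arrow v w ->
    bun v `<=` closure (bun w).
  elim=> {v w} [v w /arr//|v|v u w _ vu _ uw]; first exact: subset_closure.
  by move=> A /vu /(closure_subset uw); apply: closed_closure.
have closure_le v w : bun v `<=` closure (bun w) -> (rk v <= rk w)%N /\ (lv v <= lv w)%N.
  move=> vw; have [A vA] := bun0 v; have [<- <-] := (bunE v A).1 vA.
  split; [apply: (crk (rk w))|apply: (clv (lv w))]; move: (vw _ vA);
    by apply: closure_subset => B /bunE[r l]; rewrite /= ?r ?l.
split.
- move=> v w vw; have [A vA] := bun0 v.
  have [r l] := (bunE v A).1 vA; rewrite vw in vA; have [r' l'] := (bunE w A).1 vA.
  by apply: inj; rewrite -?r -?l ?r' ?l'.
- apply/seteqP; split => X [].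
    by move=> v _ <-; have [A vA] := bun0 v; exists A => //; exact: bunC.
  by move=> A _ <-; have [v vA] := bunT A; exists v => //; rewrite (bunC v).
- move=> v w; split; first exact: graph_closure.
  by move=> /closure_le[]; exact: path.
- move=> v w; split => [vw|[neq vw between]].
    split; last 1 first.
    + move=> u /closure_le[r1 l1] /closure_le[r2 l2].
      by apply: (hasse v w vw u); rewrite ?r1 ?l1.
    + by move=> E; move: vw; rewrite E (negPf (irr w)).
    + exact: arr.
  have [r l] := closure_le _ _ vw.
  (* The end of the first arrow on a path from [v] to [w] lies between them, hence is [w]. *)
  have [//|[u vu uw]] := clos_refl_trans_first (path _ _ r l).
  have [uv|<-//] := between u (arr _ _ vu) (graph_closure _ _ uw).
  by move: vu; rewrite uv (negPf (irr v)).
Qed.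

Lemma congruent_to_closure (K : numFieldType) n (F : set 'M[K]_n) (M N : 'M[K]_n) A :
  (forall e, e != 0 -> congruent_to F (M + e *: N)) -> congruent A M ->
  closure (congruent_to F) A.
Proof.
move=> FN /congruent_sym[P Pu PM]; apply: (@closure_perturbation _ _ _ _ (P^T *m N *m P)).
move=> e /FN; apply: congruent_to_trans; apply: congruent_sym; exists P => //.
by rewrite mulmxDr mulmxDl PM -scalemxAr -scalemxAl.
Qed.

Lemma M3_line (K : pzRingType) (t a b c d e f g h i a' b' c' d' e' f' g' h' i' : K) :
  M3 a b c d e f g h i + t *: M3 a' b' c' d' e' f' g' h' i' =
  M3 (a + t * a') (b + t * b') (c + t * c') (d + t * d') (e + t * e') (f + t * f')
     (g + t * g') (h + t * h') (i + t * i').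
Proof. by apply: matrix3P; rewrite !mxE. Qed.

Ltac perturb_mx N := exists N; intros e en0; rewrite ?M3_line
  ?(mulr0, mulr1, mulrN1, addr0, add0r).

Lemma arrow2_perturbation (C : numClosedFieldType) v w M : arrow2 v w -> canon2 C v M ->
  exists N, forall e, e != 0 ->
    symrank (M + e *: N) = rk2 w /\ skew_level (M + e *: N) = lv2 w.
Proof.
case: v w => [] [] //= _ ->.
- perturb_mx (M2 1 0 0 0 : 'M[C]_2).
  by split; [invS symrank2P 0%N (2%:R * e)|level0].
- perturb_mx (M2 0 1 (-1) 0 : 'M[C]_2).
  by split; [rank0|invS skew_level2P 0%N (2%:R * e)].
- perturb_mx (M2 0 0 0 1 : 'M[C]_2).
  by split; [invS symrank2P 0%N (4%:R * e)|level0].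
- perturb_mx (M2 0 1 (-1) 0 : 'M[C]_2).
  by split; [invS symrank2P 0%N (2%:R : C)|invS skew_level2P 0%N (2%:R * e)].
- perturb_mx (M2 0 1 (-1) 0 : 'M[C]_2).
  by split; [invS symrank2P 0%N (4%:R : C)|invS skew_level2P 0%N (2%:R * e)].
- perturb_mx (M2 0 0 0 1 : 'M[C]_2).
  by split; [invS symrank2P 2%N (2%:R * e)|invS skew_level2P 0%N (2%:R : C)].
- perturb_mx (M2 1 0 0 0 : 'M[C]_2).
  by split; [invS symrank2P 0%N (4%:R * e)|invS skew_level2P 0%N (-2%:R : C)].
Qed.

(** Each [N] below is either symmetric, which moves S and fixes k, or skew-symmetric, which moves k
    and fixes S. *)
Lemma arrow3_perturbation (C : numClosedFieldType) v w M : arrow3 v w -> canon3 C v M ->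
  exists N, forall e, e != 0 ->
    symrank (M + e *: N) = rk3 w /\ axial_level (M + e *: N) = lv3 w.
Proof.
have nz (l : C) : l != 1 -> l != -1 -> 1 - l != 0 /\ 1 + l != 0.
  by move=> l1 lm1; rewrite subr_eq0 eq_sym l1 addrC addr_eq0 lm1.
case: v w => [] [] //= _.
- move=> ->; perturb_mx (M3 0 1 0 (-1) 0 0 0 0 0 : 'M[C]_3).
  by split; [rank0|invS axial_level3P 2%N (2%:R * e)].
- move=> ->; perturb_mx (M3 1 0 0 0 0 0 0 0 0 : 'M[C]_3).
  by split; [invS symrank3P 0%N (2%:R * e)|level0].
- move=> ->; perturb_mx (M3 0 0 0 0 1 0 0 0 0 : 'M[C]_3).
  by split; [invS symrank3P 1%N (2%:R * e)|invS axial_level3P 2%N (2%:R : C)].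
- move=> ->; perturb_mx (M3 0 1 0 (-1) 0 0 0 0 0 : 'M[C]_3).
  by split; [invS symrank3P 0%N (2%:R : C)|invS axial_level3P 2%N (2%:R * e)].
- move=> ->; perturb_mx (M3 0 0 0 0 1 0 0 0 0 : 'M[C]_3).
  by split; [invS symrank3P 2%N (4%:R * e)|level0].
- move=> ->; perturb_mx (M3 0 0 (-1) 0 0 0 1 0 0 : 'M[C]_3).
  by split; [invS symrank3P 1%N (2%:R : C)|invS axial_level3P 0%N (8%:R * e ^+ 2)].
- move=> ->; perturb_mx (M3 1 0 0 0 0 0 0 0 0 : 'M[C]_3).
  by split; [invS symrank3P 2%N (4%:R * e)|invS axial_level3P 2%N (-2%:R : C)].
- move=> ->; perturb_mx (M3 0 0 0 0 0 0 0 0 1 : 'M[C]_3).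
  by split; [invS symrank3P 0%N (8%:R * e)|level0].
- move=> ->; perturb_mx (M3 0 1 0 (-1) 0 0 0 0 0 : 'M[C]_3).
  by split; [invS symrank3P 2%N (4%:R : C)|invS axial_level3P 2%N (2%:R * e)].
- move=> ->; perturb_mx (M3 1 0 0 0 0 0 0 0 0 : 'M[C]_3).
  by split; [invS symrank3P 1%N (4%:R * e)|invS axial_level3P 0%N (8%:R : C)].
(* This skew matrix creates the axial vector [2 e (1, 'i, 0)], isotropic for S = 2 I: the level
   jumps from 0 to 2. *)
- move=> ->; rewrite (M3_eta 1%:M) !mxE /=; perturb_mx (M3 0 0 (- 'i) 0 0 1 'i (-1) 0 :
    'M[C]_3).
  split; first by invS symrank3P 0%N (8%:R : C).
  apply: (@axial_level3P _ _ _ 0 (4%:R * e)); last by rewrite mulf_neq0 // pnatr_eq0.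
    rewrite level_polys3_M3 /vanish /= andbT; apply/eqP.
    by transitivity (8%:R * e ^+ 2 * (1 + 'i ^+ 2)); [ring|rewrite sqrCi subrr mulr0].
  by rewrite level_polys3_M3 /=; ring.
- move=> ->; perturb_mx (M3 0 0 (-1) 0 0 0 1 0 0 : 'M[C]_3).
  by split; [invS symrank3P 0%N (-1%:R : C)|invS axial_level3P 0%N (8%:R * e)].
(* With k = (1, 0, 1) fixed, the entries -2 and 1 cancel in k^T S k, while det S becomes [8 e]. *)
- move=> ->; perturb_mx (M3 (-2) 0 1 0 0 0 1 0 0 : 'M[C]_3).
  by split; [invS symrank3P 0%N (8%:R * e)|invS axial_level3P 1%N (2%:R : C)].
- move=> ->; perturb_mx (M3 1 0 0 0 0 0 0 0 0 : 'M[C]_3).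
  by split; [invS symrank3P 0%N (8%:R * e)|invS axial_level3P 0%N (8%:R : C)].
- move=> ->; perturb_mx (M3 1 0 0 0 0 0 0 0 0 : 'M[C]_3).
  by split; [invS symrank3P 0%N (8%:R : C)|invS axial_level3P 0%N (8%:R * e)].
- move=> [l [l1 lm1 ->]]; have [h1 h2] := nz _ l1 lm1; rewrite /HB0.
  perturb_mx (M3 0 0 0 0 0 1 0 (-1) 0 : 'M[C]_3).
  by split; [invS symrank3P 2%N (- (1 + l) ^+ 2)|invS axial_level3P 1%N (2%:R * e * (1 +
      l))].
Qed.

(** Searching a first step in the list [s] makes the hypothesis checkable by computation; the growth
    of [rk + lv] along steps bounds the path length. *)
Lemma clos_refl_trans_measure (V : Type) (arrow : rel V) (rk lv : V -> nat) (s : seq V) :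
  let le v w := (rk v <= rk w)%N && (lv v <= lv w)%N in
  (forall v w, le v w -> v = w \/
     has (fun u => [&& arrow v u, le u w & rk v + lv v < rk u + lv u]%N) s) ->
  forall v w, (rk v <= rk w)%N -> (lv v <= lv w)%N ->
  Relation_Operators.clos_refl_trans V arrow v w.
Proof.
move=> le step v w vr vl; have vw : le v w by rewrite /le vr.
have [k] := ubnP (rk w + lv w - (rk v + lv v))%N.
elim: k v vw {vr vl} => // k IH v vw vk.
have [->|] := step v w vw; first exact: Relation_Operators.rt_refl.
elim: s {step} => //= u s IHs /orP[/and3P[vu uw mvu]|//].
apply: Relation_Operators.rt_trans (Relation_Operators.rt_step _ _ _ _ vu) _.
apply: IH => //; rewrite -ltnS; apply: leq_ltn_trans vk.
by rewrite ltn_sub2l // (leq_trans mvu) // leq_add //; case/andP: uw.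
Qed.

Lemma arrow2_path v w : (rk2 v <= rk2 w)%N -> (lv2 v <= lv2 w)%N ->
  Relation_Operators.clos_refl_trans vertex2 arrow2 v w.
Proof.
apply: (clos_refl_trans_measure (s := [:: v_D; v_I; v_H; v_Gamma; v_B])) => {v w}.
by move=> [] [] // _; first [left; reflexivity | right; reflexivity].
Qed.

Lemma arrow3_path v w : (rk3 v <= rk3 w)%N -> (lv3 v <= lv3 w)%N ->
  Relation_Operators.clos_refl_trans vertex3 arrow3 v w.
Proof.
apply: (clos_refl_trans_measure (s := [:: v_m1sq_0; v_100; v_1sq_0; v_110; v_m1sq_1;
  v_111; v_0cube; v_1sq_1; v_1cube; v_B0; v_B1])) => {v w}.
by move=> [] [] // _; first [left; reflexivity | right; reflexivity].
Qed.

Lemma canon2_nonempty (C : numClosedFieldType) v : canon2 C v !=set0.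
Proof.
case: v => /=; try by eexists.
by exists (H2 0); exists 0; rewrite eq_sym oner_neq0 eq_sym oppr_eq0 oner_neq0.
Qed.

Lemma canon3_nonempty (C : numClosedFieldType) v : canon3 C v !=set0.
Proof.
have z : (0 : C) != 1 /\ (0 : C) != -1.
  by rewrite eq_sym oner_neq0 eq_sym oppr_eq0 oner_neq0.
case: z => z1 zm1; case: v => /=; try by eexists.
  by exists (HB0 0); exists 0.
by exists (HB1 0); exists 0.
Qed.

Lemma arrow2_closure (C : numClosedFieldType) v w : arrow2 v w ->
  congruent_to (canon2 C v) `<=` closure (congruent_to (canon2 C w)).
Proof.
move=> vw A [M vM AM]; have [N NE] := arrow2_perturbation vw vM.
by apply: congruent_to_closure AM => e /NE h; rewrite congruent_to_canon2; exact: h.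
Qed.

Lemma arrow3_closure (C : numClosedFieldType) v w : arrow3 v w ->
  congruent_to (canon3 C v) `<=` closure (congruent_to (canon3 C w)).
Proof.
move=> vw A [M vM AM]; have [N NE] := arrow3_perturbation vw vM.
by apply: congruent_to_closure AM => e /NE h; rewrite congruent_to_canon3; exact: h.
Qed.

Lemma closure_graph2 (R : realType) :
  is_closure_graph (fun v => congruent_to (canon2 (Cplx R) v)) arrow2.
Proof.
apply: (@closure_graph_of_invariants _ _ _ _ _ rk2 lv2 (@symrank _ _) (@skew_level _ _)).
- by move=> v A; rewrite congruent_to_canon2.
- move=> v; have [M vM] := canon2_nonempty (Cplx R) v.
  by exists M, M => //; exact: congruent_refl.
- exact: canon2_exists.
- exact: congr_bundle2E.
- by move=> [] [].
- exact: symrank2_closed.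
- exact: skew_level2_closed.
- exact: arrow2_closure.
- exact: arrow2_path.
- by move=> [] [] // _ [] //=; by [left|right].
- by case.
Qed.

Lemma closure_graph3 (R : realType) :
  is_closure_graph (fun v => congruent_to (canon3 (Cplx R) v)) arrow3.
Proof.
apply: (@closure_graph_of_invariants _ _ _ _ _ rk3 lv3 (@symrank _ _) (@axial_level _)).
- by move=> v A; rewrite congruent_to_canon3.
- move=> v; have [M vM] := canon3_nonempty (Cplx R) v.
  by exists M, M => //; exact: congruent_refl.
- exact: canon3_exists.
- exact: congr_bundle3E.
- by move=> [] [].
- exact: symrank3_closed.
- exact: axial_level3_closed.
- exact: arrow3_closure.
- exact: arrow3_path.
- by move=> [] [] // _ [] //=; by [left|right].
- by case.
Qed.

(** * Dimensions *)

Lemma differentiable_mx (K : numFieldType) (V : normedModType K) m n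
    (F : V -> 'M[K]_(m, n)) x :
  (forall i j, differentiable (fun y => F y i j) x) -> differentiable F x.
Proof.
move=> dF; have -> : F = \sum_(i < m) \sum_(j < n) (fun y => F y i j *: delta_mx i j).
  apply/funext => y; rewrite {1}(matrix_sum_delta (F y)) fct_sumE.
  by apply: eq_bigr => i _; rewrite fct_sumE.
apply: differentiable_sum => i; apply: differentiable_sum => j.
exact: differentiableZl.
Qed.

Lemma open_neq0 (K : numFieldType) (V : normedModType K) (g : V -> K) :
  (forall x, differentiable g x) -> open [set x | g x != 0].
Proof.
move=> dg; have -> : [set x | g x != 0] = ~` (g @^-1` [set 0]).
  by apply/seteqP; split => x /= /eqP.
rewrite openC; apply: preimage_closed.
  by move=> x _; exact: differentiable_continuous.
exact: (accessible_closed_set1 (hausdorff_accessible (@norm_hausdorff K K))).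
Qed.

(** As [U] is open, [psi \o phi] is the identity near [u], and the chain rule makes ['d psi (phi u)]
    a left inverse of ['d phi u]. *)
Lemma left_inverse_diff_inj (K : numFieldType) (V W : normedModType K)
    (U : set V) (phi : V -> W) (psi : W -> V) u :
  open U -> U u -> (forall u, U u -> psi (phi u) = u) ->
  differentiable phi u -> differentiable psi (phi u) -> injective ('d phi u).
Proof.
move=> Uo Uu psiK dphi dpsi; apply: (can_inj (g := 'd psi (phi u))) => v.
have -> : 'd psi (phi u) ('d phi u v) = 'd (psi \o phi) u v by rewrite (diff_comp dphi
    dpsi).
rewrite -deriveE; last exact: differentiable_comp.
rewrite (@near_eq_derive _ _ _ _ id) ?derive_id //.
have : nbhs u U by exact: open_nbhs_nbhs.
by apply: filterS => x /psiK.
Qed.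

Lemma left_inverse_open_image (V W : topologicalType)
    (U : set V) (phi : V -> W) (psi : W -> V) :
  (forall u, U u -> psi (phi u) = u) -> (forall u, U u -> {for phi u, continuous psi}) ->
  forall B, open B -> B `<=` U -> exists2 A, open A & phi @` B = A `&` phi @` U.
Proof.
move=> psiK cpsi B Bo BU; exists ((psi @^-1` B)°); first exact: open_interior.
apply/seteqP; split => y.
  move=> [u Bu <-]; split; last by exists u => //; exact: BU.
  apply: cpsi; first exact: BU.
  by rewrite psiK; [exact: open_nbhs_nbhs|exact: BU].
move=> [/interior_subset /= + [u Uu yE]]; rewrite -yE psiK // => Bu.
by exists u.
Qed.

Lemma submanifold_of_left_inverse (R : realType) n d (X : set 'M[Cplx R]_n)
    (U : set 'rV[Cplx R]_d) (phi : 'rV[Cplx R]_d -> 'M[Cplx R]_n) psi :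
  open U -> U !=set0 -> (forall u, U u -> differentiable phi u) ->
  (forall u, U u -> differentiable psi (phi u)) ->
  (forall u, U u -> psi (phi u) = u) -> (forall u, U u -> X (phi u)) ->
  contains_submanifold X d.
Proof.
move=> Uo U0 dphi dpsi psiK XU; exists U, phi; last by move=> _ [u Uu <-]; exact: XU.
split => //.
- by move=> u Uu; split; [exact: dphi|exact: (left_inverse_diff_inj Uo Uu psiK (dphi _
    Uu) (dpsi _ Uu))].
- by move=> u v; rewrite !inE => Uu Uv E; rewrite -(psiK u) // E psiK.
- apply: (@left_inverse_open_image _ _ U phi psi) => // u Uu.
  exact: differentiable_continuous (dpsi u Uu).
Qed.

(** * Upper bounds from limit directions *)

Lemma limit_direction (K : numFieldType) (V W : normedModType K) (U : set V)
    (phi : V -> W) (X : set W) u v :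
  open U -> U u -> phi @` U `<=` X -> differentiable phi u ->
  closure [set p : K * W | p.1 != 0 /\ X (phi u + p.1 *: p.2)] (0, 'd phi u v).
Proof.
move=> Uo Uu UX dphi B; rewrite -deriveE // => -[[B1 B2] /= [B1n B2n] sB].
have h1 : \forall h \near (0 : K)^', B1 h by exact: nbhs_dnbhs.
have h2 : \forall h \near (0 : K)^', B2 (h^-1 *: ((phi \o shift u) (h *: v) - phi u)).
  exact: (diff_derivable dphi).
have h3 : \forall h \near (0 : K)^', U (h *: v + u).
  have cU : continuous (fun h : K => h *: v + u).
    by move=> x; apply: (@cvgD _ _ _ (nbhs x) (nbhs_filter x));
      [apply: (@cvgZr_tmp _ _ _ (nbhs x) (nbhs_filter x)); exact: cvg_id
      |exact: (@cvg_cst _ _ _ (nbhs x) (nbhs_filter x))].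
  have : nbhs (0 *: v + u) U by rewrite scale0r add0r; exact: open_nbhs_nbhs.
  by move=> /(cU 0) /=; exact: nbhs_dnbhs.
have h4 : \forall h \near (0 : K)^', h != 0 by exact: nbhs_dnbhs_neq.
(* A small [h != 0] and the difference quotient of [phi] along [v] form the required pair: adding
   [h] times the quotient to [phi u] gives a value of [phi]. *)
have [h [[[Bh1 Bh2] Uh] h0]] := filter_ex (filterI (filterI (filterI h1 h2) h3) h4).
exists (h, h^-1 *: ((phi \o shift u) (h *: v) - phi u)); split => /=; last exact: sB.
split => //; rewrite scalerA divff // scale1r addrC subrK; apply: UX.
by exists (h *: v + u).
Qed.

Lemma linear_injective_dim (K : fieldType) m n (f : {linear 'rV[K]_m -> 'rV[K]_n}) :
  (forall v, f v = 0 -> v = 0) -> (m <= n)%N.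
Proof.
move=> f0; have : row_free (lin1_mx f).
  by apply: inj_row_free => v; rewrite mul_rV_lin1; exact: f0.
by rewrite -row_leq_rank => /leq_trans; apply; exact: rank_leq_col.
Qed.

Lemma congruence_continuous (K : numFieldType) n (P : 'M[K]_n) :
  continuous (fun A : 'M[K]_n => P^T *m A *m P).
Proof.
move=> A; apply: differentiable_continuous; apply: differentiable_mx => i j.
have -> : (fun B : 'M[K]_n => (P^T *m B *m P) i j) =
    \sum_(k < n) \sum_(l < n) (fun B : 'M[K]_n => P^T i l * B l k * P k j).
  apply/funext => B; rewrite mxE fct_sumE; apply: eq_bigr => k _.
  by rewrite mxE fct_sumE mulr_suml.
by apply: differentiable_sum => k; apply: differentiable_sum => l; diff_poly.
Qed.

Lemma diff_linear_comp (K : numFieldType) (V W W' : normedModType K)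
    (L : {linear W -> W'}) (phi : V -> W) u :
  continuous L -> differentiable phi u ->
  differentiable (L \o phi) u /\ (forall v, 'd (L \o phi) u v = L ('d phi u v)).
Proof.
move=> cL dphi; have dL : differentiable L (phi u) by exact: linear_differentiable.
split; first exact: differentiable_comp.
move=> v; have -> : 'd (L \o phi) u v = 'd L (phi u) ('d phi u v) by rewrite (diff_comp
    dphi dL).
by rewrite diff_lin.
Qed.

Lemma diff_congruence (K : numFieldType) (V : normedModType K) n (P : 'M[K]_n)
    (phi : V -> 'M[K]_n) u :
  differentiable phi u ->
  differentiable (fun x => P^T *m phi x *m P) u /\
  (forall v, 'd (fun x => P^T *m phi x *m P) u v = P^T *m 'd phi u v *m P).
Proof.
have lin : linear (fun A : 'M[K]_n => P^T *m A *m P).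
  by move=> a A B; rewrite mulmxDr mulmxDl -scalemxAr -scalemxAl.
pose L : {linear 'M[K]_n -> 'M[K]_n} := HB.pack (fun A : 'M[K]_n => P^T *m A *m P)
  (GRing.isLinear.Build K 'M[K]_n 'M[K]_n *:%R (fun A : 'M[K]_n => P^T *m A *m P) lin).
exact: (@diff_linear_comp _ _ _ _ L phi u (@congruence_continuous _ _ P)).
Qed.

(** A congruence moves [phi u] to its canonical matrix [M]. Reading the entries at the positions [s]
    is then a linear map on the parameter directions, injective because a limit direction at [M]
    with these entries zero is zero. *)
Lemma tangent_dim (K : numFieldType) n d (F : set 'M[K]_n) (s : seq ('I_n * 'I_n))
    (U : set 'rV[K]_d) (phi : 'rV[K]_d -> 'M[K]_n) :
  (forall M T, F M ->
    closure [set p : K * 'M[K]_n | p.1 != 0 /\ congruent_to F (M + p.1 *: p.2)] (0, T) ->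
    (forall ij, ij \in s -> T ij.1 ij.2 = 0) -> T = 0) ->
  open U -> U !=set0 -> phi @` U `<=` congruent_to F ->
  (forall u, U u -> differentiable phi u /\ injective ('d phi u)) ->
  (d <= size s)%N.
Proof.
move=> tangent Uo [u Uu] UF dphi; have [du iu] := dphi u Uu.
have [|M FM [P Pu PM]] := UF (phi u); first by exists u.
have [dpsi psiE] := diff_congruence P du.
set psi := (fun x => P^T *m phi x *m P) in dpsi psiE.
have psiF : psi @` U `<=` congruent_to F.
  move=> _ [x Ux <-]; apply: (@congruent_to_trans _ _ _ _ (phi x)).
    by apply: congruent_sym; exists P.
  by apply: UF; exists x.
pose f v : 'rV[K]_(size s) := \row_k ('d psi u v) (tnth (in_tuple s) k).1 (tnth (in_tuple
    s) k).2.
have fl : linear f.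
  move=> a v w; apply/rowP => k; rewrite !mxE linearP !mxE //.
pose fL : {linear 'rV[K]_d -> 'rV[K]_(size s)} :=
  HB.pack f (GRing.isLinear.Build K 'rV[K]_d 'rV[K]_(size s) *:%R f fl).
apply: (linear_injective_dim (f := fL)) => v /= fv0.
have T0 : 'd psi u v = 0.
  apply: (tangent M) => //.
    have -> : M = psi u by rewrite /psi PM.
    exact: (limit_direction Uo Uu psiF dpsi).
  move=> ij /(tnthP (in_tuple s)) [k ->].
  by have /rowP /(_ k) := fv0; rewrite !mxE.
apply: iu; rewrite linear0.
apply: (can_inj (mulKmx (_ : P^T \in unitmx))); first by rewrite unitmx_tr.
by apply: (can_inj (mulmxK Pu)); rewrite mulmx0 mul0mx -psiE.
Qed.

Lemma submanifold_dim_le (R : realType) n d (F : set 'M[Cplx R]_n) (s : seq ('I_n *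
    'I_n)) :
  (forall M T, F M ->
    closure [set p : Cplx R * 'M[Cplx R]_n |
      p.1 != 0 /\ congruent_to F (M + p.1 *: p.2)] (0, T) ->
    (forall ij, ij \in s -> T ij.1 ij.2 = 0) -> T = 0) ->
  contains_submanifold (congruent_to F) d -> (d <= size s)%N.
Proof.
move=> tangent [U [phi [[Uo U0] dphi _ _] UF]].
exact: (tangent_dim tangent Uo U0 UF dphi).
Qed.

Lemma limit_direction_vanish (K : numFieldType) (V : normedModType K)
    (Z : set V) (G : V -> K) x :
  closure Z x -> (forall y, differentiable G y) -> (forall y, Z y -> G y = 0) -> G x = 0.
Proof.
move=> Zx dG ZG; have : closed (G @^-1` [set 0]).
  apply: preimage_closed; first by move=> y _; exact: differentiable_continuous.
  exact: (accessible_closed_set1 (hausdorff_accessible (@norm_hausdorff K K))).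
by apply; apply: closure_subset Zx => y /ZG.
Qed.

Lemma differentiable_fst (K : numFieldType) (V W : normedModType K) (x : V * W) :
  differentiable (fst : V * W -> V) x.
Proof.
have lin : linear (fst : V * W -> V) by [].
pose L : {linear (V * W)%type -> V} := HB.pack (fst : V * W -> V)
  (GRing.isLinear.Build K (V * W)%type V *:%R fst lin).
apply: (@linear_differentiable _ _ _ L) => y; exact: cvg_fst.
Qed.

Lemma differentiable_snd (K : numFieldType) (V W : normedModType K) (x : V * W) :
  differentiable (snd : V * W -> W) x.
Proof.
have lin : linear (snd : V * W -> W) by [].
pose L : {linear (V * W)%type -> W} := HB.pack (snd : V * W -> W)
  (GRing.isLinear.Build K (V * W)%type W *:%R snd lin).
apply: (@linear_differentiable _ _ _ L) => y; exact: cvg_snd.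
Qed.

Lemma differentiable_fst_scalar (K : numFieldType) (W : normedModType K) (x : K * W) :
  differentiable (fun p : K * W => p.1) x.
Proof. exact: (@differentiable_fst _ K^o W). Qed.

Lemma differentiable_snd_coord (K : numFieldType) m n i j (x : K * 'M[K]_(m, n)) :
  differentiable (fun p : K * 'M[K]_(m, n) => p.2 i j) x.
Proof.
exact: (differentiable_comp (@differentiable_snd _ K^o _ x) (differentiable_coord x.2 i
    j)).
Qed.

Lemma vanish_nth (K : nmodType) (s : seq K) i : vanish s -> s`_i = 0.
Proof. by move=> s0; apply/eqP/negPn/negP => /vanishN; rewrite s0. Qed.

Definition bundle_direction (K : numFieldType) n (X : set 'M[K]_n) (M T : 'M[K]_n) :=
  closure [set p : K * 'M[K]_n | p.1 != 0 /\ X (M + p.1 *: p.2)] (0, T).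

(* [G 0 T = 0] is the linearization at [M], in the direction [T], of the equation
   [(P A)`_i = 0] of [X]. *)
Lemma bundle_direction_linearize (K : numFieldType) n (X : set 'M[K]_n) M T
    (P : 'M[K]_n -> seq K) i (G : K -> 'M[K]_n -> K) :
  bundle_direction X M T -> (forall A, X A -> vanish (P A)) ->
  (forall y, differentiable (fun p : K * 'M[K]_n => G p.1 p.2) y) ->
  (forall t B, (P (M + t *: B))`_i = t * G t B) -> G 0 T = 0.
Proof.
move=> dir XP dG PG.
apply: (limit_direction_vanish (G := fun p => G p.1 p.2) dir dG) => -[t B] /= [t0 XB].
by apply: (mulfI t0); rewrite mulr0 -PG vanish_nth //; exact: XP.
Qed.

Ltac diff_pair := repeat first
  [ exact: differentiable_cst | exact: differentiable_fst_scalar | exact: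
      differentiable_snd_coord
  | apply: differentiable_add | apply: differentiable_opp | apply: differentiable_mul ].

Ltac lin_eq H i G :=
  rewrite -[RHS](H i G);
  [rewrite /=; ring | intros; diff_pair | intros; rewrite /= !mxE /=; ring].

Ltac lin_comb e := transitivity e; [by [ring|fieldx] |].

(** A choice of entries of a tangent matrix that determine all others through the linearized
    equations; their number is [dim2 v]. *)
Definition positions2 (v : vertex2) : seq ('I_2 * 'I_2) :=
  match v with
  | v_0 => [::]
  | v_H => [:: (f0, f1)]
  | v_D => [:: (f0, f0); (f0, f1)]
  | v_Gamma => [:: (f1, f1); (f0, f1); (f1, f0)]
  | v_I => [:: (f0, f0); (f0, f1); (f1, f1)]
  | v_B => [:: (f0, f0); (f0, f1); (f1, f0); (f1, f1)]
  end.

Definition positions3 (v : vertex3) : seq ('I_3 * 'I_3) :=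
  match v with
  | v_000 => [::]
  | v_m1sq_0 => [:: (e0, e1); (e0, e2); (e1, e2)]
  | v_100 => [:: (e0, e0); (e0, e1); (e0, e2)]
  | v_1sq_0 => [:: (e1, e1); (e0, e1); (e1, e0); (e1, e2); (e2, e1)]
  | v_110 => [:: (e0, e0); (e1, e1); (e0, e1); (e0, e2); (e1, e2)]
  | v_m1sq_1 => [:: (e2, e2); (e1, e2); (e2, e1); (e0, e2); (e2, e0); (e0, e1)]
  | v_111 => [:: (e0, e0); (e0, e1); (e0, e2); (e1, e1); (e1, e2); (e2, e2)]
  | v_0cube => [:: (e2, e2); (e1, e1); (e1, e2); (e2, e1); (e0, e1); (e1, e0); (e0, e2)]
  | v_1sq_1 => [:: (e0, e1); (e0, e2); (e1, e0); (e1, e1); (e1, e2); (e2, e0); (e2, e1);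
      (e2, e2)]
  | v_1cube => [:: (e0, e1); (e0, e2); (e1, e0); (e1, e1); (e1, e2); (e2, e0); (e2, e1);
      (e2, e2)]
  | v_B0 => [:: (e0, e0); (e1, e1); (e0, e1); (e1, e0); (e0, e2); (e2, e1)]
  | v_B1 => [:: (e0, e0); (e0, e1); (e0, e2); (e1, e0); (e1, e1); (e1, e2); (e2, e0);
      (e2, e1); (e2, e2)]
  end.

Lemma canon2_tangent (C : numClosedFieldType) v M T : canon2 C v M ->
  bundle_direction (congruent_to (canon2 C v)) M T ->
  (forall ij, ij \in positions2 v -> T ij.1 ij.2 = 0) -> T = 0.
Proof.
move=> vM dir.
have XR A : congruent_to (canon2 C v) A -> vanish (rank_polys2 (rk2 v) A).
  by rewrite congruent_to_canon2 => -[<- _]; rewrite -symrank2_le.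
have XL A : congruent_to (canon2 C v) A -> vanish (level_polys2 (lv2 v) A).
  by rewrite congruent_to_canon2 => -[_ <-]; rewrite -skew_level2_le.
have hR i G := bundle_direction_linearize (i := i) (G := G) dir XR.
have hL i G := bundle_direction_linearize (i := i) (G := G) dir XL.
case: v vM hR hL {dir XR XL} => /=.
- move=> -> hR hL pos.
  have ha : syment T f0 f0 = 0
    by abstract lin_eq hR 0%N (fun (t : C) (B : 'M[C]_2) => syment B f0 f0).
  have hb : syment T f0 f1 = 0
    by abstract lin_eq hR 1%N (fun (t : C) (B : 'M[C]_2) => syment B f0 f1).
  have hc : syment T f1 f1 = 0
    by abstract lin_eq hR 2%N (fun (t : C) (B : 'M[C]_2) => syment B f1 f1).
  have hk : skewent T f0 f1 = 0
    by abstract lin_eq hL 0%N (fun (t : C) (B : 'M[C]_2) => skewent B f0 f1).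
  have p00 : T f0 f0 = 0.
    by lin_comb ((syment T f0 f0) / 2 : C); rewrite ?(ha) ?(mulr0, mul0r, addr0, subr0,
        sub0r, oppr0).
  have p11 : T f1 f1 = 0.
    by lin_comb ((syment T f1 f1) / 2 : C); rewrite ?(hc) ?(mulr0, mul0r, addr0, subr0,
        sub0r, oppr0).
  have p01 : T f0 f1 = 0.
    by lin_comb (((syment T f0 f1) + (skewent T f0 f1)) / 2 : C); rewrite ?(hb, hk)
        ?(mulr0, mul0r, addr0, subr0, sub0r, oppr0).
  have p10 : T f1 f0 = 0.
    by lin_comb (((syment T f0 f1) - (skewent T f0 f1)) / 2 : C); rewrite ?(hb, hk)
        ?(mulr0, mul0r, addr0, subr0, sub0r, oppr0).
  by apply: matrix2P; rewrite mxE.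
- move=> -> hR hL pos.
  have p00 := pos (f0, f0) isT.
  have p01 := pos (f0, f1) isT.
  have hk : skewent T f0 f1 = 0
    by abstract lin_eq hL 0%N (fun (t : C) (B : 'M[C]_2) => skewent B f0 f1).
  have he : 2 * syment T f1 f1 = 0
    by abstract lin_eq hR 0%N (fun (t : C) (B : 'M[C]_2) => 2 * syment B f1 f1 + t *
        (syment B f0 f0 * syment B f1 f1 - syment B f0 f1 * syment B f0 f1)).
  have p11 : T f1 f1 = 0.
    by lin_comb ((2 * syment T f1 f1) / 4 : C); rewrite ?(he) ?(mulr0, mul0r, addr0,
        subr0, sub0r, oppr0).
  have p10 : T f1 f0 = 0.
    by lin_comb (T f0 f1 - (skewent T f0 f1) : C); rewrite ?(hk, p01) ?(mulr0, mul0r,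
        addr0, subr0, sub0r, oppr0).
  by apply: matrix2P; rewrite mxE.
- move=> -> hR hL pos.
  have p00 := pos (f0, f0) isT.
  have p01 := pos (f0, f1) isT.
  have p11 := pos (f1, f1) isT.
  have hk : skewent T f0 f1 = 0
    by abstract lin_eq hL 0%N (fun (t : C) (B : 'M[C]_2) => skewent B f0 f1).
  have p10 : T f1 f0 = 0.
    by lin_comb (T f0 f1 - (skewent T f0 f1) : C); rewrite ?(hk, p01) ?(mulr0, mul0r,
        addr0, subr0, sub0r, oppr0).
  by apply: matrix2P; rewrite mxE.
- move=> -> hR hL pos.
  have p01 := pos (f0, f1) isT.
  have ha : syment T f0 f0 = 0
    by abstract lin_eq hR 0%N (fun (t : C) (B : 'M[C]_2) => syment B f0 f0).
  have hb : syment T f0 f1 = 0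
    by abstract lin_eq hR 1%N (fun (t : C) (B : 'M[C]_2) => syment B f0 f1).
  have hc : syment T f1 f1 = 0
    by abstract lin_eq hR 2%N (fun (t : C) (B : 'M[C]_2) => syment B f1 f1).
  have p00 : T f0 f0 = 0.
    by lin_comb ((syment T f0 f0) / 2 : C); rewrite ?(ha) ?(mulr0, mul0r, addr0, subr0,
        sub0r, oppr0).
  have p11 : T f1 f1 = 0.
    by lin_comb ((syment T f1 f1) / 2 : C); rewrite ?(hc) ?(mulr0, mul0r, addr0, subr0,
        sub0r, oppr0).
  have p10 : T f1 f0 = 0.
    by lin_comb ((syment T f0 f1) - T f0 f1 : C); rewrite ?(hb, p01) ?(mulr0, mul0r,
        addr0, subr0, sub0r, oppr0).
  by apply: matrix2P; rewrite mxE.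
- move=> -> hR hL pos.
  have p11 := pos (f1, f1) isT.
  have p01 := pos (f0, f1) isT.
  have p10 := pos (f1, f0) isT.
  have he : 2 * syment T f0 f0 = 0
    by abstract lin_eq hR 0%N (fun (t : C) (B : 'M[C]_2) => 2 * syment B f0 f0 + t *
        (syment B f0 f0 * syment B f1 f1 - syment B f0 f1 * syment B f0 f1)).
  have p00 : T f0 f0 = 0.
    by lin_comb ((2 * syment T f0 f0) / 4 : C); rewrite ?(he) ?(mulr0, mul0r, addr0,
        subr0, sub0r, oppr0).
  by apply: matrix2P; rewrite mxE.
- move=> _ hR hL pos.
  have p00 := pos (f0, f0) isT.
  have p01 := pos (f0, f1) isT.
  have p10 := pos (f1, f0) isT.
  have p11 := pos (f1, f1) isT.
  by apply: matrix2P; rewrite mxE.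
Qed.

Lemma canon3_tangent (C : numClosedFieldType) v M T : canon3 C v M ->
  bundle_direction (congruent_to (canon3 C v)) M T ->
  (forall ij, ij \in positions3 v -> T ij.1 ij.2 = 0) -> T = 0.
Proof.
move=> vM dir.
have XR A : congruent_to (canon3 C v) A -> vanish (rank_polys3 (rk3 v) A).
  by rewrite congruent_to_canon3 => -[<- _]; rewrite -symrank3_le.
have XL A : congruent_to (canon3 C v) A -> vanish (level_polys3 (lv3 v) A).
  by rewrite congruent_to_canon3 => -[_ <-]; rewrite -axial_level3_le.
have hR i G := bundle_direction_linearize (i := i) (G := G) dir XR.
have hL i G := bundle_direction_linearize (i := i) (G := G) dir XL.
case: v vM hR hL {dir XR XL} => /=.
- move=> -> hR hL pos.
  have ha : syment T e0 e0 = 0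
    by abstract lin_eq hR 0%N (fun (t : C) (B : 'M[C]_3) => syment B e0 e0).
  have hb : syment T e1 e1 = 0
    by abstract lin_eq hR 1%N (fun (t : C) (B : 'M[C]_3) => syment B e1 e1).
  have hc : syment T e2 e2 = 0
    by abstract lin_eq hR 2%N (fun (t : C) (B : 'M[C]_3) => syment B e2 e2).
  have hx : syment T e1 e2 = 0
    by abstract lin_eq hR 3%N (fun (t : C) (B : 'M[C]_3) => syment B e1 e2).
  have hy : syment T e0 e2 = 0
    by abstract lin_eq hR 4%N (fun (t : C) (B : 'M[C]_3) => syment B e0 e2).
  have hz : syment T e0 e1 = 0
    by abstract lin_eq hR 5%N (fun (t : C) (B : 'M[C]_3) => syment B e0 e1).
  have hu : skewent T e1 e2 = 0
    by abstract lin_eq hL 0%N (fun (t : C) (B : 'M[C]_3) => skewent B e1 e2).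
  have hv : skewent T e2 e0 = 0
    by abstract lin_eq hL 1%N (fun (t : C) (B : 'M[C]_3) => skewent B e2 e0).
  have hw : skewent T e0 e1 = 0
    by abstract lin_eq hL 2%N (fun (t : C) (B : 'M[C]_3) => skewent B e0 e1).
  have p00 : T e0 e0 = 0.
    by lin_comb ((syment T e0 e0) / 2 : C); rewrite ?(ha) ?(mulr0, mul0r, addr0, subr0,
        sub0r, oppr0).
  have p11 : T e1 e1 = 0.
    by lin_comb ((syment T e1 e1) / 2 : C); rewrite ?(hb) ?(mulr0, mul0r, addr0, subr0,
        sub0r, oppr0).
  have p22 : T e2 e2 = 0.
    by lin_comb ((syment T e2 e2) / 2 : C); rewrite ?(hc) ?(mulr0, mul0r, addr0, subr0,
        sub0r, oppr0).
  have p12 : T e1 e2 = 0.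
    by lin_comb (((syment T e1 e2) + (skewent T e1 e2)) / 2 : C); rewrite ?(hu, hx)
        ?(mulr0, mul0r, addr0, subr0, sub0r, oppr0).
  have p21 : T e2 e1 = 0.
    by lin_comb (((syment T e1 e2) - (skewent T e1 e2)) / 2 : C); rewrite ?(hu, hx)
        ?(mulr0, mul0r, addr0, subr0, sub0r, oppr0).
  have p20 : T e2 e0 = 0.
    by lin_comb (((syment T e0 e2) + (skewent T e2 e0)) / 2 : C); rewrite ?(hv, hy)
        ?(mulr0, mul0r, addr0, subr0, sub0r, oppr0).
  have p02 : T e0 e2 = 0.
    by lin_comb (((syment T e0 e2) - (skewent T e2 e0)) / 2 : C); rewrite ?(hv, hy)
        ?(mulr0, mul0r, addr0, subr0, sub0r, oppr0).
  have p01 : T e0 e1 = 0.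
    by lin_comb (((syment T e0 e1) + (skewent T e0 e1)) / 2 : C); rewrite ?(hw, hz)
        ?(mulr0, mul0r, addr0, subr0, sub0r, oppr0).
  have p10 : T e1 e0 = 0.
    by lin_comb (((syment T e0 e1) - (skewent T e0 e1)) / 2 : C); rewrite ?(hw, hz)
        ?(mulr0, mul0r, addr0, subr0, sub0r, oppr0).
  by apply: matrix3P; rewrite mxE.
- move=> -> hR hL pos.
  have p01 := pos (e0, e1) isT.
  have p02 := pos (e0, e2) isT.
  have p12 := pos (e1, e2) isT.
  have ha : syment T e0 e0 = 0
    by abstract lin_eq hR 0%N (fun (t : C) (B : 'M[C]_3) => syment B e0 e0).
  have hb : syment T e1 e1 = 0
    by abstract lin_eq hR 1%N (fun (t : C) (B : 'M[C]_3) => syment B e1 e1).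
  have hc : syment T e2 e2 = 0
    by abstract lin_eq hR 2%N (fun (t : C) (B : 'M[C]_3) => syment B e2 e2).
  have hx : syment T e1 e2 = 0
    by abstract lin_eq hR 3%N (fun (t : C) (B : 'M[C]_3) => syment B e1 e2).
  have hy : syment T e0 e2 = 0
    by abstract lin_eq hR 4%N (fun (t : C) (B : 'M[C]_3) => syment B e0 e2).
  have hz : syment T e0 e1 = 0
    by abstract lin_eq hR 5%N (fun (t : C) (B : 'M[C]_3) => syment B e0 e1).
  have p00 : T e0 e0 = 0.
    by lin_comb ((syment T e0 e0) / 2 : C); rewrite ?(ha) ?(mulr0, mul0r, addr0, subr0,
        sub0r, oppr0).
  have p11 : T e1 e1 = 0.
    by lin_comb ((syment T e1 e1) / 2 : C); rewrite ?(hb) ?(mulr0, mul0r, addr0, subr0,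
        sub0r, oppr0).
  have p22 : T e2 e2 = 0.
    by lin_comb ((syment T e2 e2) / 2 : C); rewrite ?(hc) ?(mulr0, mul0r, addr0, subr0,
        sub0r, oppr0).
  have p10 : T e1 e0 = 0.
    by lin_comb ((syment T e0 e1) - T e0 e1 : C); rewrite ?(hz, p01) ?(mulr0, mul0r,
        addr0, subr0, sub0r, oppr0).
  have p20 : T e2 e0 = 0.
    by lin_comb ((syment T e0 e2) - T e0 e2 : C); rewrite ?(hy, p02) ?(mulr0, mul0r,
        addr0, subr0, sub0r, oppr0).
  have p21 : T e2 e1 = 0.
    by lin_comb ((syment T e1 e2) - T e1 e2 : C); rewrite ?(hx, p12) ?(mulr0, mul0r,
        addr0, subr0, sub0r, oppr0).
  by apply: matrix3P; rewrite mxE.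
- move=> -> hR hL pos.
  have p00 := pos (e0, e0) isT.
  have p01 := pos (e0, e1) isT.
  have p02 := pos (e0, e2) isT.
  have hu : skewent T e1 e2 = 0
    by abstract lin_eq hL 0%N (fun (t : C) (B : 'M[C]_3) => skewent B e1 e2).
  have hv : skewent T e2 e0 = 0
    by abstract lin_eq hL 1%N (fun (t : C) (B : 'M[C]_3) => skewent B e2 e0).
  have hw : skewent T e0 e1 = 0
    by abstract lin_eq hL 2%N (fun (t : C) (B : 'M[C]_3) => skewent B e0 e1).
  have hc : 2 * syment T e2 e2 = 0
    by abstract lin_eq hR 1%N (fun (t : C) (B : 'M[C]_3) => 2 * syment B e2 e2 + t *
        (syment B e0 e0 * syment B e2 e2 - syment B e0 e2 * syment B e0 e2)).
  have hb : 2 * syment T e1 e1 = 0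
    by abstract lin_eq hR 2%N (fun (t : C) (B : 'M[C]_3) => 2 * syment B e1 e1 + t *
        (syment B e0 e0 * syment B e1 e1 - syment B e0 e1 * syment B e0 e1)).
  have hx : - (2 * syment T e1 e2) = 0
    by abstract lin_eq hR 3%N (fun (t : C) (B : 'M[C]_3) => - (2 * syment B e1 e2) + t *
        (syment B e0 e2 * syment B e0 e1 - syment B e0 e0 * syment B e1 e2)).
  have p11 : T e1 e1 = 0.
    by lin_comb ((2 * syment T e1 e1) / 4 : C); rewrite ?(hb) ?(mulr0, mul0r, addr0,
        subr0, sub0r, oppr0).
  have p22 : T e2 e2 = 0.
    by lin_comb ((2 * syment T e2 e2) / 4 : C); rewrite ?(hc) ?(mulr0, mul0r, addr0,
        subr0, sub0r, oppr0).
  have p12 : T e1 e2 = 0.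
    by lin_comb (- ((- (2 * syment T e1 e2)) / 4) + (skewent T e1 e2) / 2 : C); rewrite
        ?(hu, hx) ?(mulr0, mul0r, addr0, subr0, sub0r, oppr0).
  have p21 : T e2 e1 = 0.
    by lin_comb (- ((- (2 * syment T e1 e2)) / 4) - (skewent T e1 e2) / 2 : C); rewrite
        ?(hu, hx) ?(mulr0, mul0r, addr0, subr0, sub0r, oppr0).
  have p20 : T e2 e0 = 0.
    by lin_comb ((skewent T e2 e0) + T e0 e2 : C); rewrite ?(hv, p02) ?(mulr0, mul0r,
        addr0, subr0, sub0r, oppr0).
  have p10 : T e1 e0 = 0.
    by lin_comb (T e0 e1 - (skewent T e0 e1) : C); rewrite ?(hw, p01) ?(mulr0, mul0r,
        addr0, subr0, sub0r, oppr0).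
  by apply: matrix3P; rewrite mxE.
- move=> -> hR hL pos.
  have p11 := pos (e1, e1) isT.
  have p01 := pos (e0, e1) isT.
  have p10 := pos (e1, e0) isT.
  have p12 := pos (e1, e2) isT.
  have p21 := pos (e2, e1) isT.
  have hc : 2 * syment T e2 e2 = 0
    by abstract lin_eq hR 0%N (fun (t : C) (B : 'M[C]_3) => 2 * syment B e2 e2 + t *
        (syment B e1 e1 * syment B e2 e2 - syment B e1 e2 * syment B e1 e2)).
  have ha : 2 * syment T e0 e0 = 0
    by abstract lin_eq hR 2%N (fun (t : C) (B : 'M[C]_3) => 2 * syment B e0 e0 + t *
        (syment B e0 e0 * syment B e1 e1 - syment B e0 e1 * syment B e0 e1)).
  have hy : - (2 * syment T e0 e2) = 0
    by abstract lin_eq hR 4%N (fun (t : C) (B : 'M[C]_3) => - (2 * syment B e0 e2) + t *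
        (syment B e0 e1 * syment B e1 e2 - syment B e1 e1 * syment B e0 e2)).
  (* The second coordinate of the variation S' k + S k' of S k, at S = diag(0, 2, 0) and k = (0, 0,
     -2). *)
  have hv : 2 * skewent T e2 e0 - 2 * syment T e1 e2 = 0
    by abstract lin_eq hL 1%N (fun (t : C) (B : 'M[C]_3) => 2 * skewent B e2 e0 - 2 *
        syment B e1 e2 + t * (syment B e0 e1 * skewent B e1 e2 + syment B e1 e1 * skewent
        B e2 e0 + syment B e1 e2 * skewent B e0 e1)).
  have p00 : T e0 e0 = 0.
    by lin_comb ((2 * syment T e0 e0) / 4 : C); rewrite ?(ha) ?(mulr0, mul0r, addr0,
        subr0, sub0r, oppr0).
  have p22 : T e2 e2 = 0.
    by lin_comb ((2 * syment T e2 e2) / 4 : C); rewrite ?(hc) ?(mulr0, mul0r, addr0,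
        subr0, sub0r, oppr0).
  have p20 : T e2 e0 = 0.
    by lin_comb (- ((- (2 * syment T e0 e2)) / 4) + (2 * skewent T e2 e0 - 2 * syment T
        e1 e2) / 4 + (T e1 e2 + T e2 e1) / 2 : C); rewrite ?(hv, hy, p12, p21) ?(mulr0,
        mul0r, addr0, subr0, sub0r, oppr0).
  have p02 : T e0 e2 = 0.
    by lin_comb (- ((- (2 * syment T e0 e2)) / 4) - (2 * skewent T e2 e0 - 2 * syment T
        e1 e2) / 4 - (T e1 e2 + T e2 e1) / 2 : C); rewrite ?(hv, hy, p12, p21) ?(mulr0,
        mul0r, addr0, subr0, sub0r, oppr0).
  by apply: matrix3P; rewrite mxE.
- move=> -> hR hL pos.
  have p00 := pos (e0, e0) isT.
  have p11 := pos (e1, e1) isT.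
  have p01 := pos (e0, e1) isT.
  have p02 := pos (e0, e2) isT.
  have p12 := pos (e1, e2) isT.
  have hu : skewent T e1 e2 = 0
    by abstract lin_eq hL 0%N (fun (t : C) (B : 'M[C]_3) => skewent B e1 e2).
  have hv : skewent T e2 e0 = 0
    by abstract lin_eq hL 1%N (fun (t : C) (B : 'M[C]_3) => skewent B e2 e0).
  have hw : skewent T e0 e1 = 0
    by abstract lin_eq hL 2%N (fun (t : C) (B : 'M[C]_3) => skewent B e0 e1).
  have hd : 4 * syment T e2 e2 = 0
    by abstract lin_eq hR 0%N (fun (t : C) (B : 'M[C]_3) => (2 + t * syment B e0 e0) *
        ((2 + t * syment B e1 e1) * syment B e2 e2 - t * (syment B e1 e2 * syment B e1
        e2)) - t * t * (syment B e0 e1 * (syment B e0 e1 * syment B e2 e2 - syment B e1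
        e2 * syment B e0 e2)) + syment B e0 e2 * (t * t * (syment B e0 e1 * syment B e1
        e2) - t * ((2 + t * syment B e1 e1) * syment B e0 e2))).
  have p22 : T e2 e2 = 0.
    by lin_comb ((4 * syment T e2 e2) / 8 : C); rewrite ?(hd) ?(mulr0, mul0r, addr0,
        subr0, sub0r, oppr0).
  have p21 : T e2 e1 = 0.
    by lin_comb (T e1 e2 - (skewent T e1 e2) : C); rewrite ?(hu, p12) ?(mulr0, mul0r,
        addr0, subr0, sub0r, oppr0).
  have p20 : T e2 e0 = 0.
    by lin_comb ((skewent T e2 e0) + T e0 e2 : C); rewrite ?(hv, p02) ?(mulr0, mul0r,
        addr0, subr0, sub0r, oppr0).
  have p10 : T e1 e0 = 0.
    by lin_comb (T e0 e1 - (skewent T e0 e1) : C); rewrite ?(hw, p01) ?(mulr0, mul0r,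
        addr0, subr0, sub0r, oppr0).
  by apply: matrix3P; rewrite mxE.
- move=> -> hR hL pos.
  have p22 := pos (e2, e2) isT.
  have p12 := pos (e1, e2) isT.
  have p21 := pos (e2, e1) isT.
  have p02 := pos (e0, e2) isT.
  have p20 := pos (e2, e0) isT.
  have p01 := pos (e0, e1) isT.
  have hb : 2 * syment T e1 e1 = 0
    by abstract lin_eq hR 0%N (fun (t : C) (B : 'M[C]_3) => 2 * syment B e1 e1 + t *
        (syment B e1 e1 * syment B e2 e2 - syment B e1 e2 * syment B e1 e2)).
  have ha : 2 * syment T e0 e0 = 0
    by abstract lin_eq hR 1%N (fun (t : C) (B : 'M[C]_3) => 2 * syment B e0 e0 + t *
        (syment B e0 e0 * syment B e2 e2 - syment B e0 e2 * syment B e0 e2)).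
  have hz : - (2 * syment T e0 e1) = 0
    by abstract lin_eq hR 5%N (fun (t : C) (B : 'M[C]_3) => - (2 * syment B e0 e1) + t *
        (syment B e1 e2 * syment B e0 e2 - syment B e2 e2 * syment B e0 e1)).
  have p00 : T e0 e0 = 0.
    by lin_comb ((2 * syment T e0 e0) / 4 : C); rewrite ?(ha) ?(mulr0, mul0r, addr0,
        subr0, sub0r, oppr0).
  have p11 : T e1 e1 = 0.
    by lin_comb ((2 * syment T e1 e1) / 4 : C); rewrite ?(hb) ?(mulr0, mul0r, addr0,
        subr0, sub0r, oppr0).
  have p10 : T e1 e0 = 0.
    by lin_comb (- ((- (2 * syment T e0 e1)) / 2) - T e0 e1 : C); rewrite ?(hz, p01)
        ?(mulr0, mul0r, addr0, subr0, sub0r, oppr0).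
  by apply: matrix3P; rewrite mxE.
- move=> -> hR hL pos.
  have p00 := pos (e0, e0) isT.
  have p01 := pos (e0, e1) isT.
  have p02 := pos (e0, e2) isT.
  have p11 := pos (e1, e1) isT.
  have p12 := pos (e1, e2) isT.
  have p22 := pos (e2, e2) isT.
  have hu : skewent T e1 e2 = 0
    by abstract lin_eq hL 0%N (fun (t : C) (B : 'M[C]_3) => skewent B e1 e2).
  have hv : skewent T e2 e0 = 0
    by abstract lin_eq hL 1%N (fun (t : C) (B : 'M[C]_3) => skewent B e2 e0).
  have hw : skewent T e0 e1 = 0
    by abstract lin_eq hL 2%N (fun (t : C) (B : 'M[C]_3) => skewent B e0 e1).
  have p21 : T e2 e1 = 0.
    by lin_comb (T e1 e2 - (skewent T e1 e2) : C); rewrite ?(hu, p12) ?(mulr0, mul0r,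
        addr0, subr0, sub0r, oppr0).
  have p20 : T e2 e0 = 0.
    by lin_comb ((skewent T e2 e0) + T e0 e2 : C); rewrite ?(hv, p02) ?(mulr0, mul0r,
        addr0, subr0, sub0r, oppr0).
  have p10 : T e1 e0 = 0.
    by lin_comb (T e0 e1 - (skewent T e0 e1) : C); rewrite ?(hw, p01) ?(mulr0, mul0r,
        addr0, subr0, sub0r, oppr0).
  by apply: matrix3P; rewrite mxE.
- move=> -> hR hL pos.
  have p22 := pos (e2, e2) isT.
  have p11 := pos (e1, e1) isT.
  have p12 := pos (e1, e2) isT.
  have p21 := pos (e2, e1) isT.
  have p01 := pos (e0, e1) isT.
  have p10 := pos (e1, e0) isT.
  have p02 := pos (e0, e2) isT.
  (* At the canonical matrix the kernel of S is spanned by (1, 0, -1), and the adjugate of S is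
     minus the square of this vector; this gives the variation of det S. In [hq], k = (1, 0, 1)
     enters the variation k^T S' k + 2 k^T S k'. *)
  have hd : - syment T e0 e0 - syment T e2 e2 + 2 * syment T e0 e2 = 0
    by abstract lin_eq hR 0%N (fun (t : C) (B : 'M[C]_3) => syment B e0 e0 * (t * t *
        (syment B e1 e1 * syment B e2 e2) - (1 + t * syment B e1 e2) * (1 + t * syment B
        e1 e2)) - (1 + t * syment B e0 e1) * ((1 + t * syment B e0 e1) * syment B e2 e2 -
        (1 + t * syment B e1 e2) * syment B e0 e2) + syment B e0 e2 * ((1 + t * syment B
        e0 e1) * (1 + t * syment B e1 e2) - t * t * (syment B e1 e1 * syment B e0 e2))).
  have hq : syment T e0 e0 + syment T e2 e2 + 2 * syment T e0 e2 + 4 * skewent T e2 e0 = 0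
    by abstract lin_eq hL 0%N (fun (t : C) (B : 'M[C]_3) => (syment B e0 e0 * (1 + t *
        skewent B e1 e2) + (1 + t * syment B e0 e1) * skewent B e2 e0 + syment B e0 e2 *
        (1 + t * skewent B e0 e1)) * (1 + t * skewent B e1 e2) + ((1 + t * syment B e0
        e1) * (1 + t * skewent B e1 e2) + t * t * (syment B e1 e1 * skewent B e2 e0) + (1
        + t * syment B e1 e2) * (1 + t * skewent B e0 e1)) * skewent B e2 e0 + (syment B
        e0 e2 * (1 + t * skewent B e1 e2) + (1 + t * syment B e1 e2) * skewent B e2 e0 +
        syment B e2 e2 * (1 + t * skewent B e0 e1)) * (1 + t * skewent B e0 e1)).
  have p20 : T e2 e0 = 0.
    (* In the sum of the two equations the diagonal entries cancel and only [8 * T e2 e0] is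
       left. *)
    by lin_comb (((- syment T e0 e0 - syment T e2 e2 + 2 * syment T e0 e2) + (syment T e0
        e0 + syment T e2 e2 + 2 * syment T e0 e2 + 4 * skewent T e2 e0)) / 8 : C);
        rewrite ?(hd, hq) ?(mulr0, mul0r, addr0, subr0, sub0r, oppr0).
  have p00 : T e0 e0 = 0.
    by lin_comb (- ((- syment T e0 e0 - syment T e2 e2 + 2 * syment T e0 e2) / 2) - T e2
        e2 + T e2 e0 + T e0 e2 : C); rewrite ?(hd, p02, p20, p22) ?(mulr0, mul0r, addr0,
        subr0, sub0r, oppr0).
  by apply: matrix3P; rewrite mxE.
- move=> -> hR hL pos.
  have p01 := pos (e0, e1) isT.
  have p02 := pos (e0, e2) isT.
  have p10 := pos (e1, e0) isT.
  have p11 := pos (e1, e1) isT.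
  have p12 := pos (e1, e2) isT.
  have p20 := pos (e2, e0) isT.
  have p21 := pos (e2, e1) isT.
  have p22 := pos (e2, e2) isT.
  have hd : 4 * syment T e0 e0 = 0
    by abstract lin_eq hR 0%N (fun (t : C) (B : 'M[C]_3) => syment B e0 e0 * ((2 + t *
        syment B e1 e1) * (2 + t * syment B e2 e2) - t * t * (syment B e1 e2 * syment B
        e1 e2)) - t * (syment B e0 e1 * (syment B e0 e1 * (2 + t * syment B e2 e2) - t *
        (syment B e1 e2 * syment B e0 e2))) + t * (syment B e0 e2 * (t * (syment B e0 e1
        * syment B e1 e2) - (2 + t * syment B e1 e1) * syment B e0 e2))).
  have p00 : T e0 e0 = 0.
    by lin_comb ((4 * syment T e0 e0) / 8 : C); rewrite ?(hd) ?(mulr0, mul0r, addr0,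
        subr0, sub0r, oppr0).
  by apply: matrix3P; rewrite mxE.
- move=> -> hR hL pos.
  have p01 := pos (e0, e1) isT.
  have p02 := pos (e0, e2) isT.
  have p10 := pos (e1, e0) isT.
  have p11 := pos (e1, e1) isT.
  have p12 := pos (e1, e2) isT.
  have p20 := pos (e2, e0) isT.
  have p21 := pos (e2, e1) isT.
  have p22 := pos (e2, e2) isT.
  (* The variation k^T S' k + 2 k^T S k' at k = (-2, 0, 0), where the first row of S is (0, 0,
     2). *)
  have hq : 4 * syment T e0 e0 - 8 * skewent T e0 e1 = 0
    by abstract lin_eq hL 0%N (fun (t : C) (B : 'M[C]_3) => (syment B e0 e0 * (t *
        skewent B e1 e2 - 2) + t * (syment B e0 e1 * skewent B e2 e0) + (2 + t * syment B
        e0 e2) * skewent B e0 e1) * (t * skewent B e1 e2 - 2) + t * (syment B e0 e1 * (t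
        * skewent B e1 e2 - 2) + (t * syment B e1 e1 - 2) * skewent B e2 e0 + t * (syment
        B e1 e2 * skewent B e0 e1)) * skewent B e2 e0 + ((2 + t * syment B e0 e2) * (t *
        skewent B e1 e2 - 2) + t * t * (syment B e1 e2 * skewent B e2 e0) + t * t *
        (syment B e2 e2 * skewent B e0 e1)) * skewent B e0 e1).
  have p00 : T e0 e0 = 0.
    by lin_comb ((4 * syment T e0 e0 - 8 * skewent T e0 e1) / 8 + T e0 e1 - T e1 e0 : C);
        rewrite ?(hq, p01, p10) ?(mulr0, mul0r, addr0, subr0, sub0r, oppr0).
  by apply: matrix3P; rewrite mxE.
- move=> [l [l1 lm1 ->]] hR hL pos; have l1' : 1 - l != 0 by rewrite subr_eq0 eq_sym.
  have p00 := pos (e0, e0) isT.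
  have p11 := pos (e1, e1) isT.
  have p01 := pos (e0, e1) isT.
  have p10 := pos (e1, e0) isT.
  have p02 := pos (e0, e2) isT.
  have p21 := pos (e2, e1) isT.
  (* The three equations are the variation of S k = 0 at k = (0, 0, 1 - l); as k <> 0, this
     condition already forces det S = 0. *)
  have ho : (1 + l) * skewent T e2 e0 + (1 - l) * syment T e0 e2 = 0
    by abstract lin_eq hL 0%N (fun (t : C) (B : 'M[C]_3) => (1 + l) * skewent B e2 e0 +
        (1 - l) * syment B e0 e2 + t * (syment B e0 e0 * skewent B e1 e2 + syment B e0 e1
        * skewent B e2 e0 + syment B e0 e2 * skewent B e0 e1)).
  have hi : (1 + l) * skewent T e1 e2 + (1 - l) * syment T e1 e2 = 0
    by abstract lin_eq hL 1%N (fun (t : C) (B : 'M[C]_3) => (1 + l) * skewent B e1 e2 +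
        (1 - l) * syment B e1 e2 + t * (syment B e0 e1 * skewent B e1 e2 + syment B e1 e1
        * skewent B e2 e0 + syment B e1 e2 * skewent B e0 e1)).
  have hc : (1 - l) * syment T e2 e2 = 0
    by abstract lin_eq hL 2%N (fun (t : C) (B : 'M[C]_3) => (1 - l) * syment B e2 e2 + t
        * (syment B e0 e2 * skewent B e1 e2 + syment B e1 e2 * skewent B e2 e0 + syment B
        e2 e2 * skewent B e0 e1)).
  have p20 : T e2 e0 = 0.
    by lin_comb (((1 + l) * skewent T e2 e0 + (1 - l) * syment T e0 e2) / 2 + l * T e0 e2
        : C); rewrite ?(ho, p02) ?(mulr0, mul0r, addr0, subr0, sub0r, oppr0).
  have p12 : T e1 e2 = 0.
    by lin_comb (((1 + l) * skewent T e1 e2 + (1 - l) * syment T e1 e2) / 2 + l * T e2 e1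
        : C); rewrite ?(hi, p21) ?(mulr0, mul0r, addr0, subr0, sub0r, oppr0).
  have p22 : T e2 e2 = 0.
    by lin_comb (((1 - l) * syment T e2 e2) / (2 * (1 - l)) : C); rewrite ?(hc) ?(mulr0,
        mul0r, addr0, subr0, sub0r, oppr0).
  by apply: matrix3P; rewrite mxE.
- move=> _ hR hL pos.
  have p00 := pos (e0, e0) isT.
  have p01 := pos (e0, e1) isT.
  have p02 := pos (e0, e2) isT.
  have p10 := pos (e1, e0) isT.
  have p11 := pos (e1, e1) isT.
  have p12 := pos (e1, e2) isT.
  have p20 := pos (e2, e0) isT.
  have p21 := pos (e2, e1) isT.
  have p22 := pos (e2, e2) isT.
  by apply: matrix3P; rewrite mxE.
Qed.

(** * Charts of the bundles *)

Definition rv (K : nmodType) d (u : 'rV[K]_d) (k : nat) : K :=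
  if insub k is Some i then u 0 i else 0.

Lemma rvE (K : nmodType) d (u : 'rV[K]_d) (i : 'I_d) : rv u i = u 0 i.
Proof. by rewrite /rv valK. Qed.

Lemma rv_row (K : nmodType) d (s : seq K) k : (k < d)%N -> rv (\row_(i < d) s`_i) k =
    s`_k.
Proof. by move=> kd; rewrite /rv insubT mxE. Qed.

Lemma differentiable_rv (K : numFieldType) d k (u : 'rV[K]_d) :
  differentiable (fun x : 'rV[K]_d => rv x k) u.
Proof.
rewrite /rv; case: insub => [i|]; last exact: differentiable_cst.
exact: differentiable_coord.
Qed.

Lemma differentiable_M2 (K : numFieldType) (V : normedModType K) (a b c d : V -> K) u :
  differentiable a u -> differentiable b u -> differentiable c u -> differentiable d u ->
  differentiable (fun x => M2 (a x) (b x) (c x) (d x)) u.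
Proof.
move=> da db dc dd; apply: differentiable_mx; apply: ord2P; apply: ord2P;
  by under eq_fun do rewrite mxE /=.
Qed.

Lemma differentiable_M3 (K : numFieldType) (V : normedModType K)
    (a b c d e f g h i : V -> K) u :
  [/\ differentiable a u, differentiable b u & differentiable c u] ->
  [/\ differentiable d u, differentiable e u & differentiable f u] ->
  [/\ differentiable g u, differentiable h u & differentiable i u] ->
  differentiable (fun x => M3 (a x) (b x) (c x) (d x) (e x) (f x) (g x) (h x) (i x)) u.
Proof.
move=> [? ? ?] [? ? ?] [? ? ?]; apply: differentiable_mx; apply: ord3P; apply: ord3P;
  by under eq_fun do rewrite mxE /=.
Qed.

(** The coordinates are those of S / 2 and k / 2, whence the powers of 2 in the values of the
    invariants below. *)
Notation symskew2 a z c w := (M2 a (z + w) (z - w) c).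
Notation symskew3 a b c x y z u v w :=
  (M3 a (z + w) (y - v) (z - w) b (x + u) (y + v) (x - u) c).

(* [psi] lists the coordinates of a left inverse of the chart [phi]. *)
Definition local_chart (K : numFieldType) n d (X : set 'M[K]_n) : Prop :=
  exists g : 'rV[K]_d -> K, exists phi : 'rV[K]_d -> 'M[K]_n, exists psi : 'M[K]_n -> seq
      K,
  [/\ forall u, differentiable g u, exists u, g u != 0 &
    forall u, g u != 0 -> [/\ differentiable phi u,
      forall k, differentiable (fun A => (psi A)`_k) (phi u),
      forall k, (k < d)%N -> (psi (phi u))`_k = rv u k & X (phi u)]].

Lemma submanifold_of_chart (R : realType) n d (X : set 'M[Cplx R]_n) :
  local_chart d X -> contains_submanifold X d.
Proof.
move=> [g [phi [psi [dg [u gu] chart]]]].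
apply: (@submanifold_of_left_inverse _ _ _ _ [set u | g u != 0] phi
  (fun A => \row_(k < d) (psi A)`_k)).
- exact: open_neq0.
- by exists u.
- by move=> v /chart[].
- move=> v /chart[_ dpsi _ _]; apply: differentiable_mx => i j.
  by under eq_fun do rewrite mxE.
- by move=> v /chart[_ _ psiK _]; apply/rowP => k; rewrite mxE psiK // rvE.
- by move=> v /chart[].
Qed.

Lemma neq0_eq (K : nmodType) (x y : K) : y != 0 -> x = y -> x != 0.
Proof. by move=> y0 ->. Qed.

Lemma half_sub (K : numFieldType) (x u : K) : (x + u - (x - u)) / 2 = u.
Proof. by field. Qed.

Lemma half_add (K : numFieldType) (x u : K) : (x + u + (x - u)) / 2 = x.
Proof. by field. Qed.

Ltac diff_frac := repeat first
  [ exact: differentiable_cst | exact: differentiable_rv | exact: differentiable_coord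
  | apply: differentiable_add | apply: differentiable_opp | apply: differentiable_mul
  | apply: differentiable_inv ].

Ltac split_factors := repeat match goal with
  H : is_true (_ * _ != 0) |- _ => move: H; rewrite mulf_eq0 negb_or => /andP[? ?] end.

Lemma chart2_H (C : numClosedFieldType) :
  local_chart 1 (congruent_to (canon2 C v_H)).
Proof.
exists (fun r => let w := rv r 0 in w),
  (fun r => let w := rv r 0 in symskew2 0 0 0 w),
  (fun A => [:: skewent A f0 f1 / 2]); split.
- by move=> r; cbv zeta; diff_frac.
- exists (\row_(i < 1) [:: 1]`_i); rewrite !rv_row // /=.
  by apply: (@neq0_eq _ _ (1)); [rewrite ?oppr_eq0 oner_neq0|ring].
- move=> r; cbv beta zeta => gp; split.
  + split_factors; apply: differentiable_M2; by diff_frac; rewrite ?mulf_neq0.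
  + split_factors.
    by move=> [|k] /=; rewrite ?nth_nil; diff_frac.
  + split_factors; move=> [|k] // _; rewrite /= !mxE /= ?half_sub ?half_add;
    by rewrite ?[_ - _ + (_ + _)]addrC ?half_add; fieldx.
  + rewrite congruent_to_canon2; move: (rv r 0) gp => w gp.
    split_factors; split.
    * by rank0.
    * by invS skew_level2P 0%N (2 * w).
Qed.

Lemma chart2_D (C : numClosedFieldType) :
  local_chart 2 (congruent_to (canon2 C v_D)).
Proof.
exists (fun r => let a := rv r 0 in let z := rv r 1 in a),
  (fun r => let a := rv r 0 in let z := rv r 1 in symskew2 a z ((z * z / a)) 0),
  (fun A => [:: A f0 f0; syment A f0 f1 / 2]); split.
- by move=> r; cbv zeta; diff_frac.
- exists (\row_(i < 2) [:: 1; 0]`_i); rewrite !rv_row // /=.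
  by apply: (@neq0_eq _ _ (1)); [rewrite ?oppr_eq0 oner_neq0|ring].
- move=> r; cbv beta zeta => gp; split.
  + split_factors; apply: differentiable_M2; by diff_frac; rewrite ?mulf_neq0.
  + split_factors.
    by move=> [|[|k]] /=; rewrite ?nth_nil; diff_frac.
  + split_factors; move=> [|[|k]] // _; rewrite /= !mxE /= ?half_sub ?half_add;
    by rewrite ?[_ - _ + (_ + _)]addrC ?half_add; fieldx.
  + rewrite congruent_to_canon2; move: (rv r 0) (rv r 1) gp => a z gp.
    split_factors; split.
    * by invS symrank2P 0%N (2 * a).
    * by level0.
Qed.

Lemma chart2_Gamma (C : numClosedFieldType) :
  local_chart 3 (congruent_to (canon2 C v_Gamma)).
Proof.
exists (fun r => let a := rv r 0 in let z := rv r 1 in let w := rv r 2 in a * w),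
  (fun r => let a := rv r 0 in let z := rv r 1 in let w := rv r 2 in symskew2 a z ((z * z
      / a)) w),
  (fun A => [:: A f0 f0; syment A f0 f1 / 2; skewent A f0 f1 / 2]); split.
- by move=> r; cbv zeta; diff_frac.
- exists (\row_(i < 3) [:: 1; 0; 1]`_i); rewrite !rv_row // /=.
  by apply: (@neq0_eq _ _ (1)); [rewrite ?oppr_eq0 oner_neq0|ring].
- move=> r; cbv beta zeta => gp; split.
  + split_factors; apply: differentiable_M2; by diff_frac; rewrite ?mulf_neq0.
  + split_factors.
    by move=> [|[|[|k]]] /=; rewrite ?nth_nil; diff_frac.
  + split_factors; move=> [|[|[|k]]] // _; rewrite /= !mxE /= ?half_sub ?half_add;
    by rewrite ?[_ - _ + (_ + _)]addrC ?half_add; fieldx.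
  + rewrite congruent_to_canon2; move: (rv r 0) (rv r 1) (rv r 2) gp => a z w gp.
    split_factors; split.
    * by invS symrank2P 0%N (2 * a).
    * by invS skew_level2P 0%N (2 * w).
Qed.

Lemma chart2_I (C : numClosedFieldType) :
  local_chart 3 (congruent_to (canon2 C v_I)).
Proof.
exists (fun r => let a := rv r 0 in let c := rv r 1 in let z := rv r 2 in (a * c - z *
    z)),
  (fun r => let a := rv r 0 in let c := rv r 1 in let z := rv r 2 in symskew2 a z c 0),
  (fun A => [:: A f0 f0; A f1 f1; syment A f0 f1 / 2]); split.
- by move=> r; cbv zeta; diff_frac.
- exists (\row_(i < 3) [:: 1; 1; 0]`_i); rewrite !rv_row // /=.
  by apply: (@neq0_eq _ _ (1)); [rewrite ?oppr_eq0 oner_neq0|ring].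
- move=> r; cbv beta zeta => gp; split.
  + split_factors; apply: differentiable_M2; by diff_frac; rewrite ?mulf_neq0.
  + split_factors.
    by move=> [|[|[|k]]] /=; rewrite ?nth_nil; diff_frac.
  + split_factors; move=> [|[|[|k]]] // _; rewrite /= !mxE /= ?half_sub ?half_add;
    by rewrite ?[_ - _ + (_ + _)]addrC ?half_add; fieldx.
  + rewrite congruent_to_canon2; move: (rv r 0) (rv r 1) (rv r 2) gp => a c z gp.
    split_factors; split.
    * by invS symrank2P 0%N (4 * (a * c - z * z)).
    * by level0.
Qed.

Lemma chart2_B (C : numClosedFieldType) :
  local_chart 4 (congruent_to (canon2 C v_B)).
Proof.
exists (fun r => let a := rv r 0 in let c := rv r 1 in let z := rv r 2 in let w := rv r 3
    in (a * c - z * z) * w),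
  (fun r => let a := rv r 0 in let c := rv r 1 in let z := rv r 2 in let w := rv r 3 in
      symskew2 a z c w),
  (fun A => [:: A f0 f0; A f1 f1; syment A f0 f1 / 2; skewent A f0 f1 / 2]); split.
- by move=> r; cbv zeta; diff_frac.
- exists (\row_(i < 4) [:: 1; 1; 0; 1]`_i); rewrite !rv_row // /=.
  by apply: (@neq0_eq _ _ (1)); [rewrite ?oppr_eq0 oner_neq0|ring].
- move=> r; cbv beta zeta => gp; split.
  + split_factors; apply: differentiable_M2; by diff_frac; rewrite ?mulf_neq0.
  + split_factors.
    by move=> [|[|[|[|k]]]] /=; rewrite ?nth_nil; diff_frac.
  + split_factors; move=> [|[|[|[|k]]]] // _; rewrite /= !mxE /= ?half_sub ?half_add;
    by rewrite ?[_ - _ + (_ + _)]addrC ?half_add; fieldx.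
  + rewrite congruent_to_canon2; move: (rv r 0) (rv r 1) (rv r 2) (rv r 3) gp => a c z w
      gp.
    split_factors; split.
    * by invS symrank2P 0%N (4 * (a * c - z * z)).
    * by invS skew_level2P 0%N (2 * w).
Qed.

Lemma chart3_m1sq_0 (C : numClosedFieldType) :
  local_chart 3 (congruent_to (canon3 C v_m1sq_0)).
Proof.
exists (fun r => let u := rv r 0 in let v := rv r 1 in let w := rv r 2 in w),
  (fun r => let u := rv r 0 in let v := rv r 1 in let w := rv r 2 in symskew3 0 0 0 0 0 0
      u v w),
  (fun A => [:: skewent A e1 e2 / 2; skewent A e2 e0 / 2; skewent A e0 e1 / 2]); split.
- by move=> r; cbv zeta; diff_frac.
- exists (\row_(i < 3) [:: 0; 0; 1]`_i); rewrite !rv_row // /=.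
  by apply: (@neq0_eq _ _ (1)); [rewrite ?oppr_eq0 oner_neq0|ring].
- move=> r; cbv beta zeta => gp; split.
  + split_factors; apply: differentiable_M3; split; by diff_frac; rewrite ?mulf_neq0.
  + split_factors.
    by move=> [|[|[|k]]] /=; rewrite ?nth_nil; diff_frac.
  + split_factors; move=> [|[|[|k]]] // _; rewrite /= !mxE /= ?half_sub ?half_add;
    by rewrite ?[_ - _ + (_ + _)]addrC ?half_add; fieldx.
  + rewrite congruent_to_canon3; move: (rv r 0) (rv r 1) (rv r 2) gp => u v w gp.
    split_factors; split.
    * by rank0.
    * by invS axial_level3P 2%N (2 * w).
Qed.

(** A symmetric matrix of rank 1 with [a != 0] is determined by its first row. *)
Lemma chart3_100 (C : numClosedFieldType) :
  local_chart 3 (congruent_to (canon3 C v_100)).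
Proof.
exists (fun r => let a := rv r 0 in let y := rv r 1 in let z := rv r 2 in a),
  (fun r => let a := rv r 0 in let y := rv r 1 in let z := rv r 2 in symskew3 a (z * z /
      a) (y * y / a) (y * z / a) y z 0 0 0),
  (fun A => [:: A e0 e0; syment A e0 e2 / 2; syment A e0 e1 / 2]); split.
- by move=> r; cbv zeta; diff_frac.
- exists (\row_(i < 3) [:: 1; 0; 0]`_i); rewrite !rv_row // /=.
  by apply: (@neq0_eq _ _ (1)); [rewrite ?oppr_eq0 oner_neq0|ring].
- move=> r; cbv beta zeta => gp; split.
  + split_factors; apply: differentiable_M3; split; by diff_frac; rewrite ?mulf_neq0.
  + split_factors.
    by move=> [|[|[|k]]] /=; rewrite ?nth_nil; diff_frac.
  + split_factors; move=> [|[|[|k]]] // _; rewrite /= !mxE /= ?half_sub ?half_add;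
    by rewrite ?[_ - _ + (_ + _)]addrC ?half_add; fieldx.
  + rewrite congruent_to_canon3; move: (rv r 0) (rv r 1) (rv r 2) gp => a y z gp.
    split_factors; split.
    * by invS symrank3P 0%N (2 * a).
    * by level0.
Qed.

(** To the rank 1 parametrization by the first row, S k = 0 adds one condition,
    [a u + z v + y w = 0], solved for [u]. *)
Lemma chart3_1sq_0 (C : numClosedFieldType) :
  local_chart 5 (congruent_to (canon3 C v_1sq_0)).
Proof.
exists (fun r => let a := rv r 0 in let y := rv r 1 in let z := rv r 2 in let v := rv r 3
    in let w := rv r 4 in a * w),
  (fun r => let a := rv r 0 in let y := rv r 1 in let z := rv r 2 in let v := rv r 3 in
      let w := rv r 4 in symskew3 a (z * z / a) (y * y / a) (y * z / a) y z ((- (z * v +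
      y * w) / a)) v w),
  (fun A => [:: A e0 e0; syment A e0 e2 / 2; syment A e0 e1 / 2; skewent A e2 e0 / 2;
      skewent A e0 e1 / 2]); split.
- by move=> r; cbv zeta; diff_frac.
- exists (\row_(i < 5) [:: 1; 0; 0; 0; 1]`_i); rewrite !rv_row // /=.
  by apply: (@neq0_eq _ _ (1)); [rewrite ?oppr_eq0 oner_neq0|ring].
- move=> r; cbv beta zeta => gp; split.
  + split_factors; apply: differentiable_M3; split; by diff_frac; rewrite ?mulf_neq0.
  + split_factors.
    by move=> [|[|[|[|[|k]]]]] /=; rewrite ?nth_nil; diff_frac.
  + split_factors; move=> [|[|[|[|[|k]]]]] // _; rewrite /= !mxE /= ?half_sub ?half_add;
    by rewrite ?[_ - _ + (_ + _)]addrC ?half_add; fieldx.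
  + rewrite congruent_to_canon3; move: (rv r 0) (rv r 1) (rv r 2) (rv r 3) (rv r 4) gp =>
      a y z v w gp.
    split_factors; split.
    * by invS symrank3P 0%N (2 * a).
    * by invS axial_level3P 2%N (2 * w).
Qed.

(** The determinant of S is linear in [c] with leading coefficient proportional to [a b - z^2], and
    det S = 0 is solved for [c]. *)
Lemma chart3_110 (C : numClosedFieldType) :
  local_chart 5 (congruent_to (canon3 C v_110)).
Proof.
exists (fun r => let a := rv r 0 in let b := rv r 1 in let x := rv r 2 in let y := rv r 3
    in let z := rv r 4 in (a * b - z * z)),
  (fun r => let a := rv r 0 in let b := rv r 1 in let x := rv r 2 in let y := rv r 3 in
      let z := rv r 4 in symskew3 a b (((b * y * y + a * x * x - 2 * (x * y * z)) / (a *
      b - z * z))) x y z 0 0 0),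
  (fun A => [:: A e0 e0; A e1 e1; syment A e1 e2 / 2; syment A e0 e2 / 2; syment A e0 e1
      / 2]); split.
- by move=> r; cbv zeta; diff_frac.
- exists (\row_(i < 5) [:: 1; 1; 0; 0; 0]`_i); rewrite !rv_row // /=.
  by apply: (@neq0_eq _ _ (1)); [rewrite ?oppr_eq0 oner_neq0|ring].
- move=> r; cbv beta zeta => gp; split.
  + split_factors; apply: differentiable_M3; split; by diff_frac; rewrite ?mulf_neq0.
  + split_factors.
    by move=> [|[|[|[|[|k]]]]] /=; rewrite ?nth_nil; diff_frac.
  + split_factors; move=> [|[|[|[|[|k]]]]] // _; rewrite /= !mxE /= ?half_sub ?half_add;
    by rewrite ?[_ - _ + (_ + _)]addrC ?half_add; fieldx.
  + rewrite congruent_to_canon3; move: (rv r 0) (rv r 1) (rv r 2) (rv r 3) (rv r 4) gp =>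
      a b x y z gp.
    split_factors; split.
    * by invS symrank3P 2%N (4 * (a * b - z * z)).
    * by level0.
Qed.

(** For S of rank 1, k^T S k is, up to a constant, the square of [a u + z v + y w] divided by [a];
    this linear form must not vanish. *)
Lemma chart3_m1sq_1 (C : numClosedFieldType) :
  local_chart 6 (congruent_to (canon3 C v_m1sq_1)).
Proof.
exists (fun r => let a := rv r 0 in let y := rv r 1 in let z := rv r 2 in let u := rv r 3
    in let v := rv r 4 in let w := rv r 5 in a * (a * u + z * v + y * w)),
  (fun r => let a := rv r 0 in let y := rv r 1 in let z := rv r 2 in let u := rv r 3 in
      let v := rv r 4 in let w := rv r 5 in symskew3 a (z * z / a) (y * y / a) (y * z /
      a) y z u v w),
  (fun A => [:: A e0 e0; syment A e0 e2 / 2; syment A e0 e1 / 2; skewent A e1 e2 / 2;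
      skewent A e2 e0 / 2; skewent A e0 e1 / 2]); split.
- by move=> r; cbv zeta; diff_frac.
- exists (\row_(i < 6) [:: 1; 0; 0; 1; 0; 0]`_i); rewrite !rv_row // /=.
  by apply: (@neq0_eq _ _ (1)); [rewrite ?oppr_eq0 oner_neq0|ring].
- move=> r; cbv beta zeta => gp; split.
  + split_factors; apply: differentiable_M3; split; by diff_frac; rewrite ?mulf_neq0.
  + split_factors.
    by move=> [|[|[|[|[|[|k]]]]]] /=; rewrite ?nth_nil; diff_frac.
  + split_factors; move=> [|[|[|[|[|[|k]]]]]] // _; rewrite /= !mxE /= ?half_sub
      ?half_add;
    by rewrite ?[_ - _ + (_ + _)]addrC ?half_add; fieldx.
  + rewrite congruent_to_canon3; move: (rv r 0) (rv r 1) (rv r 2) (rv r 3) (rv r 4) (rv r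
      5) gp => a y z u v w gp.
    split_factors; split.
    * by invS symrank3P 0%N (2 * a).
    * by invS axial_level3P 0%N (8 * ((a * u + z * v + y * w) * (a * u + z * v + y * w))
        / a).
Qed.

Lemma chart3_111 (C : numClosedFieldType) :
  local_chart 6 (congruent_to (canon3 C v_111)).
Proof.
exists (fun r => let a := rv r 0 in let b := rv r 1 in let c := rv r 2 in let x := rv r 3
    in let y := rv r 4 in let z := rv r 5 in (a * (b * c - x * x) - z * (z * c - x * y) +
    y * (z * x - b * y))),
  (fun r => let a := rv r 0 in let b := rv r 1 in let c := rv r 2 in let x := rv r 3 in
      let y := rv r 4 in let z := rv r 5 in symskew3 a b c x y z 0 0 0),
  (fun A => [:: A e0 e0; A e1 e1; A e2 e2; syment A e1 e2 / 2; syment A e0 e2 / 2; syment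
      A e0 e1 / 2]); split.
- by move=> r; cbv zeta; diff_frac.
- exists (\row_(i < 6) [:: 1; 1; 1; 0; 0; 0]`_i); rewrite !rv_row // /=.
  by apply: (@neq0_eq _ _ (1)); [rewrite ?oppr_eq0 oner_neq0|ring].
- move=> r; cbv beta zeta => gp; split.
  + split_factors; apply: differentiable_M3; split; by diff_frac; rewrite ?mulf_neq0.
  + split_factors.
    by move=> [|[|[|[|[|[|k]]]]]] /=; rewrite ?nth_nil; diff_frac.
  + split_factors; move=> [|[|[|[|[|[|k]]]]]] // _; rewrite /= !mxE /= ?half_sub
      ?half_add;
    by rewrite ?[_ - _ + (_ + _)]addrC ?half_add; fieldx.
  + rewrite congruent_to_canon3; move: (rv r 0) (rv r 1) (rv r 2) (rv r 3) (rv r 4) (rv r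
      5) gp => a b c x y z gp.
    split_factors; split.
    * by invS symrank3P 0%N (8 * (a * (b * c - x * x) - z * (z * c - x * y) + y * (z * x
        - b * y))).
    * by level0.
Qed.

(** In the basis (k/u, e1, e2) the form S / 2 has rows (0, t, p), (t, b, x), (p, x, c), where 0
    expresses k^T S k = 0. The determinant condition is solved for [c] using [t != 0], and returning
    to the standard basis gives [a], [y], [z]. So [t] and [p] are two coordinates of S k divided by
    [u], up to scale, which is how the inverse recovers them; [p b - t x != 0] keeps the rank at
    2. *)
Lemma chart3_0cube (C : numClosedFieldType) :
  local_chart 7 (congruent_to (canon3 C v_0cube)).
Proof.
exists (fun r => let u := rv r 0 in let v := rv r 1 in let w := rv r 2 in let b := rv r 3
    in let x := rv r 4 in let t := rv r 5 in let p := rv r 6 in u * t * (p * b - t * x)),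
  (fun r => let u := rv r 0 in let v := rv r 1 in let w := rv r 2 in let b := rv r 3 in
      let x := rv r 4 in let t := rv r 5 in let p := rv r 6 in symskew3 (- (2 * ((v / u)
      * t)) - 2 * ((w / u) * p) + (v / u) * (v / u) * b + 2 * ((v / u) * (w / u) * x) +
      (w / u) * (w / u) * ((2 * (t * p * x) - p * p * b) / (t * t))) b (((2 * (t * p * x)
      - p * p * b) / (t * t))) x ((p - (v / u) * x - (w / u) * ((2 * (t * p * x) - p * p
      * b) / (t * t)))) ((t - (v / u) * b - (w / u) * x)) u v w),
  (fun A => [:: skewent A e1 e2 / 2; skewent A e2 e0 / 2; skewent A e0 e1 / 2; A e1 e1;
      syment A e1 e2 / 2; syment A e0 e1 / 2 + (skewent A e2 e0 / 2 * A e1 e1 + skewent A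
      e0 e1 / 2 * syment A e1 e2 / 2) / (skewent A e1 e2 / 2); syment A e0 e2 / 2 +
      (skewent A e2 e0 / 2 * syment A e1 e2 / 2 + skewent A e0 e1 / 2 * A e2 e2) /
      (skewent A e1 e2 / 2)]); split.
- by move=> r; cbv zeta; diff_frac.
- exists (\row_(i < 7) [:: 1; 0; 0; 0; 1; 1; 0]`_i); rewrite !rv_row // /=.
  by apply: (@neq0_eq _ _ (- 1)); [rewrite ?oppr_eq0 oner_neq0|ring].
- move=> r; cbv beta zeta => gp; split.
  + split_factors; apply: differentiable_M3; split; by diff_frac; rewrite ?mulf_neq0.
  + split_factors.
    (* The divisor in the last two coordinates of the inverse takes the value [u] along the
       chart. *)
    by move=> [|[|[|[|[|[|[|k]]]]]]] /=; rewrite ?nth_nil; diff_frac; rewrite ?mxE /=;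
        apply: (@neq0_eq _ _ (rv r 0)) => //; fieldx.
  + split_factors; move=> [|[|[|[|[|[|[|k]]]]]]] // _; rewrite /= !mxE /= ?half_sub
      ?half_add;
    by rewrite ?[_ - _ + (_ + _)]addrC ?half_add; fieldx.
  + rewrite congruent_to_canon3; move: (rv r 0) (rv r 1) (rv r 2) (rv r 3) (rv r 4) (rv r
      5) (rv r 6) gp => u v w b x t p gp.
    split_factors; split.
    * by invS symrank3P 0%N (- (4 * ((p * b - t * x) * (p * b - t * x))) / (t * t)).
    * by invS axial_level3P 1%N (4 * (u * t)).
Qed.

Lemma chart3_1sq_1 (C : numClosedFieldType) :
  local_chart 8 (congruent_to (canon3 C v_1sq_1)).
Proof.
exists (fun r => let a := rv r 0 in let b := rv r 1 in let x := rv r 2 in let y := rv r 3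
    in let z := rv r 4 in let u := rv r 5 in let v := rv r 6 in let w := rv r 7 in (a * b
    - z * z) * ((a * b - z * z) * (a * u * u + b * v * v + 2 * (z * u * v)) + 2 * (a * b
    - z * z) * (y * u * w + x * v * w) + (b * y * y + a * x * x - 2 * (x * y * z)) * w *
    w)),
  (fun r => let a := rv r 0 in let b := rv r 1 in let x := rv r 2 in let y := rv r 3 in
      let z := rv r 4 in let u := rv r 5 in let v := rv r 6 in let w := rv r 7 in
      symskew3 a b (((b * y * y + a * x * x - 2 * (x * y * z)) / (a * b - z * z))) x y z
      u v w),
  (fun A => [:: A e0 e0; A e1 e1; syment A e1 e2 / 2; syment A e0 e2 / 2; syment A e0 e1
      / 2; skewent A e1 e2 / 2; skewent A e2 e0 / 2; skewent A e0 e1 / 2]); split.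
- by move=> r; cbv zeta; diff_frac.
- exists (\row_(i < 8) [:: 1; 1; 0; 0; 0; 1; 0; 0]`_i); rewrite !rv_row // /=.
  by apply: (@neq0_eq _ _ (1)); [rewrite ?oppr_eq0 oner_neq0|ring].
- move=> r; cbv beta zeta => gp; split.
  + split_factors; apply: differentiable_M3; split; by diff_frac; rewrite ?mulf_neq0.
  + split_factors.
    by move=> [|[|[|[|[|[|[|[|k]]]]]]]] /=; rewrite ?nth_nil; diff_frac.
  + split_factors; move=> [|[|[|[|[|[|[|[|k]]]]]]]] // _; rewrite /= !mxE /= ?half_sub
      ?half_add;
    by rewrite ?[_ - _ + (_ + _)]addrC ?half_add; fieldx.
  + rewrite congruent_to_canon3; move: (rv r 0) (rv r 1) (rv r 2) (rv r 3) (rv r 4) (rv r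
      5) (rv r 6) (rv r 7) gp => a b x y z u v w gp.
    split_factors; split.
    * by invS symrank3P 2%N (4 * (a * b - z * z)).
    * by invS axial_level3P 0%N (8 * ((a * b - z * z) * (a * u * u + b * v * v + 2 * (z *
        u * v)) + 2 * (a * b - z * z) * (y * u * w + x * v * w) + (b * y * y + a * x * x
        - 2 * (x * y * z)) * w * w) / (a * b - z * z)).
Qed.

(** The equation k^T S k = 0 is linear in [a] and solved for it where [u != 0]. The two other
    factors say that a coordinate of S k and, with the denominator [u^2] cleared, det S do not
    vanish. *)
Lemma chart3_1cube (C : numClosedFieldType) :
  local_chart 8 (congruent_to (canon3 C v_1cube)).
Proof.
exists (fun r => let b := rv r 0 in let c := rv r 1 in let x := rv r 2 in let y := rv r 3
    in let z := rv r 4 in let u := rv r 5 in let v := rv r 6 in let w := rv r 7 in u * (z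
    * u + b * v + x * w) * (- (2 * (z * u * v) + 2 * (y * u * w) + b * v * v + 2 * (x * v
    * w) + c * w * w) * (b * c - x * x) - u * u * (z * (z * c - x * y)) + u * u * (y * (z
    * x - b * y)))),
  (fun r => let b := rv r 0 in let c := rv r 1 in let x := rv r 2 in let y := rv r 3 in
      let z := rv r 4 in let u := rv r 5 in let v := rv r 6 in let w := rv r 7 in
      symskew3 ((- (2 * (z * u * v) + 2 * (y * u * w) + b * v * v + 2 * (x * v * w) + c *
      w * w) / (u * u))) b c x y z u v w),
  (fun A => [:: A e1 e1; A e2 e2; syment A e1 e2 / 2; syment A e0 e2 / 2; syment A e0 e1
      / 2; skewent A e1 e2 / 2; skewent A e2 e0 / 2; skewent A e0 e1 / 2]); split.
- by move=> r; cbv zeta; diff_frac.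
- exists (\row_(i < 8) [:: 0; 1; 0; 0; 1; 1; 0; 0]`_i); rewrite !rv_row // /=.
  by apply: (@neq0_eq _ _ (- 1)); [rewrite ?oppr_eq0 oner_neq0|ring].
- move=> r; cbv beta zeta => gp; split.
  + split_factors; apply: differentiable_M3; split; by diff_frac; rewrite ?mulf_neq0.
  + split_factors.
    by move=> [|[|[|[|[|[|[|[|k]]]]]]]] /=; rewrite ?nth_nil; diff_frac.
  + split_factors; move=> [|[|[|[|[|[|[|[|k]]]]]]]] // _; rewrite /= !mxE /= ?half_sub
      ?half_add;
    by rewrite ?[_ - _ + (_ + _)]addrC ?half_add; fieldx.
  + rewrite congruent_to_canon3; move: (rv r 0) (rv r 1) (rv r 2) (rv r 3) (rv r 4) (rv r
      5) (rv r 6) (rv r 7) gp => b c x y z u v w gp.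
    split_factors; split.
    * by invS symrank3P 0%N (8 * (- (2 * (z * u * v) + 2 * (y * u * w) + b * v * v + 2 *
        (x * v * w) + c * w * w) * (b * c - x * x) - u * u * (z * (z * c - x * y)) + u *
        u * (y * (z * x - b * y))) / (u * u)).
    * by invS axial_level3P 1%N (4 * (z * u + b * v + x * w)).
Qed.

(** Besides det S = 0, solved for [c], k must lie in the kernel of S, which is spanned by the last
    column of the adjugate; [w] fixes the scale. *)
Lemma chart3_B0 (C : numClosedFieldType) :
  local_chart 6 (congruent_to (canon3 C v_B0)).
Proof.
exists (fun r => let a := rv r 0 in let b := rv r 1 in let x := rv r 2 in let y := rv r 3
    in let z := rv r 4 in let w := rv r 5 in w * (a * b - z * z)),
  (fun r => let a := rv r 0 in let b := rv r 1 in let x := rv r 2 in let y := rv r 3 in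
      let z := rv r 4 in let w := rv r 5 in symskew3 a b (((b * y * y + a * x * x - 2 *
      (x * y * z)) / (a * b - z * z))) x y z ((w * (z * x - b * y) / (a * b - z * z)))
      ((w * (z * y - a * x) / (a * b - z * z))) w),
  (fun A => [:: A e0 e0; A e1 e1; syment A e1 e2 / 2; syment A e0 e2 / 2; syment A e0 e1
      / 2; skewent A e0 e1 / 2]); split.
- by move=> r; cbv zeta; diff_frac.
- exists (\row_(i < 6) [:: 1; 1; 0; 0; 0; 1]`_i); rewrite !rv_row // /=.
  by apply: (@neq0_eq _ _ (1)); [rewrite ?oppr_eq0 oner_neq0|ring].
- move=> r; cbv beta zeta => gp; split.
  + split_factors; apply: differentiable_M3; split; by diff_frac; rewrite ?mulf_neq0.
  + split_factors.
    by move=> [|[|[|[|[|[|k]]]]]] /=; rewrite ?nth_nil; diff_frac.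
  + split_factors; move=> [|[|[|[|[|[|k]]]]]] // _; rewrite /= !mxE /= ?half_sub
      ?half_add;
    by rewrite ?[_ - _ + (_ + _)]addrC ?half_add; fieldx.
  + rewrite congruent_to_canon3; move: (rv r 0) (rv r 1) (rv r 2) (rv r 3) (rv r 4) (rv r
      5) gp => a b x y z w gp.
    split_factors; split.
    * by invS symrank3P 2%N (4 * (a * b - z * z)).
    * by invS axial_level3P 2%N (2 * w).
Qed.

Lemma chart3_B1 (C : numClosedFieldType) :
  local_chart 9 (congruent_to (canon3 C v_B1)).
Proof.
exists (fun r => let a := rv r 0 in let b := rv r 1 in let c := rv r 2 in let x := rv r 3
    in let y := rv r 4 in let z := rv r 5 in let u := rv r 6 in let v := rv r 7 in let w
    := rv r 8 in (a * (b * c - x * x) - z * (z * c - x * y) + y * (z * x - b * y)) * ((a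
    * u + z * v + y * w) * u + (z * u + b * v + x * w) * v + (y * u + x * v + c * w) *
    w)),
  (fun r => let a := rv r 0 in let b := rv r 1 in let c := rv r 2 in let x := rv r 3 in
      let y := rv r 4 in let z := rv r 5 in let u := rv r 6 in let v := rv r 7 in let w
      := rv r 8 in symskew3 a b c x y z u v w),
  (fun A => [:: A e0 e0; A e1 e1; A e2 e2; syment A e1 e2 / 2; syment A e0 e2 / 2; syment
      A e0 e1 / 2; skewent A e1 e2 / 2; skewent A e2 e0 / 2; skewent A e0 e1 / 2]); split.
- by move=> r; cbv zeta; diff_frac.
- exists (\row_(i < 9) [:: 1; 1; 1; 0; 0; 0; 1; 0; 0]`_i); rewrite !rv_row // /=.
  by apply: (@neq0_eq _ _ (1)); [rewrite ?oppr_eq0 oner_neq0|ring].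
- move=> r; cbv beta zeta => gp; split.
  + split_factors; apply: differentiable_M3; split; by diff_frac; rewrite ?mulf_neq0.
  + split_factors.
    by move=> [|[|[|[|[|[|[|[|[|k]]]]]]]]] /=; rewrite ?nth_nil; diff_frac.
  + split_factors; move=> [|[|[|[|[|[|[|[|[|k]]]]]]]]] // _; rewrite /= !mxE /= ?half_sub
      ?half_add;
    by rewrite ?[_ - _ + (_ + _)]addrC ?half_add; fieldx.
  + rewrite congruent_to_canon3; move: (rv r 0) (rv r 1) (rv r 2) (rv r 3) (rv r 4) (rv r
      5) (rv r 6) (rv r 7) (rv r 8) gp => a b c x y z u v w gp.
    split_factors; split.
    * by invS symrank3P 0%N (8 * (a * (b * c - x * x) - z * (z * c - x * y) + y * (z * x
        - b * y))).
    * by invS axial_level3P 0%N (8 * ((a * u + z * v + y * w) * u + (z * u + b * v + x *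
        w) * v + (y * u + x * v + c * w) * w)).
Qed.

Lemma local_chart0 (K : numFieldType) n (X : set 'M[K]_n) : X 0 -> local_chart 0 X.
Proof.
move=> X0; exists (fun=> 1), (fun=> 0), (fun=> [::]); split.
- by move=> u; exact: differentiable_cst.
- by exists 0; exact: oner_neq0.
- by move=> u _; split.
Qed.

Lemma canon2_dim (R : realType) v :
  has_complex_dim (congruent_to (canon2 (Cplx R) v)) (dim2 v).
Proof.
split; last first.
  move=> d /(submanifold_dim_le (canon2_tangent (v := v))).
  by case: v.
apply: submanifold_of_chart; case: v.
- by apply: local_chart0; exists 0 => //; exact: congruent_refl.
- exact: chart2_D.
- exact: chart2_I.
- exact: chart2_H.
- exact: chart2_Gamma.
- exact: chart2_B.
Qed.

Lemma canon3_dim (R : realType) v :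
  has_complex_dim (congruent_to (canon3 (Cplx R) v)) (dim3 v).
Proof.
split; last first.
  move=> d /(submanifold_dim_le (canon3_tangent (v := v))).
  by case: v.
apply: submanifold_of_chart; case: v.
- by apply: local_chart0; exists 0 => //; exact: congruent_refl.
- exact: chart3_m1sq_0.
- exact: chart3_100.
- exact: chart3_1sq_0.
- exact: chart3_110.
- exact: chart3_m1sq_1.
- exact: chart3_111.
- exact: chart3_0cube.
- exact: chart3_1sq_1.
- exact: chart3_1cube.
- exact: chart3_B0.
- exact: chart3_B1.
Qed.

Theorem theorem3p5 (R : realType) :
  (* (a) *)
  (let bundle2 := fun v : vertex2 => congruent_to (canon2 (Cplx R) v) in
   [/\ is_closure_graph bundle2 arrow2,
       forall (v : vertex2) (M : 'M[Cplx R]_2),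
         canon2 (Cplx R) v M -> congr_bundle M = bundle2 v,
       determined_up_to_inverse (@H2 (Cplx R))
     & forall v : vertex2, has_complex_dim (bundle2 v) (dim2 v)])
  /\
  (* (b) *)
  (let bundle3 := fun v : vertex3 => congruent_to (canon3 (Cplx R) v) in
   [/\ is_closure_graph bundle3 arrow3,
       forall (v : vertex3) (M : 'M[Cplx R]_3),
         canon3 (Cplx R) v M -> congr_bundle M = bundle3 v,
       determined_up_to_inverse (@HB0 (Cplx R))
         /\ determined_up_to_inverse (@HB1 (Cplx R))
     & forall v : vertex3, has_complex_dim (bundle3 v) (dim3 v)]).
Proof.
split; split.
- exact: closure_graph2.
- by move=> v M vM; apply: congr_bundle2E; exists M => //; exact: congruent_refl.
- exact: H2_parameter.
- exact: canon2_dim.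
- exact: closure_graph3.
- by move=> v M vM; apply: congr_bundle3E; exists M => //; exact: congruent_refl.
- by split; [exact: HB0_parameter|exact: HB1_parameter].
- exact: canon3_dim.
Qed.
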